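(* Let $\mathbb{X}$ be a weighted projective line over a finite field $\mathbf{k}=\mathbb{F}_q$. Let $L,L'$ be line bundles on $\mathbb{X}$, let $S$ be a torsion sheaf and let $S'$ be a torsion sheaf (possibly zero). Then there exists an exact sequence $$0\longrightarrow L\longrightarrow L'\oplus S'\longrightarrow S\longrightarrow 0$$ if and only if $S'$ is (isomorphic to) a subsheaf of $S$ such that there is an exact sequence $$0\longrightarrow L\longrightarrow L'\longrightarrow S/S'\longrightarrow 0.$$ In this case, setting $S''=S/S'$, we have $$F_{SL}^{L'\oplus S'}=|\mathrm{Hom}(L',S')|\cdot F_{S''S'}^{S}\,\frac{a_{S'}a_{S''}}{a_S}.$$ In particular, if $S$ is indecomposable, then (in this case) $$F_{SL}^{L'\oplus S'}=\begin{cases}|\mathrm{Hom}(L,S)|,&\text{if }S\cong S';\\ a_{S'},&\text{if }S\not\cong S'.\end{cases}$$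
   Context: Weighted projective line $\mathbb{X}$ over a field $\mathbf{k}$: given by a weight sequence $(p_1,\dots,p_t)$ of positive integers and distinct points $\lambda_1,\dots,\lambda_t\in\mathbb{P}^1(\mathbf{k})$ normalized so that $\lambda_1=\infty,\lambda_2=0,\lambda_3=1$. $\mathbb{L}$ is the abelian group with generators $\vec{x}_1,\dots,\vec{x}_t$ and relations $p_1\vec{x}_1=\cdots=p_t\vec{x}_t=:\vec{c}$. Let $A=\mathbf{k}[X_1,\dots,X_t]/(f_3,\dots,f_t)$ with $f_i=X_i^{p_i}-X_2^{p_2}+\lambda_iX_1^{p_1}$, $\mathbb{L}$-graded by $\deg X_i=\vec{x}_i$. Then $\mathrm{coh}\,\mathbb{X}=\mathrm{mod}^{\mathbb{L}}(A)/\mathrm{mod}_0^{\mathbb{L}}(A)$, the quotient of finitely generated $\mathbb{L}$-graded $A$-modules by those of finite length; it is a hereditary abelian category. The structure sheaf $\mathcal{O}$ is the image of $A$, and the line bundles are the grading shifts $\mathcal{O}(\vec{x})$, $\vec{x}\in\mathbb{L}$. Torsion sheaves are the finite length objects of $\mathrm{coh}\,\mathbb{X}$. Hall number: $F_{AB}^{M}=|\{X\subseteq M\mid X\cong B,\ M/X\cong A\}|$. For an object $M$, $a_M=|\mathrm{Aut}(M)|$ (so $a_0=1$). In the formula, $S''$ is the quotient of $S$ by a subsheaf isomorphic to $S'$ for which the exact sequence $0\to L\to L'\to S/S'\to0$ exists. *)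

(* Defs.v *)
From HB Require Import structures.
From mathcomp Require Import all_boot all_order all_algebra.
From mathcomp Require Import generic_quotient ring_quotient.
From mathcomp Require Import freeg mpoly.
From mathcomp Require Import boolp classical_sets.

Set Implicit Arguments.
Unset Strict Implicit.
Unset Printing Implicit Defensive.

Import GRing.Theory.
Local Open Scope classical_set_scope.
Local Open Scope quotient_scope.
Local Open Scope ring_scope.

(* The sets counted below may live in the universe of a large category, which
   is above the universe of the sets of classical_sets: they are predicates. *)
Definition has_card (T : Type) (A : T -> Prop) (n : nat) :=
  exists f : 'I_n -> T,
    (forall i j, f i = f j -> i = j) /\ (forall x, A x <-> exists i, f i = x).

Definition finite_card (T : Type) (A : T -> Prop) := exists n, has_card A n.

(* The number of elements of a finite set; junk value 0 on infinite sets. *)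
Definition ncard (T : Type) (A : T -> Prop) : nat :=
  xget 0%N [set n | has_card A n].

Record category := Category {
  obj :> Type;
  mor : obj -> obj -> Type;
  idm : forall X, mor X X;
  compm : forall X Y Z, mor Y Z -> mor X Y -> mor X Z;
  compmA : forall W X Y Z (h : mor Y Z) (g : mor X Y) (f : mor W X),
    compm h (compm g f) = compm (compm h g) f;
  comp1m : forall X Y (f : mor X Y), compm (idm Y) f = f;
  compm1 : forall X Y (f : mor X Y), compm f (idm X) = f
}.

Declare Scope cat_scope.
Delimit Scope cat_scope with cat.
Notation "g \oc f" := (compm g f) (at level 50, left associativity) : cat_scope.
Local Open Scope cat_scope.

Arguments mor {c} X Y.
Arguments idm {c} X.

Section CategoryNotions.
Context {C : category}.
Implicit Types X Y Z M A B P : C.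

Definition is_iso X Y (f : mor X Y) :=
  exists g : mor Y X, g \oc f = idm X /\ f \oc g = idm Y.

Definition iso_obj X Y := exists f : mor X Y, is_iso f.

Definition mono X Y (f : mor X Y) :=
  forall W (g h : mor W X), f \oc g = f \oc h -> g = h.

Definition zero_obj Z :=
  forall X, (exists! f : mor X Z, True) /\ (exists! f : mor Z X, True).

Definition zero_mor X Y (f : mor X Y) :=
  exists Z (u : mor X Z) (v : mor Z Y), zero_obj Z /\ f = v \oc u.

Definition is_kernel X Y Z (f : mor X Y) (g : mor Y Z) :=
  zero_mor (g \oc f) /\
  forall W (h : mor W Y), zero_mor (g \oc h) -> exists! h', f \oc h' = h.

Definition is_cokernel X Y Z (f : mor X Y) (g : mor Y Z) :=
  zero_mor (g \oc f) /\
  forall W (h : mor Y W), zero_mor (h \oc f) -> exists! h', h' \oc g = h.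

(* There is an exact sequence 0 -> B -> M -> A -> 0. *)
Definition short_exact B M A :=
  exists (f : mor B M) (g : mor M A), is_kernel f g /\ is_cokernel f g.

Definition coproduct X Y P (i : mor X P) (j : mor Y P) :=
  forall Z (f : mor X Z) (g : mor Y Z),
    exists! h : mor P Z, h \oc i = f /\ h \oc j = g.

Definition indecomposable M :=
  ~ zero_obj M /\
  forall X Y (i : mor X M) (j : mor Y M),
    coproduct i j -> zero_obj X \/ zero_obj Y.

Definition simple_obj M :=
  ~ zero_obj M /\
  forall X (i : mor X M), mono i -> zero_obj X \/ is_iso i.

Inductive finite_length : C -> Prop :=
| FiniteLength0 M : zero_obj M -> finite_length M
| FiniteLengthS N M T :
    finite_length N -> simple_obj T -> short_exact N M T -> finite_length M.

Definition aut M (f : mor M M) : Prop := is_iso f.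
Arguments aut : clear implicits.

(* A subobject of M is a class of monomorphisms into M for same_subobj. *)
Definition same_subobj M (U V : {X : C & mor X M}) :=
  exists u : mor (projT1 U) (projT1 V),
    is_iso u /\ projT2 U = projT2 V \oc u.

(* The subobjects X of M with X isomorphic to B and M/X isomorphic to A. *)
Definition hall_set A B M (K : {X : C & mor X M} -> Prop) :=
  exists X (i : mor X M), [/\ mono i, iso_obj X B,
    exists Q (q : mor M Q), is_cokernel i q /\ iso_obj Q A &
    K = same_subobj (existT _ X i)].
Arguments hall_set : clear implicits.

Definition hall_number A B M : nat := ncard (hall_set A B M).

Definition card_hom X Y : nat := ncard (fun _ : mor X Y => True).

Definition card_aut M : nat := ncard (aut M).

End CategoryNotions.

Arguments aut {C} M _.
Arguments hall_set {C} A B M _.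

Definition ord_snd {n} : 'I_n.+2 := @Ordinal n.+2 1 isT.

(* The weights are p_1, ..., p_t with t = wl_n.+2, shifted to the indices
   0, ..., t-1.  P^1(k) is option k, with None the point at infinity. *)
Record wpl (k : fieldType) := WPL {
  wl_n : nat;
  wl_weight : 'I_wl_n.+2 -> nat;
  wl_weight_gt0 : forall i, (0 < wl_weight i)%N;
  wl_point : 'I_wl_n.+2 -> option k;
  wl_point_inj : injective wl_point;
  wl_point1 : wl_point ord0 = None;
  wl_point2 : wl_point ord_snd = Some 0;
  wl_point3 : forall i, val i = 2%N -> wl_point i = Some 1
}.

Section WeightedLine.
Variables (k : fieldType) (X : wpl k).
Local Notation t := (wl_n X).+2.
Local Notation p := (@wl_weight k X).

(* The subgroup of Z^t generated by the p_i e_i - p_j e_j. *)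
Definition Lrel : pred 'rV[int]_t := fun v =>
  `[< exists c : 'I_t -> 'I_t -> int,
        v = \sum_i \sum_j (delta_mx 0 i *+ p i - delta_mx 0 j *+ p j) *~ c i j >].

Lemma Lrel_zmod_closed : zmod_closed Lrel.
Proof.
split=> [|u v /asboolP[c ->] /asboolP[d ->]]; apply/asboolP.
  exists (fun _ _ => 0); rewrite big1 // => i _; rewrite big1 //.
exists (fun i j => c i j - d i j).
rewrite -sumrB; apply: eq_bigr => i _; rewrite -sumrB; apply: eq_bigr => j _.
by rewrite mulrzBr.
Qed.

Definition Lsub : zmodClosed 'rV[int]_t :=
  HB.pack Lrel (GRing.isZmodClosed.Build 'rV[int]_t Lrel Lrel_zmod_closed).

Definition LL : zmodType := Quotient.quot Lsub.

Definition xvec (i : 'I_t) : LL :=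
  \pi_(Quotient.quot Lsub) (delta_mx 0 i).

Definition cvec : LL := xvec ord0 *+ p ord0.

Lemma xvec_weight i : xvec i *+ p i = cvec.
Proof.
rewrite /cvec /xvec -!raddfMn; apply/eqP.
rewrite -Quotient.idealrBE; apply/asboolP.
exists (fun i' j' => ((i' == i) && (j' == ord0))%:R).
rewrite (bigD1 i) //= (bigD1 ord0) //= !eqxx !big1 ?addr0 //.
- by move=> j /negbTE jN; rewrite big1 // => j' _; rewrite jN mulr0z.
- by move=> j /negbTE jN; rewrite jN mulr0z.
Qed.

Definition wl_poly : comNzRingType := {mpoly k[t]}.

Definition mdegL (m : 'X_{1..t}) : LL := \sum_i xvec i *+ m i.

(* f_i, meant for the 0-based indices i >= 2, where wl_point i is finite. *)
Definition wl_rel (i : 'I_t) : {mpoly k[t]} :=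
  'X_i ^+ p i - 'X_ord_snd ^+ p ord_snd
  + odflt 0 (wl_point i) *: 'X_ord0 ^+ p ord0.

Definition wl_ideal : pred wl_poly := fun f =>
  `[< exists g : 'I_t -> wl_poly, f = \sum_(i < t | (1 < i)%N) g i * wl_rel i >].

Lemma wl_ideal_closed : idealr_closed wl_ideal.
Proof.
split.
- by apply/asboolP; exists (fun=> 0); rewrite big1 // => i _; rewrite mul0r.
- apply/asboolP => -[g] /(congr1 (meval (fun=> 0))).
  rewrite rmorph1 rmorph_sum big1 => [/eqP|i _]; first by rewrite oner_eq0.
  rewrite rmorphM /= /wl_rel mevalD mevalB mevalZ !rmorphXn /= !mevalXU.
  by rewrite !expr0n !gtn_eqF ?wl_weight_gt0 //= subrr mulr0 addr0 mulr0.
- move=> a u v /asboolP[g ->] /asboolP[h ->]; apply/asboolP.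
  exists (fun i => a * g i + h i); rewrite mulr_sumr -big_split /=.
  by apply: eq_bigr => i _; rewrite mulrDl mulrA.
Qed.

Definition Aideal : idealr wl_poly :=
  HB.pack wl_ideal (isIdealr.Build wl_poly wl_ideal wl_ideal_closed).

Definition AA : comNzRingType := {ideal_quot Aideal}.

Definition Apr (f : wl_poly) : AA := \pi_{ideal_quot Aideal} f.

Definition mhomog (x : LL) (f : {mpoly k[t]}) :=
  {in msupp f, forall m, mdegL m = x}.

Definition Ahomog (x : LL) (a : AA) := exists f, mhomog x f /\ a = Apr f.

End WeightedLine.

Section GradedModules.
Variables (k : fieldType) (X : wpl k).
Local Notation A := (AA X).
Local Notation L := (LL X).

(* A finitely generated L-graded A-module M.  The decomposition of M as the
   direct sum of its M_x is given by its projections hcomp x : M -> M_x. *)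
Record gmod := GMod {
  gcar :> lmodType A;
  hcomp : L -> gcar -> gcar;
  hcompD : forall x, {morph hcomp x : u v / u + v};
  hcompK : forall x y u, hcomp x (hcomp y u) = if x == y then hcomp y u else 0;
  hcomp_sum : forall u, exists s : seq L, uniq s /\ u = \sum_(x <- s) hcomp x u;
  hcompZ : forall x y a u,
    Ahomog x a -> hcomp y u = u -> hcomp (x + y) (a *: u) = a *: u;
  gmod_fg : exists s : seq gcar, forall u, exists c : gcar -> A,
    u = \sum_(v <- s) c v *: v
}.

Definition gsub (M : gmod) (U : set M) :=
  [/\ U 0, forall u v, U u -> U v -> U (u + v),
      forall a u, U u -> U (a *: u) & forall x u, U u -> U (hcomp x u)].

(* V/U is simple in the category of graded modules. *)
Definition gcover (M : gmod) (U V : set M) :=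
  [/\ gsub U, gsub V, U `<=` V, U <> V &
      forall W, gsub W -> U `<=` W -> W `<=` V -> W = U \/ W = V].

(* V/U has finite length in the category of graded modules. *)
Inductive gflen (M : gmod) (U : set M) : set M -> Prop :=
| GFlen0 : gsub U -> gflen U U
| GFlenS V W : gflen U V -> gcover V W -> gflen U W.

(* R is a graded submodule of the direct sum of M and N. *)
Definition gcorr (M N : gmod) (R : M -> N -> Prop) :=
  [/\ R 0 0, forall u v u' v', R u v -> R u' v' -> R (u + u') (v + v'),
      forall a u v, R u v -> R (a *: u) (a *: v) &
      forall x u v, R u v -> R (hcomp x u) (hcomp x v)].

Definition rimg (M N : gmod) (R : M -> N -> Prop) (U : set M) : set N :=
  [set v | exists2 u, U u & R u v].

Definition rinv (M N : gmod) (R : M -> N -> Prop) : N -> M -> Prop :=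
  fun v u => R u v.

Definition rdom (M N : gmod) (R : M -> N -> Prop) : set M :=
  [set u | exists v, R u v].

Definition rcomp (M N P : gmod) (S : N -> P -> Prop) (R : M -> N -> Prop)
  : M -> P -> Prop := fun u w => exists2 v, R u v & S v w.

(* A representative (M', N', f : M' -> N/N') of an element of the colimit of
   the Hom(M', N/N') over the M' and N' with M/M' and N' of finite length.
   The homomorphism f is given by the graph {(u, v) | u \in M', f u = v + N'},
   from which M' and N' are recovered as rdom fcorr and fcorr 0. *)
Record frac (M N : gmod) := Frac {
  fcorr : M -> N -> Prop;
  fcorr_gcorr : gcorr fcorr;
  fcorr_dom : gflen (rdom fcorr) setT;
  fcorr_ind : gflen [set 0] (fcorr 0)
}.

(* Equality in the colimit: f and g induce the same map M3 -> N/N3.  The last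
   clause, at u = 0, forces fcorr f 0 and fcorr g 0 to be contained in N3. *)
Definition frac_eqv (M N : gmod) (f g : frac M N) :=
  exists (M3 : set M) (N3 : set N),
  [/\ gflen M3 setT, gflen [set 0] N3,
      M3 `<=` rdom (fcorr f), M3 `<=` rdom (fcorr g) &
      forall u v w, M3 u -> fcorr f u v -> fcorr g u w -> N3 (v - w)].

Section Lemmas.
Variables M N P : gmod.
Implicit Types (U V W : set M) (R : M -> N -> Prop).

Lemma gsub0 U : gsub U -> U 0.
Proof. by case. Qed.

Lemma gsubD U u v : gsub U -> U u -> U v -> U (u + v).
Proof. by case=> ? H ? ?; apply: H. Qed.

Lemma gsubN U u : gsub U -> U u -> U (- u).
Proof. by case=> ? ? H ? ?; rewrite -scaleN1r; apply: H. Qed.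

Lemma gsubB U u v : gsub U -> U u -> U v -> U (u - v).
Proof. by move=> HU Hu Hv; apply: gsubD => //; apply: gsubN. Qed.

Lemma hcomp0 (x : L) : hcomp x (0 : M) = 0.
Proof. by apply: (addIr (hcomp x (0 : M))); rewrite -hcompD !add0r. Qed.

Lemma gsubT : gsub [set: M]. Proof. by []. Qed.

Lemma gsub_set0 : gsub [set 0 : M].
Proof.
split=> //= [u v -> ->|a u ->|x u ->]; first by rewrite addr0.
  by rewrite scaler0.
exact: hcomp0.
Qed.

Lemma gcorrB R u v u' v' : gcorr R -> R u v -> R u' v' -> R (u - u') (v - v').
Proof.
case=> _ RD RZ _ Ruv Ruv'; apply: RD => //.
by rewrite -[- u']scaleN1r -[- v']scaleN1r; apply: RZ.
Qed.

Lemma gcorr_rinv R : gcorr R -> gcorr (rinv R).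
Proof.
case=> R0 RD RZ Rh; split=> //; rewrite /rinv => *; [exact: RD|exact: RZ|exact: Rh].
Qed.

Lemma gsub_rimg R U : gcorr R -> gsub U -> gsub (rimg R U).
Proof.
case=> R0 RD RZ Rh [U0 UD UZ Uh]; split.
- by exists 0.
- by move=> u v [u' ? ?] [v' ? ?]; exists (u' + v'); [apply: UD|apply: RD].
- by move=> a u [u' ? ?]; exists (a *: u'); [apply: UZ|apply: RZ].
- by move=> x u [u' ? ?]; exists (hcomp x u'); [apply: Uh|apply: Rh].
Qed.

Lemma gsub_rdom R : gcorr R -> gsub (rdom R).
Proof.
case=> R0 RD RZ Rh; split.
- by exists 0.
- by move=> u v [u' ?] [v' ?]; exists (u' + v'); apply: RD.
- by move=> a u [u' ?]; exists (a *: u'); apply: RZ.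
- by move=> x u [u' ?]; exists (hcomp x u'); apply: Rh.
Qed.

Lemma gsubI U V : gsub U -> gsub V -> gsub (U `&` V).
Proof.
case=> U0 UD UZ Uh [V0 VD VZ Vh]; split=> //=.
- by move=> u v [? ?] [? ?]; split; [apply: UD|apply: VD].
- by move=> a u [? ?]; split; [apply: UZ|apply: VZ].
- by move=> x u [? ?]; split; [apply: Uh|apply: Vh].
Qed.

Definition gadd U V : set M := [set w | exists u v, [/\ U u, V v & w = u + v]].

Lemma gsub_gadd U V : gsub U -> gsub V -> gsub (gadd U V).
Proof.
case=> U0 UD UZ Uh [V0 VD VZ Vh]; split=> /=.
- by exists 0, 0; split=> //; rewrite addr0.
- move=> _ _ [u [v [? ? ->]]] [u' [v' [? ? ->]]].
  by exists (u + u'), (v + v'); split; [apply: UD|apply: VD|rewrite addrACA].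
- move=> a _ [u [v [? ? ->]]].
  by exists (a *: u), (a *: v); split; [apply: UZ|apply: VZ|rewrite scalerDr].
- move=> x _ [u [v [? ? ->]]].
  by exists (hcomp x u), (hcomp x v); split; [apply: Uh|apply: Vh|rewrite hcompD].
Qed.

Lemma gaddl U V : gsub V -> U `<=` gadd U V.
Proof. by move=> [V0 _ _ _] u Uu; exists u, 0; split=> //; rewrite addr0. Qed.

Lemma gaddr U V : gsub U -> V `<=` gadd U V.
Proof. by move=> [V0 _ _ _] u Uu; exists 0, u; split=> //; rewrite add0r. Qed.

Lemma gflen_gsubl U V : gflen U V -> gsub U.
Proof. by elim. Qed.

Lemma gflen_gsubr U V : gflen U V -> gsub V.
Proof. by elim=> // ? ? _ _ []. Qed.

Lemma gflen_trans U V W : gflen U V -> gflen V W -> gflen U W.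
Proof. by move=> UV; elim=> // V' W' _ IH; apply: GFlenS. Qed.

End Lemmas.

Lemma rimg_cover (M N : gmod) (R : M -> N -> Prop) (U V : set M) :
  gcorr R -> gcover U V ->
  rimg R U = rimg R V \/ gcover (rimg R U) (rimg R V).
Proof.
move=> gR [gU gV UV _ cov].
have UV' : rimg R U `<=` rimg R V by move=> y [u Uu Ruy]; exists u => //; apply: UV.
case: (pselect (rimg R U = rimg R V)) => [|neq]; [by left|right].
split=> //; [exact: gsub_rimg|exact: gsub_rimg|].
move=> W gW UW WV.
have gZ : gsub (rimg (rinv R) W `&` V).
  by apply: gsubI => //; apply: gsub_rimg => //; apply: gcorr_rinv.
case: (cov (gadd U (rimg (rinv R) W `&` V))).
- exact: gsub_gadd.
- exact: gaddl.
- move=> _ [u [v [Uu [_ Vv] ->]]]; apply: gsubD => //; exact: UV.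
- move=> E; left; apply/seteqP; split=> // w Ww.
  have [v Vv Rvw] := WV _ Ww.
  exists v => //; rewrite -E; apply: gaddr => //; split=> //; by exists w.
- move=> E; right; apply/seteqP; split=> // y [v Vv Rvy].
  move: Vv; rewrite -E => -[u [z [Uu [[w Ww Rzw] Vz] vE]]].
  rewrite -(subrK w y); apply: gsubD => //; apply: UW; exists u => //.
  have -> : u = v - z by rewrite vE addrK.
  exact: gcorrB.
Qed.

Lemma rimg_gflen (M N : gmod) (R : M -> N -> Prop) (U V : set M) :
  gcorr R -> gflen U V -> gflen (rimg R U) (rimg R V).
Proof.
move=> gR; elim=> [gU|V' W _ IH cov]; first by apply: GFlen0; apply: gsub_rimg.
by have [<-//|] := rimg_cover gR cov; apply: GFlenS.
Qed.

Section Lemmas2.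
Variables M N P : gmod.
Implicit Types (U V W : set M) (R : M -> N -> Prop).

Lemma gflenI U V W : gsub W -> gflen U V -> gflen (U `&` W) (V `&` W).
Proof.
move=> gW UV; pose R (u v : M) := u = v /\ W u.
have gR : gcorr R.
  case: (gW) => W0 WD WZ Wh; split=> //=.
  - by move=> u v u' v' [-> ?] [-> ?]; split=> //; apply: WD.
  - by move=> a u v [-> ?]; split=> //; apply: WZ.
  - by move=> x u v [-> ?]; split=> //; apply: Wh.
have E Z : rimg R Z = Z `&` W.
  by apply/seteqP; split=> [v [u Zu [<-]]|v [Zv Wv]] //; exists v.
by rewrite -!E; apply: rimg_gflen.
Qed.

Lemma gflen_gadd U V W : gsub W -> gflen U V -> gflen (gadd U W) (gadd V W).
Proof.
move=> gW UV; pose R (u v : M) := W (v - u).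
have gR : gcorr R.
  case: (gW) => W0 WD WZ Wh; split=> //=; rewrite /R.
  - by rewrite subr0.
  - by move=> u v u' v' ? ?; rewrite opprD addrACA; apply: WD.
  - by move=> a u v ?; rewrite -scalerBr; apply: WZ.
  - move=> x u v ?.
    suff -> : hcomp x v - hcomp x u = hcomp x (v - u) by apply: Wh.
    by apply: (addIr (hcomp x u)); rewrite subrK -hcompD subrK.
have E Z : rimg R Z = gadd Z W.
  apply/seteqP; split=> [v [u Zu Ruv]|_ [u [w [Zu Ww ->]]]].
    by exists u, (v - u); split=> //; rewrite addrC subrK.
  by exists u => //; rewrite /R addrC addKr.
by rewrite -!E; apply: rimg_gflen.
Qed.

Lemma gflen_sub U U' V' V : gsub U' -> gsub V' -> U `<=` U' -> U' `<=` V' ->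
  V' `<=` V -> gflen U V -> gflen U' V'.
Proof.
move=> gU' gV' UU' UV' VV' flUV.
have gU := gflen_gsubl flUV.
have := gflen_gadd gU' (gflenI gV' flUV).
rewrite (_ : gadd _ U' = U'); last first.
  apply/seteqP; split=> [_ [u [v [[Uu _] Uv ->]]]|].
    by apply: gsubD => //; apply: UU'.
  by apply: gaddr; apply: gsubI.
rewrite (_ : gadd _ U' = V') //.
apply/seteqP; split=> [_ [u [v [[_ Uu] Uv ->]]]|v Vv].
  by apply: gsubD => //; apply: UV'.
by apply: gaddl => //; split=> //; apply: VV'.
Qed.

Lemma gflenIT U V : gflen U setT -> gflen V setT -> gflen (U `&` V) setT.
Proof.
move=> flU flV; have := gflenI (gflen_gsubl flV) flU.
by rewrite setTI => /gflen_trans; apply.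
Qed.

Lemma gflen0_gadd U V : gflen [set 0] U -> gflen [set 0] V ->
  gflen [set 0] (gadd U V).
Proof.
move=> flU flV; have := gflen_gadd (gflen_gsubr flV) flU.
rewrite (_ : gadd _ _ = V); first exact: gflen_trans.
apply/seteqP; split=> [_ [_ [v [-> Vv ->]]]|v Vv]; first by rewrite add0r.
by exists 0, v; split=> //; rewrite add0r.
Qed.

End Lemmas2.

Lemma gcorr_id (M : gmod) : gcorr (fun u v : M => u = v).
Proof. by split=> // [u v u' v' -> ->|a u v ->|x u v ->]. Qed.

Lemma fid_dom (M : gmod) : gflen (rdom (fun u v : M => u = v)) setT.
Proof.
rewrite (_ : rdom _ = setT); first exact/GFlen0/gsubT.
by apply/seteqP; split=> // u _; exists u.
Qed.

Lemma fid_ind (M : gmod) : gflen [set 0] (fun v : M => 0 = v).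
Proof.
rewrite (_ : (fun v => _) = [set 0]); first exact/GFlen0/gsub_set0.
by apply/seteqP; split=> v /=.
Qed.

Definition fid (M : gmod) : frac M M := Frac (gcorr_id M) (fid_dom M) (fid_ind M).

Section Composition.
Variables M N P : gmod.

Lemma gcorr_rcomp (S : N -> P -> Prop) (R : M -> N -> Prop) :
  gcorr S -> gcorr R -> gcorr (rcomp S R).
Proof.
case=> S0 SD SZ Sh [R0 RD RZ Rh]; split.
- by exists 0.
- move=> u w u' w' [v ? ?] [v' ? ?].
  by exists (v + v'); [apply: RD|apply: SD].
- by move=> a u w [v ? ?]; exists (a *: v); [apply: RZ|apply: SZ].
- by move=> x u w [v ? ?]; exists (hcomp x v); [apply: Rh|apply: Sh].
Qed.

Lemma fpre (f : frac M N) (V : set N) :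
  gflen V setT -> gflen (rimg (rinv (fcorr f)) V) setT.
Proof.
move=> /(rimg_gflen (gcorr_rinv (fcorr_gcorr f))) /gflen_trans; apply.
rewrite (_ : rimg _ _ = rdom (fcorr f)); first exact: fcorr_dom.
by apply/seteqP; split=> u [v]; exists v.
Qed.

Lemma fimg (f : frac M N) (U : set M) :
  gflen [set 0] U -> gflen [set 0] (rimg (fcorr f) U).
Proof.
move=> /(rimg_gflen (fcorr_gcorr f)); apply: gflen_trans.
rewrite (_ : rimg _ _ = fcorr f 0); first exact: fcorr_ind.
by apply/seteqP; split=> [v [_ -> //]|v ?]; exists 0.
Qed.

End Composition.

Section Composition2.
Variables M N P : gmod.
Variables (g : frac N P) (f : frac M N).

Lemma fcomp_dom : gflen (rdom (rcomp (fcorr g) (fcorr f))) setT.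
Proof.
rewrite (_ : rdom _ = rimg (rinv (fcorr f)) (rdom (fcorr g))).
  by apply: fpre; apply: fcorr_dom.
apply/seteqP; split=> u; first by move=> [w [v ? ?]]; exists v => //; exists w.
by move=> [v [w ?] ?]; exists w, v.
Qed.

Lemma fcomp_ind : gflen [set 0] (rcomp (fcorr g) (fcorr f) 0).
Proof. by apply: (fimg g); apply: fcorr_ind. Qed.

Definition fcomp : frac M P :=
  Frac (gcorr_rcomp (fcorr_gcorr g) (fcorr_gcorr f)) fcomp_dom fcomp_ind.

End Composition2.

Section FracEqv.
Variables M N : gmod.
Implicit Types f g h : frac M N.

Lemma frac_eqv_ext f g : (forall u v, fcorr f u v <-> fcorr g u v) -> frac_eqv f g.
Proof.
move=> fg; exists (rdom (fcorr f)), (fcorr f 0); split=> //.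
- exact: fcorr_dom.
- exact: fcorr_ind.
- by move=> u [v /fg ?]; exists v.
- move=> u v w _ fuv /fg fuw.
  by have := gcorrB (fcorr_gcorr f) fuv fuw; rewrite subrr.
Qed.

Lemma frac_eqv_refl f : frac_eqv f f. Proof. exact: frac_eqv_ext. Qed.

Lemma frac_eqv_sym f g : frac_eqv f g -> frac_eqv g f.
Proof.
move=> [U [V [flU flV Uf Ug E]]]; exists U, V; split=> // u v w Uu guv fuw.
by rewrite -opprB; apply: gsubN (E _ _ _ _ fuw guv) => //; apply: gflen_gsubr flV.
Qed.

Lemma frac_eqv_trans g f h : frac_eqv f g -> frac_eqv g h -> frac_eqv f h.
Proof.
move=> [U [V [flU flV Uf Ug E]]] [U' [V' [flU' flV' Ug' Uh E']]].
exists (U `&` U'), (gadd V V'); split.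
- exact: gflenIT.
- exact: gflen0_gadd.
- by move=> u [/Uf].
- by move=> u [_ /Uh].
- move=> u v w [Uu Uu'] fuv huw; have [z guz] := Ug _ Uu.
  exists (v - z), (z - w); split; [exact: E guz|exact: E' huw|].
  by rewrite addrA subrK.
Qed.

End FracEqv.

Section FracEqvComp.
Variables M N P : gmod.

Lemma fcomp_eqvr (g : frac N P) (f f' : frac M N) :
  frac_eqv f f' -> frac_eqv (fcomp g f) (fcomp g f').
Proof.
move=> [U [V [flU flV Uf Ug E]]].
exists (rdom (fcorr (fcomp g f)) `&` (rdom (fcorr (fcomp g f')) `&` U)).
exists (rimg (fcorr g) V); split.
- by do 2!(apply: gflenIT => //; first exact: fcorr_dom).
- exact: fimg.
- by move=> u [].
- by move=> u [_ []].
- move=> u w w' [_ [_ Uu]] [v fuv gvw] [v' fuv' gvw'].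
  by exists (v - v'); [apply: E fuv fuv'|apply: gcorrB => //; apply: fcorr_gcorr].
Qed.

Lemma fcomp_eqvl (g g' : frac N P) (f : frac M N) :
  frac_eqv g g' -> frac_eqv (fcomp g f) (fcomp g' f).
Proof.
move=> [U [V [flU flV Uf Ug E]]].
exists (rimg (rinv (fcorr f)) U).
exists (gadd V (gadd (fcorr (fcomp g f) 0) (fcorr (fcomp g' f) 0))); split.
- exact: fpre.
- by apply: gflen0_gadd => //; apply: gflen0_gadd; apply: fcorr_ind.
- by move=> u [v Uv fuv]; have [w ?] := Uf _ Uv; exists w, v.
- by move=> u [v Uv fuv]; have [w ?] := Ug _ Uv; exists w, v.
- move=> u w w' [z Uz fuz] [v fuv gvw] [v' fuv' gvw'].
  have [y gzy] := Uf _ Uz; have [y' gzy'] := Ug _ Uz.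
  exists (y - y'), ((w - y) + (y' - w')); split; first exact: E gzy gzy'.
    exists (w - y), (y' - w'); split=> //.
      exists (v - z); last by apply: gcorrB => //; apply: fcorr_gcorr.
      by have := gcorrB (fcorr_gcorr f) fuv fuz; rewrite subrr.
    exists (z - v'); last by apply: gcorrB => //; apply: fcorr_gcorr.
    by have := gcorrB (fcorr_gcorr f) fuz fuv'; rewrite subrr.
  by rewrite [RHS]addrA [y - y' + _]addrC !subrKA.
Qed.

End FracEqvComp.

Section Hom.
Variables M N : gmod.

HB.instance Definition _ := gen_eqMixin (frac M N).
HB.instance Definition _ := gen_choiceMixin (frac M N).

Definition frac_eqvb (f g : frac M N) : bool := `[< frac_eqv f g >].

Lemma frac_eqvb_refl : reflexive frac_eqvb.
Proof. by move=> f; apply/asboolP/frac_eqv_refl. Qed.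

Lemma frac_eqvb_sym : ssrbool.symmetric frac_eqvb.
Proof. by move=> f g; apply/asboolP/asboolP => /frac_eqv_sym. Qed.

Lemma frac_eqvb_trans : transitive frac_eqvb.
Proof.
by move=> g f h /asboolP fg /asboolP gh; apply/asboolP/(frac_eqv_trans fg gh).
Qed.

Canonical frac_equiv :=
  EquivRel frac_eqvb frac_eqvb_refl frac_eqvb_sym frac_eqvb_trans.

Definition qhom := {eq_quot frac_equiv}.

Definition qpi (f : frac M N) : qhom := \pi_qhom f.

Lemma qpiP f g : qpi f = qpi g <-> frac_eqv f g.
Proof.
split=> [/eqP|fg]; first by rewrite /qpi piE => /asboolP.
by apply/eqP; rewrite /qpi piE; apply/asboolP.
Qed.

End Hom.

Definition qcomp (M N P : gmod) (g : qhom N P) (f : qhom M N) : qhom M P :=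
  qpi (fcomp (repr g) (repr f)).

Lemma qcomp_pi (M N P : gmod) (g : frac N P) (f : frac M N) :
  qcomp (qpi g) (qpi f) = qpi (fcomp g f).
Proof.
apply/qpiP; apply: (@frac_eqv_trans _ _ (fcomp (repr (qpi g)) f)).
  by apply: fcomp_eqvr; apply/qpiP; rewrite /qpi reprK.
by apply: fcomp_eqvl; apply/qpiP; rewrite /qpi reprK.
Qed.

Lemma qpi_surj (M N : gmod) (f : qhom M N) : exists f', f = qpi f'.
Proof. by exists (repr f); rewrite /qpi reprK. Qed.

Lemma qcompA (M N P Q : gmod) (h : qhom P Q) (g : qhom N P) (f : qhom M N) :
  qcomp h (qcomp g f) = qcomp (qcomp h g) f.
Proof.
have [h' ->] := qpi_surj h; have [g' ->] := qpi_surj g.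
have [f' ->] := qpi_surj f; rewrite !qcomp_pi; apply/qpiP/frac_eqv_ext => u z.
by split=> [[w [v ? ?] ?]|[v ? [w ? ?]]]; [exists v => //|exists w => //];
   [exists w|exists v].
Qed.

Lemma qcomp1m (M N : gmod) (f : qhom M N) : qcomp (qpi (fid N)) f = f.
Proof.
have [f' ->] := qpi_surj f; rewrite qcomp_pi; apply/qpiP/frac_eqv_ext => u z.
by split=> [[v fuv <-]|] //; exists z.
Qed.

Lemma qcompm1 (M N : gmod) (f : qhom M N) : qcomp f (qpi (fid M)) = f.
Proof.
have [f' ->] := qpi_surj f; rewrite qcomp_pi; apply/qpiP/frac_eqv_ext => u z.
by split=> [[v <-]|] //; exists u.
Qed.

Definition coh : category :=
  @Category gmod qhom (fun M => qpi (fid M)) qcomp qcompA qcomp1m qcompm1.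

Lemma hcomp_out (M : gmod) (u : M) (s : seq L) x :
  uniq s -> u = \sum_(y <- s) hcomp y u -> x \notin s -> hcomp x u = 0.
Proof.
move=> us {1}-> xs; rewrite (big_morph (hcomp x) (hcompD x) (hcomp0 _ x)).
rewrite big_seq big1 // => y ys; rewrite hcompK; case: eqP => // xy.
by rewrite xy ys in xs.
Qed.

Lemma hcomp_sum_sub (M : gmod) (u : M) (s s' : seq L) :
  uniq s -> uniq s' -> {subset s <= s'} ->
  u = \sum_(y <- s) hcomp y u -> u = \sum_(y <- s') hcomp y u.
Proof.
move=> us us' ss' uE; rewrite (bigID (mem s)) /= [X in _ + X]big1 => [|y ys].
  rewrite addr0 -big_filter {1}uE; apply: perm_big; apply: uniq_perm => //.
    exact: filter_uniq.
  move=> y; rewrite mem_filter; case ys: (y \in s) => //=.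
  by rewrite (ss' _ ys).
exact: hcomp_out us uE ys.
Qed.

Section DirectSum.
Variables M N : gmod.
Let T : lmodType A := (M * N)%type.
Let hc (x : L) (u : T) : T := (hcomp x u.1, hcomp x u.2).

Fact dsum_hcompD x : {morph hc x : u v / u + v}.
Proof. by move=> u v; rewrite /hc /= !hcompD. Qed.

Fact dsum_hcompK x y u : hc x (hc y u) = if x == y then hc y u else 0.
Proof. by rewrite /hc /= !hcompK; case: eqP. Qed.

Fact dsum_hcomp_sum u :
  exists s : seq L, uniq s /\ u = \sum_(x <- s) hc x u.
Proof.
have [s1 [us1 E1]] := hcomp_sum u.1; have [s2 [us2 E2]] := hcomp_sum u.2.
exists (undup (s1 ++ s2)); split; first exact: undup_uniq.
rewrite [LHS]surjective_pairing [RHS]surjective_pairing.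
congr (_, _).
  rewrite (raddf_sum fst); apply: hcomp_sum_sub us1 _ _ E1 => [|y y1].
    exact: undup_uniq.
  by rewrite mem_undup mem_cat y1.
rewrite (raddf_sum snd); apply: hcomp_sum_sub us2 _ _ E2 => [|y y2].
  exact: undup_uniq.
by rewrite mem_undup mem_cat y2 orbT.
Qed.

Fact dsum_hcompZ x y a u :
  Ahomog x a -> hc y u = u -> hc (x + y) (a *: u) = a *: u.
Proof.
move=> ha; rewrite /hc; case: u => u v /= [Eu Ev].
by rewrite !(hcompZ ha).
Qed.

Fact dsum_fg : exists s : seq T, forall u, exists c : T -> A,
  u = \sum_(v <- s) c v *: v.
Proof.
have [s1 S1] := gmod_fg M; have [s2 S2] := gmod_fg N.
exists ([seq (u, 0) | u <- s1] ++ [seq (0, v) | v <- s2 & v != 0]) => -[u v].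
have [c1 E1] := S1 u; have [c2 E2] := S2 v.
exists (fun w => if w.2 == 0 then c1 w.1 else c2 w.2).
rewrite big_cat !big_map big_filter /=.
under eq_bigr do rewrite eqxx.
under [X in _ + X]eq_bigr => w wN0 do rewrite (negPf wN0).
rewrite [LHS]surjective_pairing [RHS]surjective_pairing /=.
rewrite !(raddf_sum fst) !(raddf_sum snd) /=; congr (_, _).
  rewrite [X in _ + X]big1 => [|w _]; last by rewrite scaler0.
  by rewrite addr0.
rewrite big1 => [|w _]; last by rewrite scaler0.
rewrite add0r {1}E2 (bigID (fun w => w == 0)) /= big1 ?add0r // => w /eqP ->.
by rewrite scaler0.
Qed.

Definition dsum : gmod :=
  GMod dsum_hcompD dsum_hcompK dsum_hcomp_sum dsum_hcompZ dsum_fg.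

Section Injections.

Let rl (u : M) (w : dsum) : Prop := w = (u, 0).
Let rr (v : N) (w : dsum) : Prop := w = (0, v).

Fact rl_gcorr : gcorr rl.
Proof.
rewrite /rl; split=> // [u v u' v' -> ->|a u v ->|x u v ->].
- by congr (_, _); rewrite addr0.
- by congr (_, _); rewrite scaler0.
- by congr (_, _); rewrite hcomp0.
Qed.

Fact rr_gcorr : gcorr rr.
Proof.
rewrite /rr; split=> // [u v u' v' -> ->|a u v ->|x u v ->].
- by congr (_, _); rewrite addr0.
- by congr (_, _); rewrite scaler0.
- by congr (_, _); rewrite hcomp0.
Qed.

Fact rl_dom : gflen (rdom rl) setT.
Proof.
rewrite (_ : rdom _ = setT); first exact/GFlen0/gsubT.
by apply/seteqP; split=> // u _; exists (u, 0).
Qed.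

Fact rr_dom : gflen (rdom rr) setT.
Proof.
rewrite (_ : rdom _ = setT); first exact/GFlen0/gsubT.
by apply/seteqP; split=> // u _; exists (0, u).
Qed.

Fact rl_ind : gflen [set 0] (rl 0).
Proof. exact/GFlen0/gsub_set0. Qed.

Fact rr_ind : gflen [set 0] (rr 0).
Proof. exact/GFlen0/gsub_set0. Qed.

Definition finl : frac M dsum := Frac rl_gcorr rl_dom rl_ind.
Definition finr : frac N dsum := Frac rr_gcorr rr_dom rr_ind.

End Injections.

Section Copair.
Variables (Z : gmod).

Fact dsum_cofin (U : set M) (V : set N) : gflen U setT -> gflen V setT ->
  gflen [set w : dsum | U w.1 /\ V w.2] setT.
Proof.
move=> flU flV.
have g1 : gcorr (fun (u : M) (w : dsum) => w.1 = u).
  by split=> //= [u v u' v' <- <-|a u v <-|x u v <-].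
have g2 : gcorr (fun (u : N) (w : dsum) => w.2 = u).
  by split=> //= [u v u' v' <- <-|a u v <-|x u v <-].
have T1 : rimg (fun (u : M) (w : dsum) => w.1 = u) setT = setT.
  by apply/seteqP; split=> // w _; exists w.1.
have T2 : rimg (fun (u : N) (w : dsum) => w.2 = u) setT = setT.
  by apply/seteqP; split=> // w _; exists w.2.
have := gflenIT (eq_ind _ (gflen _) (rimg_gflen g1 flU) _ T1)
                (eq_ind _ (gflen _) (rimg_gflen g2 flV) _ T2).
congr (gflen _ _); apply/seteqP; split=> [w [[u Uu wu] [v Vv wv]]|w [Uw Vw]].
  by split; [rewrite wu|rewrite wv].
by split; [exists w.1|exists w.2].
Qed.

Section Rel.
Variables (f : frac M Z) (g : frac N Z).

Let rc (w : dsum) (z : Z) : Prop :=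
  exists z1 z2, [/\ fcorr f w.1 z1, fcorr g w.2 z2 & z = z1 + z2].

Fact rc_gcorr : gcorr rc.
Proof.
have [f0 fD fZ fh] := fcorr_gcorr f; have [g0 gD gZ gh] := fcorr_gcorr g; split.
- by exists 0, 0; split=> //; rewrite addr0.
- move=> u v u' v' [z1 [z2 [? ? ->]]] [y1 [y2 [? ? ->]]].
  by exists (z1 + y1), (z2 + y2); split; [apply: fD|apply: gD|rewrite addrACA].
- move=> a u v [z1 [z2 [? ? ->]]].
  by exists (a *: z1), (a *: z2); split; [apply: fZ|apply: gZ|rewrite scalerDr].
- move=> x u v [z1 [z2 [? ? ->]]].
  by exists (hcomp x z1), (hcomp x z2); split; [apply: fh|apply: gh|rewrite hcompD].
Qed.

Fact rc_dom : gflen (rdom rc) setT.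
Proof.
have := dsum_cofin (fcorr_dom f) (fcorr_dom g).
congr (gflen _ _); apply/seteqP; split=> [w [[z1 ?] [z2 ?]]|w].
  by exists (z1 + z2), z1, z2.
by move=> [_ [z1 [z2 [? ? _]]]]; split; [exists z1|exists z2].
Qed.

Fact rc_ind : gflen [set 0] (rc 0).
Proof. exact: (gflen0_gadd (fcorr_ind f) (fcorr_ind g)). Qed.

Definition fcopair : frac dsum Z := Frac rc_gcorr rc_dom rc_ind.

End Rel.
End Copair.

Lemma dsum_coproduct :
  coproduct (qpi finl : @mor coh M dsum) (qpi finr : @mor coh N dsum).
Proof.
move=> Z f0 g0; have [f ->] := qpi_surj f0; have [g ->] := qpi_surj g0.
exists (qpi (fcopair f g)); split.
  rewrite /= !qcomp_pi; split; apply/qpiP; apply: frac_eqv_sym.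
  - exists (rdom (fcorr f)), (gadd (fcorr f 0) (fcorr g 0)).
    have [f00 _ _ _] := fcorr_gcorr f; have [g00 _ _ _] := fcorr_gcorr g.
    split=> //; first exact: fcorr_dom.
    + by apply: gflen0_gadd; apply: fcorr_ind.
    + move=> u [z fuz]; exists z, (u, 0) => //.
      by exists z, 0; split=> //; rewrite addr0.
    + move=> u v w _ fuv [_ -> [z1 [z2 /= [fuz gz ->]]]].
      exists (v - z1), (- z2); split; last by rewrite opprD addrA.
        by have := gcorrB (fcorr_gcorr f) fuv fuz; rewrite subrr.
      by have := gcorrB (fcorr_gcorr g) g00 gz; rewrite subrr sub0r.
  - exists (rdom (fcorr g)), (gadd (fcorr f 0) (fcorr g 0)).
    have [f00 _ _ _] := fcorr_gcorr f; have [g00 _ _ _] := fcorr_gcorr g.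
    split=> //; first exact: fcorr_dom.
    + by apply: gflen0_gadd; apply: fcorr_ind.
    + move=> u [z guz]; exists z, (0, u) => //.
      by exists 0, z; split=> //; rewrite add0r.
    + move=> u v w _ guv [_ -> [z1 [z2 /= [fz guz ->]]]].
      exists (- z1), (v - z2); split; last by rewrite opprD addrCA.
        by have := gcorrB (fcorr_gcorr f) f00 fz; rewrite subrr sub0r.
      by have := gcorrB (fcorr_gcorr g) guv guz; rewrite subrr.
move=> h0; have [h ->] := qpi_surj h0; rewrite /= !qcomp_pi => -[/qpiP hf /qpiP hg].
apply/qpiP; apply: frac_eqv_sym.
have [U1 [V1 [flU1 flV1 Uh1 Uf1 E1]]] := hf.
have [U2 [V2 [flU2 flV2 Uh2 Ug2 E2]]] := hg.
exists [set w : dsum | U1 w.1 /\ U2 w.2], (gadd (fcorr h 0) (gadd V1 V2)).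
split.
- exact: dsum_cofin.
- by do 2?apply: gflen0_gadd => //; apply: fcorr_ind.
- move=> [u v] /= [/Uh1[z1 [_ -> hz1]] /Uh2[z2 [_ -> hz2]]]; exists (z1 + z2).
  have [_ hD _ _] := fcorr_gcorr h; have := hD _ _ _ _ hz1 hz2.
  by congr (fcorr h _ _); congr (_, _); rewrite ?addr0 ?add0r.
- move=> [u v] /= [/Uf1[z1 fz1] /Ug2[z2 gz2]]; exists (z1 + z2).
  by exists z1, z2.
- move=> [u v] z _ [/= U1u U2v] huz [z1 [z2 [/= fz1 gz2 ->]]].
  have [w1 hw1] := Uh1 _ U1u; have [w2 hw2] := Uh2 _ U2v.
  exists (z - (w1 + w2)), ((w1 - z1) + (w2 - z2)); split.
  + case: hw1 => _ -> hw1; case: hw2 => _ -> hw2.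
    have [_ hD _ _] := fcorr_gcorr h.
    have := gcorrB (fcorr_gcorr h) huz (hD _ _ _ _ hw1 hw2).
    by congr (fcorr h _ _); congr (_, _); rewrite /= ?addr0 ?add0r subrr.
  + by exists (w1 - z1), (w2 - z2); split=> //; [apply: E1 hw1 fz1|apply: E2 hw2 gz2].
  + by rewrite [w1 - z1 + _]addrACA -opprD subrKA.
Qed.

End DirectSum.

End GradedModules.

Section LineBundles.
Variables (k : fieldType) (X : wpl k).
Local Notation t := (wl_n X).+2.
Local Notation A := (AA X).
Local Notation L := (LL X).
Local Notation p := (@wl_weight k X).
Implicit Types (x y : L) (f g : {mpoly k[t]}).

Lemma mdegLD (m m' : 'X_{1..t}) : mdegL (m + m')%MM = mdegL m + mdegL m' :> L.
Proof.
by rewrite -big_split; apply: eq_bigr => i _; rewrite mnmDE mulrnDr.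
Qed.

Lemma mdegL_pow (i : 'I_t) : mdegL (U_(i) *+ p i)%MM = cvec X.
Proof.
rewrite /mdegL (bigD1 i) //= big1 ?addr0 => [|j ji].
  by rewrite mulmnE mnm1E eqxx mul1n xvec_weight.
by rewrite mulmnE mnm1E eq_sym (negPf ji) mul0n mulr0n.
Qed.

Lemma mhomogX (m : 'X_{1..t}) : mhomog (mdegL m : L) 'X_[k, m].
Proof. by move=> m'; rewrite msuppX inE => /eqP ->. Qed.

Lemma mhomogZ x f (c : k) : mhomog x f -> mhomog x (c *: f).
Proof. by move=> hf m /msuppZ_le; apply: hf. Qed.

Lemma mhomogD x f g : mhomog x f -> mhomog x g -> mhomog x (f + g).
Proof. by move=> hf hg m /msuppD_le; rewrite mem_cat => /orP[/hf|/hg]. Qed.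

Lemma mhomogM x y f g : mhomog x f -> mhomog y g -> mhomog (x + y) (f * g).
Proof.
move=> hf hg m /msuppM_le /allpairsP[[m1 m2] /= [/hf E1 /hg E2 ->]].
by rewrite mdegLD E1 E2.
Qed.

Lemma wl_rel_homog (i : 'I_t) : mhomog (cvec X) (wl_rel i).
Proof.
have H j : mhomog (cvec X) ('X_j ^+ p j) by rewrite mpolyXn -(mdegL_pow j); apply: mhomogX.
apply: mhomogD; last exact: mhomogZ.
by apply: mhomogD => //; rewrite -scaleN1r; apply: mhomogZ.
Qed.

Definition mhc x f : {mpoly k[t]} :=
  \sum_(m <- msupp f | mdegL m == x) f@_m *: 'X_[m].

Lemma mcoeff_mhc x f m : (mhc x f)@_m = if mdegL m == x then f@_m else 0.
Proof.
rewrite /mhc raddf_sum /=.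
have [mf|mf] := boolP (m \in msupp f); last first.
  rewrite memN_msupp_eq0 // if_same big_seq_cond big1 // => m' /andP[m'f _].
  rewrite mcoeffZ mcoeffX; case: eqP => [E|]; last by rewrite mulr0.
  by rewrite -E m'f in mf.
rewrite big_mkcond (bigD1_seq m) //= ?msupp_uniq // big1 ?addr0 => [|m' m'm].
  by case: eqP => // _; rewrite mcoeffZ mcoeffX eqxx mulr1.
by case: ifP => // _; rewrite mcoeffZ mcoeffX (negPf m'm) mulr0.
Qed.

Lemma mhcD x : {morph mhc x : f g / f + g}.
Proof.
move=> f g; apply/mpolyP => m; rewrite mcoeffD !mcoeff_mhc mcoeffD.
by case: ifP => // _; rewrite addr0.
Qed.

Lemma mhc0 x : mhc x 0 = 0.
Proof. by rewrite /mhc msupp0 big_nil. Qed.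

Lemma mhcB x f g : mhc x (f - g) = mhc x f - mhc x g.
Proof. by apply: (addIr (mhc x g)); rewrite subrK -mhcD subrK. Qed.

Lemma mhc_homog x y f : mhomog y f -> mhc x f = if x == y then f else 0.
Proof.
move=> hf; apply/mpolyP => m; rewrite mcoeff_mhc.
have [mf|mf] := boolP (m \in msupp f).
  by rewrite (hf _ mf) eq_sym; case: eqP => // _; rewrite mcoeff0.
by rewrite memN_msupp_eq0 // if_same; case: eqP; rewrite ?mcoeff0 ?memN_msupp_eq0.
Qed.

Lemma mhcM x y f g : mhomog x f -> mhc (x + y) (f * g) = f * mhc y g.
Proof.
move=> hf; rewrite {1}(mpolyE g) mulr_sumr.
rewrite (big_morph (mhc (x + y)) (mhcD (x + y)) (mhc0 (x + y))).
rewrite /mhc mulr_sumr [RHS]big_mkcond; apply: eq_bigr => m _.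
rewrite -/(mhc _ _).
rewrite (mhc_homog _ (mhomogM hf (@mhomogZ _ _ (g@_m) (@mhomogX m)))).
by rewrite eq_sym (inj_eq (addrI x)).
Qed.

Lemma mhc_ideal x f : f \in @wl_ideal _ X -> mhc x f \in @wl_ideal _ X.
Proof.
move=> /asboolP[g ->]; apply/asboolP; exists (fun i => mhc (x - cvec X) (g i)).
rewrite (big_morph (mhc x) (mhcD x) (mhc0 x)); apply: eq_bigr => i _.
have := mhcM (x - cvec X) (g i) (wl_rel_homog (i := i)).
rewrite addrC subrK => H.
exact: (etrans (congr1 (mhc x) (mulrC _ _)) (etrans H (mulrC _ _))).
Qed.

Definition Ahc x (a : A) : A := @Apr k X (mhc x (repr a)).

Lemma Ahc_pi x f : Ahc x (Apr f) = Apr (mhc x f).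
Proof.
apply/eqP; rewrite /Ahc /Apr -Quotient.idealrBE -mhcB; apply: mhc_ideal.
suff : repr (\pi_{ideal_quot Aideal X} f) - f \in Aideal X by [].
by rewrite Quotient.idealrBE reprK.
Qed.

Lemma Apr_surj (a : A) : exists f, a = Apr f.
Proof. by exists (repr a); rewrite /Apr reprK. Qed.

Lemma AprD : {morph @Apr k X : f g / f + g}.
Proof. by move=> f g; rewrite /Apr raddfD. Qed.

Lemma AprM : {morph @Apr k X : f g / f * g}.
Proof. by move=> f g; rewrite /Apr rmorphM. Qed.

Lemma Apr0 : Apr 0 = 0 :> A. Proof. by rewrite /Apr raddf0. Qed.

Section Twist.
Variable x : L.
Let hc (y : L) (a : A^o) : A^o := Ahc (x + y) a.

Fact twist_hcompD y : {morph hc y : a b / a + b}.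
Proof.
move=> a b; have [f ->] := Apr_surj a; have [g ->] := Apr_surj b.
by rewrite /hc -AprD !Ahc_pi mhcD AprD.
Qed.

Fact twist_hcompK y z a : hc y (hc z a) = if y == z then hc z a else 0.
Proof.
have [f ->] := Apr_surj a; rewrite /hc !Ahc_pi.
rewrite (@mhc_homog _ (x + z)) ?(inj_eq (addrI x)) => [|m].
  by case: eqP => // _; rewrite Apr0.
by rewrite mcoeff_msupp mcoeff_mhc; case: (mdegL m =P x + z) => // _; rewrite eqxx.
Qed.

Fact twist_hcomp_sum a : exists s : seq L, uniq s /\ a = \sum_(y <- s) hc y a.
Proof.
have [f ->] := Apr_surj a.
exists (undup [seq mdegL m - x | m <- msupp f]); split; first exact: undup_uniq.
under eq_bigr do rewrite /hc Ahc_pi.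
rewrite -(big_morph _ AprD Apr0); congr Apr; apply/mpolyP => m.
rewrite raddf_sum /=; under eq_bigr do rewrite mcoeff_mhc.
have [mf|mf] := boolP (m \in msupp f); last first.
  by rewrite memN_msupp_eq0 // big1 // => y _; rewrite if_same.
rewrite (bigD1_seq (mdegL m - x)) ?undup_uniq //=; last first.
  by rewrite mem_undup; apply: map_f.
rewrite subrKC eqxx big1 ?addr0 // => y yN; case: eqP => // E.
by rewrite E addrC addKr eqxx in yN.
Qed.

Fact twist_hcompZ y z (a : A) (u : A^o) :
  Ahomog y a -> hc z u = u -> hc (y + z) (a *: u) = a *: u.
Proof.
move=> [f [hf ->]]; have [g ->] := Apr_surj u; rewrite /hc => <-.
rewrite Ahc_pi -[_ *: _]/(_ * _) -AprM Ahc_pi addrCA mhcM //.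
rewrite (@mhc_homog _ (x + z)) ?eqxx // => m.
by rewrite mcoeff_msupp mcoeff_mhc; case: (mdegL m =P x + z) => // _; rewrite eqxx.
Qed.

Fact twist_fg : exists s : seq A^o, forall u, exists c : A^o -> A,
  u = \sum_(v <- s) c v *: v.
Proof.
exists [:: 1] => u; exists (fun=> u).
by rewrite big_seq1 -[_ *: _]/(_ * _) mulr1.
Qed.

(* The module A(x), with A(x)_y = A_(x + y), that is, the line bundle O(x). *)
Definition twist : gmod X :=
  GMod twist_hcompD twist_hcompK twist_hcomp_sum twist_hcompZ twist_fg.

End Twist.

Definition line_bundle (M : coh X) := exists x, iso_obj M (twist x : coh X).

Definition torsion_sheaf (M : coh X) := finite_length M.

End LineBundles.

Notation "M \oplus N" := (dsum M N : coh _)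
  (at level 50, left associativity) : cat_scope.

(* Main.v *)
(** The category of coherent sheaves is realized concretely: a morphism is a graded
    correspondence up to finite length, so kernels, cokernels and images are computed
    on submodules, and multiplication by a homogeneous element a of degree d is a
    natural transformation from the shift by -d to the identity.  Since A is noetherian
    and each of its homogeneous components is a monomial times the space of binary forms
    of some degree in T0 = X_1^p_1 and T1 = X_2^p_2, every simple sheaf is killed by a
    homogeneous prime h, and L/hL is simple for every line bundle L.

    Extensions of a line bundle L by a torsion sheaf split.  For a simple kernel T of
    b : E -> L, choose h invertible on T such that h : h(L) -> L lifts to s : h(L) -> E;
    then h_E - s h(b) takes values in T and restricts to the isomorphism h_T.

    Given 0 -> L -> L' + S' -> S -> 0, the component S' -> S is a monomorphism because L
    has no torsion, and L' -> S/S' is then an epimorphism with kernel L.  Conversely, an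
    epimorphism L' -> S/S' lifts to S because Ext^1(L', S') = 0.  A finite length quotient
    of L' is determined by its composition factors, so the kernel of such an epimorphism is
    always L.  Hence the epimorphisms L' + S' -> S with kernel L fibre over the
    monomorphisms S' -> S with cokernel S''; there are F * a_S' of the latter, a_S'' choices
    of the induced map L' -> S'', and |Hom(L', S')| lifts of each.  Dividing by a_S gives the
    formula.  If S is indecomposable it has a unique simple quotient, so for S'' nonzero every
    lift of an epimorphism L' -> S'' is an epimorphism L' -> S; as Aut(S) acts simply
    transitively on the latter, a_S = a_S'' |Hom(L', S')|, and any two monomorphisms
    S' -> S with cokernel S'' differ by an automorphism of S'. *)

From HB Require Import structures.
From mathcomp Require Import all_boot all_order all_algebra.
From mathcomp Require Import ring generic_quotient ring_quotient mpoly.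
From mathcomp Require Import boolp classical_sets.
Require Import Defs.

Set Implicit Arguments.
Unset Strict Implicit.
Unset Printing Implicit Defensive.

Import GRing.Theory.
Local Open Scope classical_set_scope.
Local Open Scope quotient_scope.
Local Open Scope ring_scope.
Local Open Scope cat_scope.

(** The usual route to such formulas uses Serre duality and the classification of torsion sheaves
    into uniserial tubes. The argument here avoids both. It is run in an arbitrary abelian category
    with a class of line bundles subject to a short list of properties ([line_bundles]), and graded
    modules are entered only to verify that list. Since such a category has no elements, a function
    h is represented by a shift functor with a natural map to the identity ([twisting]); vanishing
    or invertibility of h at an object is then a property of one morphism. Two facts that tubes
    would give at once need substitutes. Equality of classes in the Grothendieck group becomes
    equality of all counts of composition factors, and this is enough because a line bundle has at
    most one simple quotient killed by a given prime. The simple top of an indecomposable torsion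
    object comes from Fitting's lemma and a Baer-type extension argument. *)

Local Notation "g \co f" := (compm g f) (at level 40, left associativity).

(** * Finite cardinalities *)

Section FiniteCardinality.
Implicit Types T U : Type.

Lemma has_card_ext T (A B : T -> Prop) n :
  (forall x, A x <-> B x) -> has_card A n -> has_card B n.
Proof.
move=> AB [f [fi fA]]; exists f; split=> // x.
by split=> [/AB/fA|/fA/AB].
Qed.

Lemma has_card0 T (A : T -> Prop) : has_card A 0 <-> forall x, ~ A x.
Proof.
split=> [[f [_ fA]] x /fA[[]] //|A0].
exists (fun i : 'I_0 => False_rect T (notF (ltn_ord i))).
by split=> [[]//|x]; split=> [/A0//|[[]]].
Qed.

Lemma has_card_cons T (A : T -> Prop) a n :
  ~ A a -> has_card A n -> has_card (fun x => A x \/ x = a) n.+1.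
Proof.
move=> Aa [f [fi fA]]; exists (fun i => oapp f a (unlift ord0 i)); split.
  move=> i j; case: unliftP => [i'|] -> /=; case: unliftP => [j'|] -> //=.
  - by move/fi ->.
  - by move=> E; case: Aa; apply/fA; exists i'.
  - by move=> E; case: Aa; apply/fA; exists j'.
move=> x; split=> [[/fA[i <-]|->]|[i <-]].
- by exists (lift ord0 i); rewrite liftK.
- by exists ord0; rewrite unlift_none.
- by case: unliftP => [i'|] _ /=; [left; apply/fA; exists i'|right].
Qed.

Lemma has_card_rem T (A : T -> Prop) a n :
  A a -> has_card A n.+1 -> has_card (fun x => A x /\ x <> a) n.
Proof.
move=> Aa [f [fi fA]]; have /fA[i0 i0E] := Aa.
exists (fun i => f (lift i0 i)); split=> [i j /fi/lift_inj//|x].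
split=> [[/fA[i <-] ia]|[i <-]].
  by case: (unliftP i0 i) => [j ->|E]; [exists j|case: ia; rewrite E].
split; first by apply/fA; exists (lift i0 i).
by rewrite -i0E => /fi/eqP; rewrite eq_sym (negPf (neq_lift _ _)).
Qed.

Lemma has_cardS T (A : T -> Prop) n : has_card A n.+1 -> exists a, A a.
Proof. by move=> [f [_ fA]]; exists (f ord0); apply/fA; exists ord0. Qed.

Lemma has_card_inj T (A : T -> Prop) n m : has_card A n -> has_card A m -> n = m.
Proof.
elim: n m A => [|n IH] [|m] A //.
- by move=> /has_card0 A0 /has_cardS[a /A0].
- by move=> /has_cardS[a Aa] /has_card0 /(_ a).
- by move=> cn cm; have [a Aa] := has_cardS cn; congr _.+1;
  apply: IH (has_card_rem Aa cn) (has_card_rem Aa cm).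
Qed.

Lemma ncardE T (A : T -> Prop) n : has_card A n -> ncard A = n.
Proof.
move=> cA; apply: (has_card_inj _ cA).
by rewrite /ncard; case: xgetP => [m _ //|/(_ n)].
Qed.

Lemma finite_cardP T (A : T -> Prop) : finite_card A -> has_card A (ncard A).
Proof. by case=> n cA; rewrite (ncardE cA). Qed.

Lemma has_card_disjU T (A B : T -> Prop) n m :
  (forall x, A x -> ~ B x) -> has_card A n -> has_card B m ->
  has_card (fun x => A x \/ B x) (n + m).
Proof.
move=> AB cA; elim: m B AB => [|m IH] B AB.
  move/has_card0 => B0; rewrite addn0; apply: has_card_ext cA => x.
  by split=> [|[//|/B0]]; first by left.
move=> cB; have [b Bb] := has_cardS cB; rewrite addnS.
apply: has_card_ext (has_card_cons (a := b) _ (IH _ _ (has_card_rem Bb cB))).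
- move=> x; split=> [[[|[]]|->]|[|Bx]]; [by left|by right|by right|by left; left|].
  by have [->|xb] := pselect (x = b); [right|left; right].
- by move=> [/AB|[]].
- by move=> x Ax [/(AB _ Ax)].
Qed.

Lemma has_card_fibre T U (A : T -> Prop) (B : U -> Prop) (f : T -> U) n m :
  (forall x, A x -> B (f x)) -> has_card B n ->
  (forall b, B b -> has_card (fun x => A x /\ f x = b) m) -> has_card A (n * m).
Proof.
elim: n A B => [|n IH] A B AB cB fib.
  by rewrite mul0n; apply/has_card0 => x /AB; move/has_card0: cB; apply.
have [b Bb] := has_cardS cB; rewrite mulSn.
apply: has_card_ext (has_card_disjU _ (fib _ Bb)
  (IH (fun x => A x /\ f x <> b) _ _ (has_card_rem Bb cB) _)).
- move=> x; split=> [[[]|[]]//|Ax].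
  by have [E|E] := pselect (f x = b); [left|right].
- by move=> x [_ ->] [].
- by move=> x [/AB].
- move=> b' [Bb' b'b]; apply: has_card_ext (fib _ Bb') => x.
  by split=> [[Ax E]|[[]]//]; split=> //; split=> //; rewrite E.
Qed.

Lemma finite_card_sub T (A B : T -> Prop) :
  (forall x, A x -> B x) -> finite_card B -> finite_card A.
Proof.
move=> AB [n cB]; elim: n A B AB cB => [|n IH] A B AB cB.
  by exists 0%N; apply/has_card0 => x /AB; move/has_card0: cB; apply.
have [b Bb] := has_cardS cB.
have [m cA] := IH (fun x => A x /\ x <> b) _ (fun x H => conj (AB x H.1) H.2) (has_card_rem Bb cB).
have [Ab|Ab] := pselect (A b); last first.
  exists m; apply: has_card_ext cA => x; split=> [[]//|Ax]; split=> // xb.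
  by rewrite xb in Ax.
exists m.+1; apply: has_card_ext (has_card_cons (a := b) _ cA) => [x|[_ /(_ erefl)] //].
split=> [[[]//|->//]|Ax]; have [->|] := pselect (x = b); [by right|by left].
Qed.

Lemma finite_card_fibre T U (A : T -> Prop) (B : U -> Prop) (f : T -> U) :
  (forall x, A x -> B (f x)) -> finite_card B ->
  (forall b, B b -> finite_card (fun x => A x /\ f x = b)) -> finite_card A.
Proof.
move=> AB [n cB]; elim: n A B AB cB => [|n IH] A B AB cB fib.
  by exists 0%N; apply/has_card0 => x /AB; move/has_card0: cB; apply.
have [b Bb] := has_cardS cB.
have [m cb] := fib _ Bb.
have [p cA] : finite_card (fun x => A x /\ f x <> b).
  apply: (IH _ _ _ (has_card_rem Bb cB)) => [x [/AB]//|b' [Bb' _]].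
  by apply: finite_card_sub (fib _ Bb') => x [[]].
exists (m + p)%N; apply: has_card_ext (has_card_disjU _ cb cA).
- move=> x; split=> [[[]|[]]//|Ax].
  by have [E|E] := pselect (f x = b); [left|right].
- by move=> x [_ ->] [].
Qed.

Lemma has_card1 T (a : T) (A : T -> Prop) : A a -> (forall x, A x -> x = a) -> has_card A 1.
Proof.
move=> Aa Au; have c0 : has_card (fun _ : T => False) 0 by apply/has_card0 => x [].
apply: has_card_ext (has_card_cons (a := a) _ c0) => // x.
by split=> [[//|->//]|/Au ->]; right.
Qed.

Lemma has_card_bij T U (A : T -> Prop) (B : U -> Prop) (f : T -> U) n :
  (forall x, A x -> B (f x)) ->
  (forall x y, A x -> A y -> f x = f y -> x = y) ->
  (forall b, B b -> exists2 x, A x & f x = b) -> has_card B n -> has_card A n.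
Proof.
move=> AB fi fs cB; rewrite -(muln1 n); apply: has_card_fibre AB cB _ => b /fs[x Ax <-].
by apply: (has_card1 (a := x)) => // y [Ay /fi]; apply.
Qed.

Lemma has_card_img T U (A : T -> Prop) (B : U -> Prop) (f : T -> U) n :
  (forall x, A x -> B (f x)) ->
  (forall x y, A x -> A y -> f x = f y -> x = y) ->
  (forall b, B b -> exists2 x, A x & f x = b) -> has_card A n -> has_card B n.
Proof.
move=> AB fi fs [g [gi gA]]; have Ag i : A (g i) by apply/gA; exists i.
exists (f \o g); split=> [i j /= /(fi _ _ (Ag i) (Ag j))/gi//|b].
by split=> [/fs[x /gA[i <-] <-]|[i <-]]; [exists i|apply: AB].
Qed.

Lemma finite_card_inj T U (A : T -> Prop) (B : U -> Prop) (f : T -> U) :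
  (forall x, A x -> B (f x)) ->
  (forall x y, A x -> A y -> f x = f y -> x = y) -> finite_card B -> finite_card A.
Proof.
move=> AB fi cB; apply: finite_card_fibre AB cB _ => b _.
have [[x [Ax <-]]|N] := pselect (exists x, A x /\ f x = b).
  by exists 1%N; apply: (has_card1 (a := x)) => // y [Ay /fi]; apply.
by exists 0%N; apply/has_card0 => x Hx; case: N; exists x.
Qed.

(** The surjection is given by its graph: in the finiteness of Hom(L, T) an element of a module
    determines a morphism only through a relation involving representatives. *)
Lemma finite_card_image T U (A : T -> Prop) (B : U -> Prop) (R : T -> U -> Prop) :
  (forall x b b', A x -> R x b -> R x b' -> b = b') ->
  (forall b, B b -> exists2 x, A x & R x b) -> finite_card A -> finite_card B.
Proof.
move=> Ru Rs [n cA]; elim: n A B Ru Rs cA => [|n IH] A B Ru Rs cA.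
  by exists 0%N; apply/has_card0 => b /Rs[x] + _; move/has_card0: cA; apply.
have [a Aa] := has_cardS cA.
have [m cB] : finite_card (fun b => B b /\ ~ R a b).
  apply: (IH _ _ _ _ (has_card_rem Aa cA)) => [x b b' []|b [/Rs[x Ax Rx] Ra]].
    by move=> + _; apply: Ru.
  by exists x => //; split=> // xa; rewrite xa in Rx.
have [[b [Bb Rb]]|N] := pselect (exists b, B b /\ R a b); last first.
  exists m; apply: has_card_ext cB => b; split=> [[]//|Bb]; split=> // Rb.
  by case: N; exists b.
exists m.+1; apply: has_card_ext (has_card_cons (a := b) _ cB) => [b'|[]//].
split=> [[[]//|->//]|Bb'].
have [Rb'|] := pselect (R a b'); [by right; apply: Ru Rb' Rb|by left].
Qed.

End FiniteCardinality.

(** * Preadditive, additive and abelian categories *)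

Definition epi (C : category) (X Y : C) (f : mor X Y) :=
  forall Z (g h : mor Y Z), g \co f = h \co f -> g = h.

(** The groups are added to a given category, so that the [coh X] of the statement is literally the
    underlying category of the abelian category constructed later. *)
Record preadditive_category := PreadditiveCategory {
  pa_cat :> category;
  pa_zmod : forall X Y : pa_cat, GRing.Zmodule (mor X Y)
}.

HB.instance Definition _ (C : preadditive_category) (X Y : C) :=
  GRing.Zmodule.copy (mor X Y) (GRing.Zmodule.Pack (pa_zmod X Y)).

Record additive_category := AdditiveCategory {
  ad_pre :> preadditive_category;
  compDm : forall (X Y Z : ad_pre) (g h : mor Y Z) (f : mor X Y),
    (g + h) \co f = g \co f + h \co f;
  compmD : forall (X Y Z : ad_pre) (h : mor Y Z) (f g : mor X Y),
    h \co (f + g) = h \co f + h \co g;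
  ab_zero : exists Z : ad_pre, zero_obj Z
}.

Record abelian := Abelian {
  ab_pre :> additive_category;
  ab_ker : forall (X Y : ab_pre) (f : mor X Y),
    exists K (k : mor K X), is_kernel k f;
  ab_coker : forall (X Y : ab_pre) (f : mor X Y),
    exists Q (q : mor Y Q), is_cokernel f q;
  ab_sum : forall X Y : ab_pre, exists P (i : mor X P) (j : mor Y P), coproduct i j;
  ab_mono : forall (X Y : ab_pre) (f : mor X Y),
    mono f -> exists Z (g : mor Y Z), is_kernel f g;
  ab_epi : forall (X Y : ab_pre) (f : mor X Y),
    epi f -> exists Z (g : mor Z X), is_cokernel g f
}.

Section AdditiveBasics.
Variable C : additive_category.
Implicit Types X Y Z W K Q U V M N T : C.

Lemma comp0m X Y Z (f : mor X Y) : (0 : mor Y Z) \co f = 0.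
Proof. by apply: (addIr ((0 : mor Y Z) \co f)); rewrite -compDm !add0r. Qed.

Lemma compm0 X Y Z (f : mor Y Z) : f \co (0 : mor X Y) = 0.
Proof. by apply: (addIr (f \co (0 : mor X Y))); rewrite -compmD !add0r. Qed.

Lemma compNm X Y Z (g : mor Y Z) (f : mor X Y) : (- g) \co f = - (g \co f).
Proof. by apply: (addIr (g \co f)); rewrite -compDm !addNr comp0m. Qed.

Lemma compmN X Y Z (g : mor Y Z) (f : mor X Y) : g \co (- f) = - (g \co f).
Proof. by apply: (addIr (g \co f)); rewrite -compmD !addNr compm0. Qed.

Lemma compBm X Y Z (g h : mor Y Z) (f : mor X Y) :
  (g - h) \co f = g \co f - h \co f.
Proof. by rewrite compDm compNm. Qed.

Lemma compmB X Y Z (h : mor Y Z) (f g : mor X Y) :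
  h \co (f - g) = h \co f - h \co g.
Proof. by rewrite compmD compmN. Qed.

Lemma zero_objP Z : zero_obj Z <-> idm Z = 0.
Proof.
split=> [/(_ Z)[[f [_ uf]] _]|Z0 X]; first by rewrite -(uf (idm Z)) // -(uf 0).
split; exists 0; split=> // f _.
  by rewrite -(comp1m f) Z0 comp0m.
by rewrite -(compm1 f) Z0 compm0.
Qed.

Lemma zero_to Z X (f : mor X Z) : zero_obj Z -> f = 0.
Proof. by move/zero_objP => Z0; rewrite -(comp1m f) Z0 comp0m. Qed.

Lemma zero_from Z X (f : mor Z X) : zero_obj Z -> f = 0.
Proof. by move/zero_objP => Z0; rewrite -(compm1 f) Z0 compm0. Qed.

Lemma zero_morP X Y (f : mor X Y) : zero_mor f <-> f = 0.
Proof.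
split=> [[Z [u [v [Z0 ->]]]]|->]; first by rewrite (zero_to u Z0) compm0.
have [Z Z0] := ab_zero C; exists Z, 0, 0; split=> //; by rewrite compm0.
Qed.

Lemma monoP X Y (f : mor X Y) :
  mono f <-> forall W (w : mor W X), f \co w = 0 -> w = 0.
Proof.
split=> [mf W w fw|f0 W g h E]; first by apply: mf; rewrite compm0.
by apply/eqP; rewrite -subr_eq0; apply/eqP/f0; rewrite compmB E subrr.
Qed.

Lemma epiP X Y (f : mor X Y) :
  epi f <-> forall W (w : mor Y W), w \co f = 0 -> w = 0.
Proof.
split=> [mf W w fw|f0 W g h E]; first by apply: mf; rewrite comp0m.
by apply/eqP; rewrite -subr_eq0; apply/eqP/f0; rewrite compBm E subrr.
Qed.

Lemma kernelP X Y Z (f : mor X Y) (g : mor Y Z) :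
  is_kernel f g <-> [/\ mono f, g \co f = 0 &
    forall W (w : mor W Y), g \co w = 0 -> exists w', w = f \co w'].
Proof.
split=> [[/zero_morP gf0 fU]|[mf gf0 fU]].
  split=> //.
    apply/monoP => W w fw0.
    have [|v [_ vu]] := fU W 0; first by apply/zero_morP; rewrite compm0.
    by rewrite -(vu w) // -(vu 0) ?compm0.
  by move=> W w /zero_morP/fU[v [E _]]; exists v.
split; first exact/zero_morP.
move=> W w /zero_morP/fU[v E]; exists v; split=> // v' E'.
by apply: mf; rewrite E' E.
Qed.

Lemma cokernelP X Y Z (f : mor X Y) (g : mor Y Z) :
  is_cokernel f g <-> [/\ epi g, g \co f = 0 &
    forall W (w : mor Y W), w \co f = 0 -> exists w', w = w' \co g].
Proof.
split=> [[/zero_morP gf0 fU]|[mf gf0 fU]].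
  split=> //.
    apply/epiP => W w fw0.
    have [|v [_ vu]] := fU W 0; first by apply/zero_morP; rewrite comp0m.
    by rewrite -(vu w) // -(vu 0) ?comp0m.
  by move=> W w /zero_morP/fU[v [E _]]; exists v.
split; first exact/zero_morP.
move=> W w /zero_morP/fU[v E]; exists v; split=> // v' E'.
by apply: mf; rewrite E' E.
Qed.

End AdditiveBasics.

Section AbelianBasics.
Variable C : abelian.
Implicit Types X Y Z W K Q U V M N T : C.

Lemma mono_kernel X Y Z (f : mor X Y) (q : mor Y Z) :
  mono f -> is_cokernel f q -> is_kernel f q.
Proof.
move=> mf /cokernelP[eq qf0 qU]; apply/kernelP; split=> // W w qw.
have [V [g /kernelP[_ gf0 gU]]] := ab_mono mf.
have [g' E] := qU _ _ gf0.
by apply: gU; rewrite E -compmA qw compm0.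
Qed.

Lemma epi_cokernel X Y Z (k : mor X Y) (f : mor Y Z) :
  epi f -> is_kernel k f -> is_cokernel k f.
Proof.
move=> ef /kernelP[mk fk0 kU]; apply/cokernelP; split=> // W w wk.
have [V [g /cokernelP[_ fg0 gU]]] := ab_epi ef.
have [g' E] := kU _ _ fg0.
by apply: gU; rewrite E compmA wk comp0m.
Qed.

Definition ses X Y Z (f : mor X Y) (g : mor Y Z) :=
  is_kernel f g /\ is_cokernel f g.

Lemma sesP X Y Z (f : mor X Y) (g : mor Y Z) :
  ses f g <-> [/\ mono f, epi g, g \co f = 0 &
    forall W (w : mor W Y), g \co w = 0 -> exists w', w = f \co w'].
Proof.
split=> [[/kernelP[mf gf fU] /cokernelP[eg _ _]]//|[mf eg gf fU]].
have kf : is_kernel f g by apply/kernelP.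
by split=> //; apply: epi_cokernel.
Qed.

Lemma ses_epi X Y Z (f : mor X Y) (g : mor Y Z) : ses f g -> epi g.
Proof. by case/sesP. Qed.

Lemma ses_mono X Y Z (f : mor X Y) (g : mor Y Z) : ses f g -> mono f.
Proof. by case/sesP. Qed.

Lemma ses0 X Y Z (f : mor X Y) (g : mor Y Z) : ses f g -> g \co f = 0.
Proof. by case/sesP. Qed.

Lemma ses_lift X Y Z (f : mor X Y) (g : mor Y Z) W (w : mor W Y) :
  ses f g -> g \co w = 0 -> exists w', w = f \co w'.
Proof. by case/sesP => _ _ _; apply. Qed.

Lemma ses_desc X Y Z (f : mor X Y) (g : mor Y Z) W (w : mor Y W) :
  ses f g -> w \co f = 0 -> exists w', w = w' \co g.
Proof. by case=> _ /cokernelP[_ _]; apply. Qed.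

Lemma ses_of_epi Y Z (g : mor Y Z) : epi g -> exists X (f : mor X Y), ses f g.
Proof.
move=> eg; have [X [f kf]] := ab_ker g; exists X, f; split=> //.
exact: epi_cokernel.
Qed.

Lemma ses_of_mono X Y (f : mor X Y) : mono f -> exists Z (g : mor Y Z), ses f g.
Proof.
move=> mf; have [Z [g cg]] := ab_coker f; exists Z, g; split=> //.
exact: mono_kernel.
Qed.

Lemma ses_short X Y Z (f : mor X Y) (g : mor Y Z) : ses f g -> short_exact X Y Z.
Proof. by exists f, g. Qed.

Lemma iso_mono X Y (f : mor X Y) : is_iso f -> mono f.
Proof.
by case=> g [gf _]; apply/monoP => W w E; rewrite -(comp1m w) -gf -compmA E compm0.
Qed.

Lemma iso_epi X Y (f : mor X Y) : is_iso f -> epi f.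
Proof.
by case=> g [_ fg]; apply/epiP => W w E; rewrite -(compm1 w) -fg compmA E comp0m.
Qed.

Lemma mono_epi_iso X Y (f : mor X Y) : mono f -> epi f -> is_iso f.
Proof.
move=> mf ef; have [K [k skf]] := ses_of_epi ef.
have k0 : k = 0 by move/monoP: mf; apply; apply: ses0.
have [g E] : exists g, idm X = g \co f.
  by apply: ses_desc skf _; rewrite k0 compm0.
exists g; split=> //; apply: ef; by rewrite -compmA -E compm1 comp1m.
Qed.

Lemma iso_id X : is_iso (idm X).
Proof. by exists (idm X); rewrite comp1m. Qed.

Lemma iso_comp X Y Z (g : mor Y Z) (f : mor X Y) :
  is_iso g -> is_iso f -> is_iso (g \co f).
Proof.
case=> g' [E1 E2] [f' [E3 E4]]; exists (f' \co g'); split.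
  by rewrite compmA -(compmA f') E1 compm1.
by rewrite compmA -(compmA g) E4 compm1.
Qed.

Lemma iso_obj_refl X : iso_obj X X.
Proof. by exists (idm X); apply: iso_id. Qed.

Lemma iso_obj_sym X Y : iso_obj X Y -> iso_obj Y X.
Proof. by case=> f [g [gf fg]]; exists g, f. Qed.

Lemma iso_obj_trans X Y Z : iso_obj X Y -> iso_obj Y Z -> iso_obj X Z.
Proof. by case=> f If [g Ig]; exists (g \co f); apply: iso_comp. Qed.

Lemma mono_comp X Y Z (g : mor Y Z) (f : mor X Y) : mono g -> mono f -> mono (g \co f).
Proof. by move=> mg mf W u v; rewrite -!compmA => /mg/mf. Qed.

Lemma epi_comp X Y Z (g : mor Y Z) (f : mor X Y) : epi g -> epi f -> epi (g \co f).
Proof. by move=> mg mf W u v; rewrite !compmA => /mf/mg. Qed.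

Lemma epi_of_comp X Y Z (g : mor Y Z) (f : mor X Y) : epi (g \co f) -> epi g.
Proof. by move=> e W u v E; apply: e; rewrite !compmA E. Qed.

Lemma mono_of_comp X Y Z (g : mor Y Z) (f : mor X Y) : mono (g \co f) -> mono f.
Proof. by move=> e W u v E; apply: e; rewrite -!compmA E. Qed.

Lemma zero_obj_iso X Y : iso_obj X Y -> zero_obj X -> zero_obj Y.
Proof.
case=> f [g [_ fg]] X0; apply/zero_objP.
by rewrite -fg (zero_to g X0) compm0.
Qed.

Lemma mono_zero X Y (f : mor X Y) : mono f -> zero_obj Y -> zero_obj X.
Proof.
by move=> mf Y0; apply/zero_objP/mf; apply: etrans (zero_to _ Y0) (esym (zero_to _ Y0)).
Qed.

Lemma epi_zero X Y (f : mor X Y) : epi f -> zero_obj X -> zero_obj Y.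
Proof.
by move=> mf Y0; apply/zero_objP/mf; apply: etrans (zero_from _ Y0) (esym (zero_from _ Y0)).
Qed.

Lemma zero_from_mono X Y Z (f : mor Z X) : zero_obj Z -> mono f.
Proof. by move=> Z0; apply/monoP => W w _; apply: zero_to. Qed.

Lemma zero_to_epi X Z (f : mor X Z) : zero_obj Z -> epi f.
Proof. by move=> Z0; apply/epiP => W w _; apply: zero_from. Qed.

Lemma ses_ker_zero X Y Z (f : mor X Y) (g : mor Y Z) : ses f g -> zero_obj X -> is_iso g.
Proof.
move=> s X0; apply: mono_epi_iso (ses_epi s); apply/monoP => W w /(ses_lift s)[w' ->].
by rewrite (zero_to w' X0) compm0.
Qed.

Lemma ses_coker_zero X Y Z (f : mor X Y) (g : mor Y Z) : ses f g -> zero_obj Z -> is_iso f.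
Proof.
move=> s Z0; apply: mono_epi_iso (ses_mono s) _; apply/epiP => W w /(ses_desc s)[w' ->].
by rewrite (zero_from w' Z0) comp0m.
Qed.

Lemma coker_zero_epi X Y Z (f : mor X Y) (g : mor Y Z) :
  is_cokernel f g -> zero_obj Z -> epi f.
Proof.
move=> /cokernelP[_ _ gU] Z0; apply/epiP => W w /gU[w' ->].
by rewrite (zero_from w' Z0) comp0m.
Qed.

Lemma ses_id_zero X Z : zero_obj Z -> ses (idm X) (0 : mor X Z).
Proof.
move=> Z0; apply/sesP; split.
- by apply/iso_mono/iso_id.
- exact: zero_to_epi.
- exact: comp0m.
- by move=> W w _; exists w; rewrite comp1m.
Qed.

Lemma ses_isol X' X Y Z (e : mor X' X) (f : mor X Y) (g : mor Y Z) :
  is_iso e -> ses f g -> ses (f \co e) g.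
Proof.
move=> Ie /sesP[mf eg gf fU]; apply/sesP; split=> //.
- by apply: mono_comp => //; apply: iso_mono.
- by rewrite compmA gf comp0m.
- move=> W w /fU[w' ->]; case: Ie => d [de ed]; exists (d \co w').
  by rewrite compmA -(compmA f) ed compm1.
Qed.

Lemma ses_isor X Y Z Z' (e : mor Z Z') (f : mor X Y) (g : mor Y Z) :
  is_iso e -> ses f g -> ses f (e \co g).
Proof.
move=> Ie /sesP[mf eg gf fU]; apply/sesP; split=> //.
- by apply: epi_comp => //; apply: iso_epi.
- by rewrite -compmA gf compm0.
- move=> W w E; apply: fU; apply: (iso_mono Ie).
  by rewrite compmA E compm0.
Qed.

Lemma ses_isom X Y Y' Z (e : mor Y' Y) (d : mor Y Y') (f : mor X Y) (g : mor Y Z) :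
  d \co e = idm _ -> e \co d = idm _ -> ses f g -> ses (d \co f) (g \co e).
Proof.
move=> de ed /sesP[mf eg gf fU]; apply/sesP; split.
- by apply: mono_comp => //; apply: iso_mono; exists e.
- by apply: epi_comp => //; apply: iso_epi; exists d.
- by rewrite compmA -(compmA g) ed compm1.
- move=> W w; rewrite -compmA => /fU[w' E]; exists w'.
  by rewrite -compmA -E compmA de comp1m.
Qed.

Lemma short_exact_iso X X' Y Y' Z Z' :
  iso_obj X X' -> iso_obj Y Y' -> iso_obj Z Z' ->
  short_exact X Y Z -> short_exact X' Y' Z'.
Proof.
move=> /iso_obj_sym[a Ia] [b [b' [b'b bb']]] [c Ic] [f [g fg]].
exists (b \co (f \co a)), ((c \co g) \co b').
by apply: ses_isom => //; apply: ses_isol => //; apply: ses_isor.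
Qed.

Lemma ses_kernel_iso X X' Y Z Z' (f : mor X Y) (g : mor Y Z)
    (f' : mor X' Y) (g' : mor Y Z') :
  ses f g -> ses f' g' -> g' \co f = 0 -> g \co f' = 0 ->
  exists (u : mor X X') (v : mor Z Z'), [/\ is_iso u, f = f' \co u, is_iso v & g' = v \co g].
Proof.
move=> s s' E E'.
have [u uE] := ses_lift s' E; have [u' uE'] := ses_lift s E'.
have [v vE] := ses_desc s E; have [v' vE'] := ses_desc s' E'.
exists u, v; split=> //.
  exists u'; split.
    by apply: (ses_mono s); rewrite compmA -uE' -uE compm1.
  by apply: (ses_mono s'); rewrite compmA -uE -uE' compm1.
exists v'; split.
  by apply: (ses_epi s); rewrite -compmA -vE -vE' comp1m.
by apply: (ses_epi s'); rewrite -compmA -vE' -vE comp1m.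
Qed.

Section Biproduct.
Variables (X Y P : C) (i : mor X P) (j : mor Y P).
Hypothesis cop : coproduct i j.

Lemma copair Z (f : mor X Z) (g : mor Y Z) : exists h, h \co i = f /\ h \co j = g.
Proof. by have [h [E _]] := cop f g; exists h. Qed.

Lemma copair_eq Z (h h' : mor P Z) : h \co i = h' \co i -> h \co j = h' \co j -> h = h'.
Proof.
move=> E1 E2; have [h0 [_ u]] := cop (h \co i) (h \co j).
by rewrite -(u h) // -(u h').
Qed.

Lemma biproduct : exists (p : mor P X) (q : mor P Y),
  [/\ p \co i = idm _, p \co j = 0, q \co i = 0, q \co j = idm _ &
      i \co p + j \co q = idm _].
Proof.
have [p [p1 p2]] := copair (idm X) 0; have [q [q1 q2]] := copair 0 (idm Y).
exists p, q; split=> //; apply: copair_eq; rewrite comp1m compDm -!compmA.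
  by rewrite p1 q1 compm1 compm0 addr0.
by rewrite p2 q2 compm1 compm0 add0r.
Qed.

End Biproduct.

Lemma pullback_ses X Y Z W (j : mor X Y) (g : mor Y Z) (w : mor W Z) : ses j g ->
  exists E (i : mor X E) (p : mor E W) (y : mor E Y),
    [/\ ses i p, g \co y = w \co p & y \co i = j].
Proof.
move=> sg; have eg := ses_epi sg; have [P [i [l cop]]] := ab_sum Y W.
have [p [q [pi pl qi ql S]]] := biproduct cop.
(* The pullback is the kernel of [h], which is [g] on [Y] and [- w] on [W]. *)
pose h := g \co p - w \co q.
have hi : h \co i = g by rewrite compBm -!compmA pi qi compm0 compm1 subr0.
have eh : epi h by apply: (@epi_of_comp _ _ _ h i); rewrite hi.
have [E [k s]] := ses_of_epi eh.
have gk : g \co (p \co k) = w \co (q \co k).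
  have := ses0 s; rewrite compBm -!compmA => /eqP; rewrite subr_eq0 => /eqP ->.
  by rewrite compmA.
have [i' iE] : exists i', i \co j = k \co i'.
  by apply: (ses_lift s); rewrite compmA hi (ses0 sg).
exists E, i', (q \co k), (p \co k); split=> //; last first.
  by rewrite -compmA -iE compmA pi comp1m.
apply/sesP; split.
- apply: (@mono_of_comp _ _ _ (p \co k)).
  by rewrite -compmA -iE compmA pi comp1m; apply: ses_mono sg.
- apply/epiP => A a; rewrite compmA => /(ses_desc s)[b bE].
  have b0 : b = 0.
    move/epiP: eg; apply; rewrite -hi compmA -bE -compmA qi; exact: compm0.
  by rewrite -(compm1 a) -ql compmA bE b0 comp0m comp0m.
- by rewrite -compmA -iE compmA qi comp0m.
- move=> V v E0.
  have [z zE] : exists z, p \co k \co v = j \co z.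
    by apply: (ses_lift sg); rewrite compmA gk -compmA E0 compm0.
  exists z; apply: (ses_mono s); rewrite compmA -iE -compmA -zE.
  rewrite -[LHS](comp1m) -S compDm -!compmA [q \co _]compmA E0 compm0 addr0.
  by rewrite !compmA.
Qed.

(** This replaces the choice of a preimage in a diagram chase: [w] is a generalized element of [Z],
    and it lifts to [Y] on a cover of its domain. *)
Lemma epi_refine Y Z W (g : mor Y Z) (w : mor W Z) : epi g ->
  exists V (e : mor V W) (y : mor V Y), epi e /\ g \co y = w \co e.
Proof.
move=> /ses_of_epi[X [j s]]; have [E [i [p [y [s' E1 _]]]]] := pullback_ses w s.
by exists E, p, y; split=> //; apply: ses_epi s'.
Qed.

(** Closes a chase begun with [epi_refine]: a factorization through a monomorphism descends along
    the cover on which it was found. *)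
Lemma factor_epi X Y Z W (k : mor X Y) (e : mor W Z) (w : mor Z Y) (x : mor W X) :
  mono k -> epi e -> w \co e = k \co x -> exists y, w = k \co y.
Proof.
move=> mk ee E; have [Q [q s]] := ses_of_mono mk.
apply: (ses_lift s); apply: ee.
by rewrite -compmA E compmA (ses0 s) !comp0m.
Qed.

(** Here [M'] is the preimage of [N] in [M]; through it an induction on a composition series of [V]
    reaches the extensions of [V]. *)
Lemma ses_preimage U M V N T (u : mor U M) (v : mor M V) (i : mor N V) (t : mor V T) :
  ses u v -> ses i t -> exists M' (k : mor M' M) (u' : mor U M') (v' : mor M' N),
    [/\ ses k (t \co v), ses u' v', u = k \co u' & v \co k = i \co v'].
Proof.
move=> suv sit.
have etv : epi (t \co v) by apply: epi_comp; [apply: ses_epi sit|apply: ses_epi suv].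
have [M' [k sk]] := ses_of_epi etv.
have [v' vE] : exists v', v \co k = i \co v'.
  by apply: (ses_lift sit); rewrite compmA (ses0 sk).
have [u' uE] : exists u', u = k \co u'.
  by apply: (ses_lift sk); rewrite -compmA (ses0 suv) compm0.
exists M', k, u', v'; split=> //; apply/sesP; split.
- by apply: (@mono_of_comp _ _ _ k); rewrite -uE; apply: ses_mono suv.
- have [E [e [y [ee yE]]]] := epi_refine i (ses_epi suv).
  have [z zE] : exists z, y = k \co z.
    by apply: (ses_lift sk); rewrite -compmA yE compmA (ses0 sit) comp0m.
  apply: (@epi_of_comp _ _ _ _ z).
  suff -> : v' \co z = e by [].
  by apply: (ses_mono sit); rewrite compmA -vE -compmA -zE.
- by apply: (ses_mono sit); rewrite compmA -vE -compmA -uE (ses0 suv) compm0.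
- move=> W w vw.
  have [x xE] : exists x, k \co w = u \co x.
    by apply: (ses_lift suv); rewrite compmA vE -compmA vw compm0.
  by exists x; apply: (ses_mono sk); rewrite xE uE compmA.
Qed.

Lemma split_coproduct X Y Z (m : mor X Y) (r : mor Y X) (k : mor Z Y) :
  ses k r -> r \co m = idm X -> coproduct m k.
Proof.
move=> s rm A f g.
have [t tE] : exists t, idm Y - m \co r = k \co t.
  by apply: (ses_lift s); rewrite compmB compm1 compmA rm comp1m subrr.
have tm : t \co m = 0.
  by apply: (ses_mono s); rewrite compmA -tE compBm comp1m -compmA rm compm1 subrr compm0.
have tk : t \co k = idm Z.
  apply: (ses_mono s); rewrite compmA -tE compBm comp1m -compmA (ses0 s).
  by rewrite compm0 subr0 compm1.
exists (f \co r + g \co t); split.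
  rewrite !compDm -!compmA rm tm tk (ses0 s) !compm0 !compm1 addr0 add0r //.
move=> h [hm hk]; rewrite -hm -hk -!compmA -compmD -tE addrC subrK compm1 //.
Qed.

Lemma image X Y (f : mor X Y) : exists I (e : mor X I) (m : mor I Y),
  [/\ epi e, mono m & f = m \co e].
Proof.
have [K [k kf]] := ab_ker f; have [I [e ce]] := ab_coker k.
case/kernelP: (kf) => mk fk fU; case/cokernelP: (ce) => ee ek eU.
have [m E] := eU _ _ fk; exists I, e, m; split=> //.
apply/monoP => W w mw.
have [V [d [x [ed ex]]]] := epi_refine w ee.
have [x' xE] : exists x', x = k \co x'.
  by apply: fU; rewrite E -compmA ex compmA mw comp0m.
by move/epiP: ed; apply; rewrite -ex xE compmA ek comp0m.
Qed.

Lemma simple_to_epi X (T : C) (f : mor X T) : simple_obj T -> f <> 0 -> epi f.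
Proof.
move=> [_ sT] fN0; have [I [e [m [ee mm E]]]] := image f.
have [I0|Im] := sT _ _ mm.
  by case: fN0; rewrite E (zero_to e I0) compm0.
by rewrite E; apply: epi_comp => //; apply: iso_epi.
Qed.

Lemma simple_from_mono X (T : C) (f : mor T X) : simple_obj T -> f <> 0 -> mono f.
Proof.
move=> [_ sT] fN0; have [K [k kf]] := ab_ker f.
case/kernelP: (kf) => mk fk fU.
have [K0|[k' [_ kk]]] := sT _ _ mk; last first.
  by case: fN0; rewrite -(compm1 f) -kk compmA fk comp0m.
by apply/monoP => W w /fU[w' ->]; rewrite (zero_to w' K0) compm0.
Qed.

Lemma simple_iso X Y : iso_obj X Y -> simple_obj X -> simple_obj Y.
Proof.
move=> XY [X0 sX]; split; first by move/(zero_obj_iso (iso_obj_sym XY)).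
case: XY => f [g [gf fg]] Z i mi.
have If : is_iso f by exists g.
have Ig : is_iso g by exists f.
have [|Z0|Ii] := sX _ (g \co i); [|by left|right].
  by apply: mono_comp => //; apply: iso_mono.
have -> : i = f \co (g \co i) by rewrite compmA fg comp1m.
exact: iso_comp.
Qed.

Lemma simple_simple_iso (T T' : C) (f : mor T T') :
  simple_obj T -> simple_obj T' -> f <> 0 -> is_iso f.
Proof.
by move=> sT sT' f0; apply: mono_epi_iso; [apply: simple_from_mono|apply: simple_to_epi].
Qed.

Lemma nonzero_id X : ~ zero_obj X -> idm X <> 0.
Proof. by move=> X0 /zero_objP. Qed.

End AbelianBasics.

(** * Composition factors *)

Section CompositionFactors.
Variable C : abelian.
Variable P : C -> Prop.
Implicit Types X Y Z W U V M N T : C.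

(* P is a class of simple objects: cfactors M n counts, with multiplicity, the
   composition factors of M lying in P. *)
Inductive cfactors : C -> nat -> Prop :=
| CFactors0 M : zero_obj M -> cfactors M 0
| CFactorsS N M T n : cfactors N n -> simple_obj T -> short_exact N M T ->
    cfactors M (n + `[< P T >]).

Lemma cfactors_fl M n : cfactors M n -> finite_length M.
Proof.
by elim=> [{}M M0|N {}M T {}n _ IH sT sM]; [apply: FiniteLength0|apply: FiniteLengthS sM].
Qed.

Lemma fl_cfactors M : finite_length M -> exists n, cfactors M n.
Proof.
elim=> [{}M M0|N {}M T _ [n IH] sT sM]; first by exists 0%N; apply: CFactors0.
by exists (n + `[< P T >])%N; apply: CFactorsS sM.
Qed.

Lemma cfactors_iso M M' n : iso_obj M M' -> cfactors M n -> cfactors M' n.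
Proof.
move=> MM' cM; case: cM MM' => [{}M M0|N {}M T {}n cN sT sM] MM'.
  by apply: CFactors0; apply: zero_obj_iso M0.
by apply: (CFactorsS cN sT); apply: short_exact_iso sM => //; apply: iso_obj_refl.
Qed.

Lemma cfactors_zero M n : zero_obj M -> cfactors M n -> n = 0%N.
Proof.
move=> M0 cM; case: cM M0 => [//|N {}M T {}n _ [T0 _] [f [g s]]] M0.
by case: T0; apply: epi_zero (ses_epi s) M0.
Qed.

(** The last factor [T] of [M] goes to [V] if [t] vanishes on [U], and to [U] otherwise, since a
    nonzero map to a simple object is epi. The rest of the series is cut by induction. *)
Lemma cfactors_ses M n U V (u : mor U M) (v : mor M V) :
  cfactors M n -> ses u v ->
  exists a b, [/\ (a + b = n)%N, cfactors U a & cfactors V b].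
Proof.
move=> cM; elim: cM U V u v => [{}M M0|N {}M T {}n cN IH sT [i [t sit]]] U V u v suv.
  exists 0%N, 0%N; split=> //; apply: CFactors0.
    exact: mono_zero (ses_mono suv) M0.
  exact: epi_zero (ses_epi suv) M0.
have [tu0|tuN0] := pselect (t \co u = 0).
  have [u' uE] := ses_lift sit tu0.
  have mu' : mono u' by apply: (@mono_of_comp _ _ _ _ i); rewrite -uE; apply: ses_mono suv.
  have [V' [v' s']] := ses_of_mono mu'.
  have [a [b [ab cU cV']]] := IH _ _ _ _ s'.
  exists a, (b + `[< P T >])%N; split=> //; first by rewrite addnA ab.
  have [t' tE] := ses_desc suv tu0.
  have [k kE] : exists k, v \co i = k \co v'.
    by apply: (ses_desc s'); rewrite -compmA -uE (ses0 suv).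
  have mk : mono k.
    apply/monoP => W w kw; have [E [e [n' [ee nE]]]] := epi_refine w (ses_epi s').
    move/epiP: ee; apply; rewrite -nE.
    have [y yE] : exists y, i \co n' = u \co y.
      by apply: (ses_lift suv); rewrite compmA kE -compmA nE compmA kw comp0m.
    have -> : n' = u' \co y by apply: (ses_mono sit); rewrite yE uE compmA.
    by rewrite compmA (ses0 s') comp0m.
  apply: (CFactorsS cV' sT); exists k, t'; apply/sesP; split=> //.
  - by apply: (@epi_of_comp _ _ _ _ _ v); rewrite -tE; apply: ses_epi sit.
  - by apply: (ses_epi s'); rewrite -compmA -kE compmA -tE (ses0 sit) comp0m.
  - move=> W w tw; have [E [e [m [ee mE]]]] := epi_refine w (ses_epi suv).
    have [n' nE] : exists n', m = i \co n'.
      by apply: (ses_lift sit); rewrite tE -compmA mE compmA tw comp0m.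
    apply: (@factor_epi _ _ _ _ _ k e w (v' \co n')) => //.
    by rewrite -mE nE !compmA kE.
(* Now [U] maps onto [T], so [N] still maps onto [V]; the kernel [K] is the intersection of [U] and
   [N]. *)
have etu := simple_to_epi sT tuN0.
have [K [k sk]] := ses_of_epi etu.
have [k' kE] : exists k', u \co k = i \co k'.
  by apply: (ses_lift sit); rewrite compmA (ses0 sk).
have s' : ses k' (v \co i).
  apply/sesP; split.
  - apply: (@mono_of_comp _ _ _ _ i); rewrite -kE.
    by apply: mono_comp; [apply: ses_mono suv|apply: ses_mono sk].
  - apply/epiP => A a; rewrite compmA => /(ses_desc sit)[b E].
    have b0 : b = 0.
      by move/epiP: etu; apply; rewrite compmA -E -compmA (ses0 suv) compm0.
    by move/epiP: (ses_epi suv); apply; rewrite E b0 comp0m.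
  - by rewrite -compmA -kE compmA (ses0 suv) comp0m.
  - move=> W w; rewrite -compmA => /(ses_lift suv)[y yE].
    have [z zE] : exists z, y = k \co z.
      by apply: (ses_lift sk); rewrite -compmA -yE compmA (ses0 sit) comp0m.
    by exists z; apply: (ses_mono sit); rewrite yE zE !compmA kE.
have [a [b [ab cK cV]]] := IH _ _ _ _ s'.
exists (a + `[< P T >])%N, b; split=> //; first by rewrite addnAC ab.
exact: CFactorsS cK sT (ses_short sk).
Qed.

Lemma cfactors_ext U M V a b (u : mor U M) (v : mor M V) :
  cfactors U a -> cfactors V b -> ses u v -> cfactors M (a + b).
Proof.
move=> cU cV; elim: cV M u v => [{}V V0|N {}V T {}b cN IH sT [i [t sit]]] M u v suv.
  by rewrite addn0; apply: cfactors_iso cU; exists u; apply: ses_coker_zero suv V0.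
have [M' [k [u' [v' [sk su _ _]]]]] := ses_preimage suv sit.
by rewrite addnA; apply: CFactorsS sT (ses_short sk); apply: IH su.
Qed.

Hypothesis P_iso : forall X Y, iso_obj X Y -> P X -> P Y.

Lemma cfactors_simple T n : simple_obj T -> cfactors T n -> n = `[< P T >].
Proof.
move=> sT cT; case: cT sT => [M M0 [] //|N M T' m cN sT' [f [g s]] sM].
have [N0|If] := sM.2 _ _ (ses_mono s); last first.
  case: sT'.1; apply/zero_objP; apply: (ses_epi s); apply: (iso_epi If).
  by rewrite !comp0m -compmA (ses0 s) compm0.
rewrite (cfactors_zero N0 cN) add0n; congr (nat_of_bool _); apply: asbool_equiv_eq.
have Ig := ses_ker_zero s N0.
by split; apply: P_iso; [apply: iso_obj_sym|]; exists g.
Qed.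

(** Jordan-Hoelder, by induction on the first series: [cfactors_ses] cuts the second one along the
    last step of the first. *)
Lemma cfactors_inj M n m : cfactors M n -> cfactors M m -> n = m.
Proof.
move=> cM; elim: cM m => [{}M M0 m /(cfactors_zero M0)//|N {}M T {}n _ IH sT [f [g s]] m].
move=> /cfactors_ses/(_ s)[a [b [<- cN cT]]].
by rewrite (IH _ cN) (cfactors_simple sT cT).
Qed.

End CompositionFactors.

Section Length.
Variable C : abelian.
Implicit Types X Y Z U V M N T : C.

Definition has_length (M : C) n := cfactors (fun _ => True) M n.

Lemma has_length_inj M n m : has_length M n -> has_length M m -> n = m.
Proof. exact: cfactors_inj. Qed.

Lemma has_length0 M : has_length M 0 -> zero_obj M.
Proof.
move E: 0%N => n cM; case: cM E => // N M' T m _ _ _.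
by rewrite asboolT // addn1.
Qed.

Lemma fl_ses U M V (u : mor U M) (v : mor M V) :
  ses u v -> finite_length M -> finite_length U /\ finite_length V.
Proof.
move=> s /(fl_cfactors (fun _ => True))[n /cfactors_ses/(_ s)[a [b [_ cU cV]]]].
by split; apply: cfactors_fl; eassumption.
Qed.

Lemma epi_same_length M N n (f : mor M N) :
  epi f -> has_length M n -> has_length N n -> is_iso f.
Proof.
move=> ef cM cN; have [K [k s]] := ses_of_epi ef.
have [a [b [ab cK cN']]] := cfactors_ses cM s.
apply: (ses_ker_zero s); apply: has_length0; suff <- : a = 0%N by [].
by apply/eqP; rewrite -(eqn_add2r b) ab (has_length_inj cN' cN).
Qed.

Lemma mono_same_length M N n (f : mor M N) :
  mono f -> has_length M n -> has_length N n -> is_iso f.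
Proof.
move=> mf cM cN; have [K [k s]] := ses_of_mono mf.
have [a [b [ab cM' cK]]] := cfactors_ses cN s.
apply: (ses_coker_zero s); apply: has_length0; suff <- : b = 0%N by [].
by apply/eqP; rewrite -(eqn_add2l a) addn0 ab (has_length_inj cM' cM).
Qed.

Lemma simple_quotient M : finite_length M -> ~ zero_obj M ->
  exists T (t : mor M T), simple_obj T /\ epi t.
Proof.
case=> [{}M //|N {}M T _ sT [f [g s]] _].
by exists T, g; split=> //; apply: ses_epi s.
Qed.

Lemma simple_subobject M : finite_length M -> ~ zero_obj M ->
  exists T (t : mor T M), simple_obj T /\ mono t.
Proof.
elim=> [{}M //|N {}M T _ IH sT [f [g s]] _].
have [N0|N0] := pselect (zero_obj N); last first.
  have [T' [t [sT' mt]]] := IH N0; exists T', (f \co t); split=> //.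
  by apply: mono_comp => //; apply: ses_mono s.
exists M, (idm M); split; last by apply/iso_mono/iso_id.
by apply: simple_iso sT; apply: iso_obj_sym; exists g; apply: ses_ker_zero s N0.
Qed.

Lemma simple_fl T : simple_obj T -> finite_length T.
Proof.
move=> sT; have [Z Z0] := ab_zero C.
apply: (FiniteLengthS (FiniteLength0 Z0) sT); exists 0, (idm T); apply/sesP; split.
- exact: zero_from_mono.
- exact/iso_epi/iso_id.
- exact: compm0.
- by move=> W w; rewrite comp1m => ->; exists 0; rewrite compm0.
Qed.

Lemma fl_epi M N (f : mor M N) : epi f -> finite_length M -> finite_length N.
Proof. by move=> /ses_of_epi[K [k s]] /(fl_ses s)[]. Qed.

Lemma fl_mono M N (f : mor M N) : mono f -> finite_length N -> finite_length M.
Proof. by move=> /ses_of_mono[K [k s]] /(fl_ses s)[]. Qed.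

End Length.

(* The model is the degree shift by -d together with the multiplication
   M(-d) -> M by a fixed homogeneous element of degree d. *)
Record twisting (C : abelian) := Twisting {
  tw : C -> C;
  twm : forall X Y, mor X Y -> mor (tw X) (tw Y);
  twm1 : forall X, twm (idm X) = idm (tw X);
  twmM : forall X Y Z (g : mor Y Z) (f : mor X Y), twm (g \co f) = twm g \co twm f;
  twm_inj : forall X Y (f g : mor X Y), twm f = twm g -> f = g;
  twm_full : forall X Y (g : mor (tw X) (tw Y)), exists f, g = twm f;
  tw_ess : forall Y, exists X, iso_obj (tw X) Y;
  twn : forall X, mor (tw X) X;
  twnN : forall X Y (f : mor X Y), f \co twn X = twn Y \co twm f
}.

Arguments twm {C} t {X Y} f.

(** * Twistings, and the composition factors that they kill *)

Section Twisting.
Variables (C : abelian) (F : twisting C).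
Implicit Types X Y Z W M N T : C.
Local Notation F0 := (tw F).
Local Notation F1 := (twm F).
Local Notation n_ := (twn F).

Lemma twm_isoE X Y (f : mor X Y) : is_iso (F1 f) <-> is_iso f.
Proof.
split=> [[g [gf fg]]|[g [gf fg]]].
  have [g' gE] := twm_full g; exists g'; split; apply: (@twm_inj _ F);
  by rewrite twmM twm1 -gE.
by exists (F1 g); rewrite -!twmM gf fg !twm1.
Qed.

Lemma tw_iso X Y : iso_obj X Y -> iso_obj (F0 X) (F0 Y).
Proof. by case=> f If; exists (F1 f); apply/twm_isoE. Qed.

Lemma tw_zeroE X : zero_obj (F0 X) <-> zero_obj X.
Proof.
have H Y : zero_obj (F0 Y) -> zero_obj Y.
  move=> FY0; apply/zero_objP; apply: (@twm_inj _ F).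
  by rewrite (zero_to (F1 (idm Y)) FY0) [RHS](zero_to _ FY0).
split=> [/H//|X0].
(* A zero object is isomorphic to some [F0 Y]; then [Y] is zero by [H], hence isomorphic to [X]. *)
have [Z Z0] := ab_zero C; have [Y YZ] := tw_ess F Z.
have FY0 : zero_obj (F0 Y) by apply: zero_obj_iso Z0; apply: iso_obj_sym.
apply: (zero_obj_iso _ FY0); apply: tw_iso; exists 0; exists 0.
split; rewrite comp0m; apply/esym/zero_objP; last exact: X0.
exact: H FY0.
Qed.

Lemma twm0 X Y : F1 (0 : mor X Y) = 0.
Proof.
have [Z Z0] := ab_zero C.
rewrite -(comp0m _ (0 : mor X Z)) twmM (zero_to (F1 (0 : mor X Z)) _) ?compm0 //.
exact/tw_zeroE.
Qed.

Lemma twm_eq0 X Y (f : mor X Y) : F1 f = 0 -> f = 0.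
Proof. by move=> E; apply: (@twm_inj _ F); rewrite twm0. Qed.

(** With [twm_from], the means to transport properties through the equivalence: a test morphism into
    or out of [F0 X] is, up to an isomorphism, the image of one into or out of [X]. *)
Lemma twm_to W X (w : mor W (F0 X)) :
  exists V (e : mor (F0 V) W) (v : mor V X), is_iso e /\ w \co e = F1 v.
Proof.
have [V [e Ie]] := tw_ess F W; have [v E] := twm_full (w \co e).
by exists V, e, v.
Qed.

Lemma twm_from W X (w : mor (F0 X) W) :
  exists V (e : mor W (F0 V)) (v : mor X V), is_iso e /\ e \co w = F1 v.
Proof.
have [V /iso_obj_sym[e Ie]] := tw_ess F W; have [v E] := twm_full (e \co w).
by exists V, e, v.
Qed.

Lemma twm_mono X Y (f : mor X Y) : mono f -> mono (F1 f).
Proof.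
move=> mf; apply/monoP => W w fw.
have [V [e [v [Ie E]]]] := twm_to w.
move/epiP: (iso_epi Ie); apply; rewrite E.
suff -> : v = 0 by rewrite twm0.
by move/monoP: mf; apply; apply: twm_eq0; rewrite twmM -E compmA fw comp0m.
Qed.

Lemma twm_epi X Y (f : mor X Y) : epi f -> epi (F1 f).
Proof.
move=> mf; apply/epiP => W w fw.
have [V [e [v [Ie E]]]] := twm_from w.
move/monoP: (iso_mono Ie); apply; rewrite E.
suff -> : v = 0 by rewrite twm0.
by move/epiP: mf; apply; apply: twm_eq0; rewrite twmM -E -compmA fw compm0.
Qed.

Lemma twm_ses X Y Z (f : mor X Y) (g : mor Y Z) : ses f g -> ses (F1 f) (F1 g).
Proof.
move=> s; apply/sesP; split.
- exact/twm_mono/(ses_mono s).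
- exact/twm_epi/(ses_epi s).
- by rewrite -twmM (ses0 s) twm0.
- move=> W w gw; have [V [e [v [[d [de ed]] E]]]] := twm_to w.
  have [y yE] : exists y, v = f \co y.
    by apply: (ses_lift s); apply: twm_eq0; rewrite twmM -E compmA gw comp0m.
  by exists (F1 y \co d); rewrite compmA -twmM -yE -E -compmA ed compm1.
Qed.

Lemma tw_simple T : simple_obj T -> simple_obj (F0 T).
Proof.
move=> [T0 sT]; split; first by move/tw_zeroE.
move=> W w mw; have [V [e [v [Ie E]]]] := twm_to w.
have mv : mono v.
  apply/monoP => A a va; apply: twm_eq0.
  have /monoP mwe : mono (w \co e) by apply: mono_comp => //; apply: iso_mono.
  by apply: mwe; rewrite E -twmM va twm0.
have [V0|Iv] := sT _ _ mv.
  by left; apply: zero_obj_iso (_ : zero_obj (F0 V)); [exists e|apply/tw_zeroE].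
right; case: (Ie) => d [de ed]; rewrite -(compm1 w) -ed compmA E.
by apply: iso_comp; [apply/twm_isoE|exists e].
Qed.

Lemma tw_length M n : has_length M n -> has_length (F0 M) n.
Proof.
elim=> [{}M M0|N {}M T {}n _ IH sT [f [g s]]].
  exact/CFactors0/tw_zeroE.
have := CFactorsS IH (tw_simple sT) (ses_short (twm_ses s)).
by rewrite !asboolT.
Qed.

Definition killed M := n_ M = 0.

Lemma killed_iso X Y : iso_obj X Y -> killed X -> killed Y.
Proof.
move=> [f If]; rewrite /killed => X0.
have /epiP := twm_epi (iso_epi If); apply.
by rewrite -twnN X0 compm0.
Qed.

Lemma killed_epi X Y (f : mor X Y) : epi f -> killed X -> killed Y.
Proof.
move=> ef kX; move/epiP: (twm_epi ef); apply.
by rewrite -twnN kX compm0.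
Qed.

(** The shift preserves length, so there is no room for a kernel. *)
Lemma twn_epi_iso M : finite_length M -> epi (n_ M) -> is_iso (n_ M).
Proof.
move=> /(fl_cfactors (fun _ => True))[n cM] e.
exact: epi_same_length e (tw_length cM) cM.
Qed.

(** On the subobject [N] the map [twn] is mono, hence invertible by length, so the induction
    continues; on the quotient [T] it is epi, so [T] is not killed. *)
Lemma twn_iso_cfactors M n : is_iso (n_ M) -> cfactors killed M n -> n = 0%N.
Proof.
move=> + cM; elim: cM => [//|N {}M T {}n cN IH sT [f [g s]]] IM.
have mN : mono (n_ N).
  apply: (@mono_of_comp _ _ _ _ f); rewrite twnN.
  by apply: mono_comp; [apply: iso_mono|apply/twm_mono/(ses_mono s)].
have eT : epi (n_ T).
  apply: (@epi_of_comp _ _ _ _ _ (F1 g)); rewrite -twnN.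
  by apply: epi_comp; [apply: ses_epi s|apply: iso_epi].
have [l lN] := fl_cfactors (fun _ => True) (cfactors_fl cN).
rewrite IH; last exact: mono_same_length mN (tw_length lN) lN.
rewrite asboolF // => kT; case: sT.1; apply/zero_objP.
by move/epiP: eT; apply; rewrite kT compm0.
Qed.

Lemma killed_not_epi M n :
  finite_length M -> cfactors killed M n -> (0 < n)%N -> ~ epi (n_ M).
Proof. by move=> flM cM + /(twn_epi_iso flM)/twn_iso_cfactors/(_ cM) n0; rewrite n0. Qed.

(** The cokernel of [twn] is killed and nonzero, and any simple quotient of it will do. *)
Lemma killed_quotient M : finite_length M -> ~ epi (n_ M) ->
  exists T (t : mor M T), [/\ simple_obj T, epi t & killed T].
Proof.
move=> flM ne; have [D [d cd]] := ab_coker (n_ M); case/cokernelP: (cd) => ed dn _.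
have kD : killed D.
  by move/epiP: (twm_epi ed); apply; rewrite -twnN.
have D0 : ~ zero_obj D by move/(coker_zero_epi cd).
have [T [t [sT et]]] := simple_quotient (fl_epi ed flM) D0.
exists T, (t \co d); split=> //; first exact: epi_comp.
exact: killed_epi et kD.
Qed.

End Twisting.

(* The properties of line bundles that the argument needs.  In lb_local, T is a
   point and h a function not vanishing there, outside of whose zeros b splits;
   in lb_prime, h is a prime element vanishing at T. *)
Record line_bundles (C : abelian) := LineBundles {
  lb : C -> Prop;
  lb_twists : Type;
  lb_tw : lb_twists -> twisting C;
  lb_iso : forall L M, iso_obj L M -> lb L -> lb M;
  lb_twE : forall h L, lb (tw (lb_tw h) L) <-> lb L;
  lb_torsionfree : forall L T (f : mor T L), lb L -> simple_obj T -> ~ mono f;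
  lb_finite : forall L T, lb L -> simple_obj T -> finite_card (fun _ : mor L T => True);
  lb_generate : forall X Y (f : mor X Y), f <> 0 ->
    exists L (w : mor L X), lb L /\ f \co w <> 0;
  lb_local : forall L T E (b : mor E L), lb L -> simple_obj T -> epi b ->
    exists h, is_iso (twn (lb_tw h) T) /\
      exists s : mor (tw (lb_tw h) L) E, b \co s = twn (lb_tw h) L;
  lb_prime : forall T, simple_obj T ->
    exists h, killed (lb_tw h) T /\
      forall L, lb L -> mono (twn (lb_tw h) L) /\
        exists Q (q : mor L Q), is_cokernel (twn (lb_tw h) L) q /\ simple_obj Q
}.

(** * Line bundles in an abelian category: splitting and finiteness *)

Section LineBundles.
Variables (C : abelian) (B : line_bundles C).
Implicit Types X Y Z W L M N T S E Q : C.
Local Notation lb := (lb B).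

Lemma lb_no_fl L S (f : mor S L) : lb L -> finite_length S -> mono f -> zero_obj S.
Proof.
move=> lL flS mf; have [//|S0] := pselect (zero_obj S).
have [T [t [sT mt]]] := simple_subobject flS S0.
by case: (lb_torsionfree lL sT (mono_comp mf mt)).
Qed.

Lemma section_of_retraction X Y Z (j : mor X Y) (b : mor Y Z) (r : mor Y X) :
  ses j b -> r \co j = idm X -> exists s, b \co s = idm Z.
Proof.
move=> s rj; have [t tE] : exists t, idm Y - j \co r = t \co b.
  by apply: (ses_desc s); rewrite compBm comp1m -compmA rj compm1 subrr.
exists t; apply: (ses_epi s); rewrite -compmA -tE compmB compm1 compmA (ses0 s).
by rewrite comp0m subr0 comp1m.
Qed.

(* The map h_E - s h(b) : h(E) -> E vanishes after b, and its restriction to the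
   kernel T of b is the isomorphism h_T: this splits the sequence. *)
Lemma lb_split_simple L T E (j : mor T E) (b : mor E L) :
  lb L -> simple_obj T -> ses j b -> exists s, b \co s = idm L.
Proof.
move=> lL sT sjb; have [h [IT [s bs]]] := lb_local lL sT (ses_epi sjb).
set F := lb_tw _ in IT s bs.
have [r rE] : exists r, twn F E - s \co twm F b = j \co r.
  by apply: (ses_lift sjb); rewrite compmB twnN compmA bs subrr.
have rj : r \co twm F j = twn F T.
  apply: (ses_mono sjb); rewrite compmA -rE compBm -twnN -compmA -twmM (ses0 sjb).
  by rewrite twm0 compm0 subr0.
have [d [dT Td]] := IT.
have [r' E'] := twm_full (d \co r).
apply: (section_of_retraction (r := r') sjb); apply: (@twm_inj _ F).
by rewrite twmM -E' -compmA rj dT twm1.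
Qed.

(** This is the pushout of the extension along [t], obtained as [E] modulo [N]. *)
Lemma ses_quotient N T T1 E L (i : mor N T) (t : mor T T1) (j : mor T E) (b : mor E L) :
  ses i t -> ses j b ->
  exists E1 (q : mor E E1) (j1 : mor T1 E1) (b1 : mor E1 L),
    [/\ ses (j \co i) q, ses j1 b1, b = b1 \co q & q \co j = j1 \co t].
Proof.
move=> sit sjb; have mji : mono (j \co i).
  by apply: mono_comp; [apply: ses_mono sjb|apply: ses_mono sit].
have [E1 [q sq]] := ses_of_mono mji.
have [b1 bE] : exists b1, b = b1 \co q.
  by apply: (ses_desc sq); rewrite compmA (ses0 sjb) comp0m.
have [j1 jE] : exists j1, q \co j = j1 \co t.
  by apply: (ses_desc sit); rewrite -compmA (ses0 sq).
have mj1 : mono j1.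
  apply/monoP => W w jw; have [V [e [y [ee yE]]]] := epi_refine w (ses_epi sit).
  move/epiP: ee; apply; rewrite -yE.
  have [z zE] : exists z, j \co y = j \co i \co z.
    by apply: (ses_lift sq); rewrite compmA jE -compmA yE compmA jw comp0m.
  have -> : y = i \co z by apply: (ses_mono sjb); rewrite zE compmA.
  by rewrite compmA (ses0 sit) comp0m.
exists E1, q, j1, b1; split=> //; apply/sesP; split=> //.
- by apply: (@epi_of_comp _ _ _ _ _ q); rewrite -bE; apply: ses_epi sjb.
- by apply: (ses_epi sit); rewrite -compmA -jE compmA -bE (ses0 sjb) comp0m.
- move=> W w bw; have [V [e [y [ee yE]]]] := epi_refine w (ses_epi sq).
  have [z zE] : exists z, y = j \co z.
    by apply: (ses_lift sjb); rewrite bE -compmA yE compmA bw comp0m.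
  apply: (@factor_epi _ _ _ _ _ j1 e w (t \co z)) => //.
  by rewrite -yE zE !compmA jE.
Qed.

(** The extension by the top factor [T] of [S] splits by the simple case; pulling back along that
    splitting leaves an extension by [N]. *)
Lemma lb_split L S E (j : mor S E) (b : mor E L) :
  lb L -> finite_length S -> ses j b -> exists s, b \co s = idm L.
Proof.
move=> lL flS; elim: flS E j b => [{}S S0|N {}S T _ IH sT [i [t sit]]] E j b sjb.
  by have [s [_ bs]] := ses_ker_zero sjb S0; exists s.
have [E1 [q [j1 [b1 [sq sj1 bE jE]]]]] := ses_quotient sit sjb.
have [s1 bs1] := lb_split_simple lL sT sj1.
have [E2 [j2 [b2 [p2 [s2 qp _]]]]] := pullback_ses s1 sq.
have [s bs] := IH _ _ _ s2.
exists (p2 \co s); rewrite compmA bE -(compmA b1) qp -!compmA bs compm1 //.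
Qed.

(** The vanishing of Ext^1(L, S') in the form used below: the pullback of the sequence along [p]
    splits. *)
Lemma lb_lift L S' S S'' (j : mor S' S) (b : mor S S'') (p : mor L S'') :
  lb L -> finite_length S' -> ses j b -> exists c, b \co c = p.
Proof.
move=> lL flS s; have [E [i [q [y [s' E1 _]]]]] := pullback_ses p s.
have [t qt] := lb_split lL flS s'.
by exists (y \co t); rewrite compmA E1 -compmA qt compm1.
Qed.

Lemma lb_fl_finite L S : lb L -> finite_length S -> finite_card (fun _ : mor L S => True).
Proof.
move=> lL; elim=> [{}S S0|N {}S T _ IH sT [f [g s]]].
  by exists 1%N; apply: (has_card1 (a := 0)) => // x _; apply: zero_to.
apply: (finite_card_fibre (f := fun u : mor L S => g \co u) _ (lb_finite lL sT)) => //.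
move=> b _; have [[c cE]|N0] := pselect (exists c, g \co c = b); last first.
  by exists 0%N; apply/has_card0 => x [_ E]; case: N0; exists x.
(* The fibre over [b] is a translate of the image of Hom(L, N). *)
apply: (finite_card_image (R := fun (v : mor L N) (u : mor L S) => u = c + f \co v) _ _ IH).
  by move=> x u u' _ -> ->.
move=> u [_ uE]; have [v vE] : exists v, u - c = f \co v.
  by apply: (ses_lift s); rewrite compmB uE cE subrr.
by exists v => //; rewrite -vE addrC subrK.
Qed.

(** Reduction to line bundles: some line bundle [L] maps onto a simple [T], which embeds Hom(T, S)
    into Hom(L, S). *)
Lemma fl_fl_finite M S : finite_length M -> finite_length S ->
  finite_card (fun _ : mor M S => True).
Proof.
move=> flM flS; elim: flM => [{}M M0|N {}M T _ IH sT [f [g s]]].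
  by exists 1%N; apply: (has_card1 (a := 0)) => // x _; apply: zero_from.
have finT : finite_card (fun _ : mor T S => True).
  have [L [w [lL wN0]]] := lb_generate B (nonzero_id sT.1).
  rewrite comp1m in wN0; have ew := simple_to_epi sT wN0.
  apply: (finite_card_inj (f := fun u : mor T S => u \co w) _ _ (lb_fl_finite lL flS)) => //.
  by move=> x y _ _ /ew.
apply: (finite_card_fibre (f := fun u : mor M S => u \co f) _ IH) => // b _.
have [[c cE]|N0] := pselect (exists c, c \co f = b); last first.
  by exists 0%N; apply/has_card0 => x [_ E]; case: N0; exists x.
apply: (finite_card_image (R := fun (v : mor T S) (u : mor M S) => u = c + v \co g) _ _ finT).
  by move=> x u u' _ -> ->.
move=> u [_ uE]; have [v vE] : exists v, u - c = v \co g.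
  by apply: (ses_desc s); rewrite compBm uE cE subrr.
by exists v => //; rewrite -vE addrC subrK.
Qed.

(** A simple quotient of [L] killed by [h] factors through [L / h L], which is itself simple; hence
    its kernel is [h L]. *)
Lemma prime_kernel h L T (t : mor L T) :
  (exists Q (q : mor L Q), is_cokernel (twn (lb_tw h) L) q /\ simple_obj Q) ->
  mono (twn (lb_tw (l := B) h) L) -> simple_obj T -> epi t -> killed (lb_tw h) T ->
  ses (twn (lb_tw h) L) t.
Proof.
move=> [Q [q [cq sQ]]] mn sT et kT.
have s : ses (twn (lb_tw h) L) q by split=> //; apply: mono_kernel.
have [u uE] : exists u, t = u \co q.
  by apply: (ses_desc s); rewrite twnN kT comp0m.
rewrite uE; apply: ses_isor s; apply: simple_simple_iso => // u0.
by case: sT.1; apply/zero_objP; move/epiP: et; apply; rewrite comp1m uE u0 comp0m.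
Qed.

End LineBundles.

(** * Uniqueness of the finite length quotients of a line bundle *)

Section SameFactors.
Variable C : abelian.
Implicit Types X Y Z W U V M N T S Q : C.

(** Equality of the multisets of isomorphism classes of composition factors, expressed through
    counts so that no multiset has to be formed. *)
Definition same_factors (M N : C) :=
  forall P : C -> Prop, (forall X Y, iso_obj X Y -> P X -> P Y) ->
  forall a b, cfactors P M a -> cfactors P N b -> a = b.

Lemma same_factors_refl M : same_factors M M.
Proof. by move=> P Piso a b; apply: cfactors_inj. Qed.

Lemma same_factors_sym M N : same_factors M N -> same_factors N M.
Proof. by move=> H P Piso a b cM cN; apply/esym/(H P). Qed.

Lemma same_factors_iso M N : iso_obj M N -> same_factors M N.
Proof. by move=> MN P Piso a b /(cfactors_iso MN); apply: cfactors_inj. Qed.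

Lemma same_factors_coker U U' M M' V V' : finite_length M -> finite_length M' ->
  short_exact U M V -> short_exact U' M' V' ->
  same_factors U U' -> same_factors M M' -> same_factors V V'.
Proof.
move=> flM flM' [f [g s]] [f' [g' s']] sU sM P Piso a b cV cV'.
have [u cU] := fl_cfactors P (fl_ses s flM).1.
have [u' cU'] := fl_cfactors P (fl_ses s' flM').1.
have := sM _ Piso _ _ (cfactors_ext cU cV s) (cfactors_ext cU' cV' s').
by rewrite (sU _ Piso _ _ cU cU') => /addnI.
Qed.

Lemma same_factors_ker U U' M M' V V' : finite_length M -> finite_length M' ->
  short_exact U M V -> short_exact U' M' V' ->
  same_factors V V' -> same_factors M M' -> same_factors U U'.
Proof.
move=> flM flM' [f [g s]] [f' [g' s']] sV sM P Piso a b cU cU'.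
have [v cV] := fl_cfactors P (fl_ses s flM).2.
have [v' cV'] := fl_cfactors P (fl_ses s' flM').2.
have := sM _ Piso _ _ (cfactors_ext cU cV s) (cfactors_ext cU' cV' s').
by rewrite (sV _ Piso _ _ cV cV') => /addIn.
Qed.

End SameFactors.

Section KernelLemma.
Variables (C : abelian) (B : line_bundles C).
Implicit Types X Y Z W U V L M N T S Q : C.
Local Notation lb := (lb B).

(* A finite length quotient of a line bundle is determined, together with the
   quotient map, by its composition factors: a composition factor T of Q is killed
   by a prime h, hence L -> Q also has a simple quotient killed by h, and the only
   such quotient of L is L/hL. *)
Lemma lb_same_kernel n L Q Q' (p : mor L Q) (p' : mor L Q') :
  lb L -> epi p -> epi p' -> finite_length Q -> finite_length Q' ->
  same_factors Q Q' -> has_length Q n ->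
  forall W (w : mor W L), p \co w = 0 -> p' \co w = 0.
Proof.
elim: n L Q Q' p p' => [|n IH] L Q Q' p p' lL ep ep' flQ flQ' sQ lQ W w pw.
  have [m lQ'] := fl_cfactors (fun _ => True) flQ'.
  apply: zero_to; apply: has_length0; rewrite (sQ _ _ _ _ lQ lQ') //.
have Q0 : ~ zero_obj Q by move=> Q0; have := cfactors_zero Q0 lQ.
have [T [t [sT et]]] := simple_quotient flQ Q0.
have [h [kT pr]] := lb_prime B sT; have [mn sq] := pr _ lL.
set F := lb_tw _ in kT pr mn sq.
have [K [k sk]] := ses_of_epi et.
have [flK _] := fl_ses sk flQ.
have [a cK] := fl_cfactors (killed F) flK.
have [b cQ'] := fl_cfactors (killed F) flQ'.
have [c cT] := fl_cfactors (killed F) (simple_fl sT).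
have cE : c = 1%N by rewrite (cfactors_simple (@killed_iso _ F) sT cT) asboolT.
have b0 : (0 < b)%N.
  by rewrite -(sQ _ (@killed_iso _ F) _ _ (cfactors_ext cK cT sk) cQ') cE addn1.
have [T' [t' [sT' et' kT']]] := killed_quotient flQ' (killed_not_epi flQ' cQ' b0).
have s := prime_kernel sq mn sT (epi_comp et ep) kT.
have s' := prime_kernel sq mn sT' (epi_comp et' ep') kT'.
have [K' [k' sk']] := ses_of_epi et'.
(* The kernel of [Q1 -> T1] is the image of [h L]. As [h L] is again a line bundle, the induction
   hypothesis applies to its maps onto the two kernels. *)
have sub Q1 T1 K1 (p1 : mor L Q1) (t1 : mor Q1 T1) (k1 : mor K1 Q1) : epi p1 ->
    ses k1 t1 -> ses (twn F L) (t1 \co p1) ->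
    exists p2 : mor (tw F L) K1, p1 \co twn F L = k1 \co p2 /\ epi p2.
  move=> ep1 sk1 s1.
  have [p2 pE] : exists p2, p1 \co twn F L = k1 \co p2.
    by apply: (ses_lift sk1); rewrite compmA (ses0 s1).
  exists p2; split=> //.
  have [V [e [y [ee yE]]]] := epi_refine k1 ep1.
  have [z zE] : exists z, y = twn F L \co z.
    by apply: (ses_lift s1); rewrite -compmA yE compmA (ses0 sk1) comp0m.
  apply: (@epi_of_comp _ _ _ _ _ z).
  suff -> : p2 \co z = e by [].
  by apply: (ses_mono sk1); rewrite compmA -pE -compmA -zE.
have [p2 [p2E ep2]] := sub _ _ _ _ _ _ ep sk s.
have [p2' [p2E' ep2']] := sub _ _ _ _ _ _ ep' sk' s'.
have [_ [v [_ _ Iv _]]] := ses_kernel_iso s s' (ses0 s') (ses0 s).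
have [w' wE] : exists w', w = twn F L \co w'.
  by apply: (ses_lift s); rewrite -compmA pw compm0.
have {}lL : lb (tw F L) by apply/lb_twE.
have lK : has_length K n.
  have [m lK] := fl_cfactors (fun _ => True) flK.
  have [l lT] := fl_cfactors (fun _ => True) (simple_fl sT).
  have := has_length_inj lQ (cfactors_ext lK lT sk).
  by rewrite (cfactors_simple _ sT lT) // asboolT // addn1 => -[->].
have sK : same_factors K K'.
  apply: same_factors_ker flQ flQ' (ses_short sk) (ses_short sk') _ sQ.
  by apply: same_factors_iso; exists v.
rewrite wE compmA p2E' -compmA.
rewrite (IH _ _ _ _ _ lL ep2 ep2' flK (fl_ses sk' flQ').1 sK lK _ w') ?compm0 //.
by apply: (ses_mono sk); rewrite compmA -p2E -compmA -wE pw compm0.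
Qed.

Lemma lb_quotient_unique L Q Q' (p : mor L Q) (p' : mor L Q') :
  lb L -> epi p -> epi p' -> finite_length Q -> finite_length Q' ->
  same_factors Q Q' -> exists2 u : mor Q Q', is_iso u & p' = u \co p.
Proof.
move=> lL ep ep' flQ flQ' sQ.
have [n lQ] := fl_cfactors (fun _ => True) flQ.
have [n' lQ'] := fl_cfactors (fun _ => True) flQ'.
have [K [k s]] := ses_of_epi ep; have [K' [k' s']] := ses_of_epi ep'.
have [|| u [v [_ _ Iv vE]]] := ses_kernel_iso s s'; last by exists v.
  exact: (lb_same_kernel lL ep ep' flQ flQ' sQ lQ (ses0 s)).
exact: (lb_same_kernel lL ep' ep flQ' flQ (same_factors_sym sQ) lQ' (ses0 s')).
Qed.

End KernelLemma.

(** * Powers of a twisting and Fitting's lemma *)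

Section TwistPowers.
Variable C : abelian.
Implicit Types X Y Z W M N T S : C.

Section Comp.
Variables G F : twisting C.

Fact tw_comp1 X : twm G (twm F (idm X)) = idm _.
Proof. by rewrite !twm1. Qed.

Fact tw_compM X Y Z (g : mor Y Z) (f : mor X Y) :
  twm G (twm F (g \co f)) = twm G (twm F g) \co twm G (twm F f).
Proof. by rewrite !twmM. Qed.

Fact tw_comp_inj X Y (f g : mor X Y) : twm G (twm F f) = twm G (twm F g) -> f = g.
Proof. by move/twm_inj/twm_inj. Qed.

Fact tw_comp_full X Y (g : mor (tw G (tw F X)) (tw G (tw F Y))) :
  exists f, g = twm G (twm F f).
Proof.
by have [f ->] := twm_full g; have [f' ->] := twm_full f; exists f'.
Qed.

Fact tw_comp_ess Y : exists X, iso_obj (tw G (tw F X)) Y.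
Proof.
have [Z ZY] := tw_ess G Y; have [X XZ] := tw_ess F Z; exists X.
by apply: iso_obj_trans ZY; apply: tw_iso.
Qed.

Fact tw_compN X Y (f : mor X Y) :
  f \co (twn F X \co twn G (tw F X)) = twn F Y \co twn G (tw F Y) \co twm G (twm F f).
Proof. by rewrite compmA (twnN F f) -!compmA twnN. Qed.

Definition tw_comp : twisting C :=
  @Twisting C _ (fun X Y f => twm G (twm F f)) tw_comp1 tw_compM
    tw_comp_inj tw_comp_full tw_comp_ess _ tw_compN.

End Comp.

Fact tw_id_ess (Y : C) : exists X, iso_obj X Y.
Proof. by exists Y; apply: iso_obj_refl. Qed.

Fact tw_id_full X Y (g : mor X Y) : exists f, g = f.
Proof. by exists g. Qed.

Fact tw_idN X Y (f : mor X Y) : f \co idm X = idm Y \co f.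
Proof. by rewrite compm1 comp1m. Qed.

Definition tw_id : twisting C :=
  @Twisting C id (fun X Y f => f) (fun X => erefl) (fun X Y Z g f => erefl)
    (fun X Y f g => id) tw_id_full tw_id_ess (@idm C) tw_idN.

Variable F : twisting C.

(** Each new factor acts last on the object itself: [twn] of the successor power at [X] factors
    through [twn F X]. *)
Fixpoint tw_pow n := if n is n'.+1 then tw_comp (tw_pow n') F else tw_id.

(** The two functors agree, but an isomorphism spares the transport of morphisms along an equality
    of objects. *)
Lemma tw_powD k n X : exists v : mor (tw (tw_pow n) (tw (tw_pow k) X)) (tw (tw_pow (k + n)) X),
  is_iso v /\
  twn (tw_pow k) X \co twn (tw_pow n) (tw (tw_pow k) X) = twn (tw_pow (k + n)) X \co v.
Proof.
elim: k X => [|k IH] X /=.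
  by exists (idm _); split; [apply: iso_id|rewrite comp1m compm1].
have [v [Iv E]] := IH (tw F X); exists v; split=> //.
by rewrite -!compmA E.
Qed.

Lemma killed_mono (G : twisting C) X Y (f : mor X Y) :
  mono f -> killed G Y -> killed G X.
Proof.
by move=> mf kY; move/monoP: mf; apply; rewrite twnN kY comp0m.
Qed.

Lemma tw_pow_iso n X : is_iso (twn F X) -> is_iso (twn (tw_pow n) X).
Proof.
elim: n X => [|n IH] X IX /=; first exact: iso_id.
apply: iso_comp => //; apply: IH.
set f := twn F X in IX.
have If : is_iso (twm F f) by apply/twm_isoE.
(* Naturality of [twn] at the morphism [twn F X] itself passes invertibility from [X] to
   [tw F X]. *)
have E := twnN F f.
have : is_iso (f \co twn F (tw F X)) by rewrite E; apply: iso_comp.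
case: IX => g [gf fg] If2; rewrite -(comp1m (twn F _)) -gf -compmA.
by apply: iso_comp => //; exists f.
Qed.

Lemma killed_iso_zero n X : is_iso (twn F X) -> killed (tw_pow n) X -> zero_obj X.
Proof.
move=> /(tw_pow_iso n) IX kX; apply/zero_objP.
by move/epiP: (iso_epi IX); apply; rewrite comp1m.
Qed.

Lemma nilpotent_simple_killed n T : simple_obj T -> killed (tw_pow n) T -> killed F T.
Proof.
move=> sT kT; have [//|k0] := pselect (killed F T).
case: (sT.1); apply: killed_iso_zero kT.
by apply: simple_simple_iso => //; apply: tw_simple.
Qed.

(** Among the images of the powers choose one, [I], of least length. Its power maps [I] onto itself,
    which makes [I] a direct summand of [S]: either zero or everything. *)
Lemma indecomposable_fitting S : finite_length S -> indecomposable S ->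
  is_iso (twn F S) \/ exists n, killed (tw_pow n) S.
Proof.
move=> flS [S0 iS].
pose Q l := `[< exists n I (e : mor (tw (tw_pow n.+1) S) I) (m : mor I S),
  [/\ epi e, mono m, twn (tw_pow n.+1) S = m \co e & has_length I l] >].
have exQ : exists l, Q l.
  have [I [e [m [ee mm E]]]] := image (twn (tw_pow 1) S).
  have [l lI] := fl_cfactors (fun _ => True) (fl_mono mm flS).
  by exists l; apply/asboolP; exists 0%N, I, e, m.
have [l /asboolP[n [I [e [m [ee mm E lI]]]]] minl] := ex_minnP exQ.
set G := tw_pow n.+1 in e ee E.
have thE : e \co twm G m = twn G I by apply: mm; rewrite compmA -E -twnN.
have [J [e1 [m1 [ee1 mm1 E1]]]] := image (twn G I).
(* The image [J] of the doubled power lies in [I]; by minimality it is as long as [I]. *)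
have Im1 : is_iso m1.
  have flI := fl_mono mm flS; have flJ := fl_mono mm1 flI.
  have [j lJ] := fl_cfactors (fun _ => True) flJ.
  have lj : (l <= j)%N.
    apply: minl; apply/asboolP.
    have [v [[v' [v'v vv']] vE]] := tw_powD n.+1 n.+1 S.
    exists (n + n.+1)%N, J, (e1 \co (twm G e \co v')), (m \co m1); split=> //.
    - do 2?apply: epi_comp => //; first exact: twm_epi.
      by apply: iso_epi; exists v.
    - exact: mono_comp.
    - rewrite [LHS](_ : _ = twn (tw_pow (n.+1 + n.+1)) S) //.
      rewrite -[LHS]compm1 -vv' compmA -vE twnN {2}E twmM -/G {1}E.
      by rewrite !compmA -(compmA m) thE E1 !compmA.
  have [Z [z sz]] := ses_of_mono mm1.
  have [_ flZ] := fl_ses sz flI; have [c lZ] := fl_cfactors (fun _ => True) flZ.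
  have lE := has_length_inj lI (cfactors_ext lJ lZ sz).
  have jl : j = l by apply/eqP; rewrite eqn_leq lj lE leq_addr.
  by apply: mono_same_length mm1 _ lI; rewrite -jl.
have eG : epi (twn G I) by rewrite E1; apply: epi_comp => //; apply: iso_epi.
have [u [uG Gu]] := twn_epi_iso (fl_mono mm flS) eG.
(* Composed with the inverse of [twn G I], the map [e] becomes a retraction of the shifted [m];
   fullness undoes the shift. *)
have [r rE] := twm_full (u \co e).
have rm : r \co m = idm I.
  by apply: (@twm_inj _ G); rewrite twmM -rE -compmA thE uG twm1.
have er : epi r by apply: (@epi_of_comp _ _ _ _ _ m); rewrite rm; apply/iso_epi/iso_id.
have [K [k sk]] := ses_of_epi er.
have [I0|K0] := iS _ _ _ _ (split_coproduct sk rm).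
  by right; exists n.+1; rewrite /killed E (zero_to e I0) compm0.
left; have Ir := ses_ker_zero sk K0.
have mr : m \co r = idm S.
  by apply: (iso_mono Ir); rewrite compmA rm comp1m compm1.
apply: twn_epi_iso flS _; apply: (@epi_of_comp _ _ _ _ _ (twn (tw_pow n) (tw F S))).
rewrite [_ \co _](_ : _ = twn G S) // E; apply: epi_comp => //.
by apply: (@epi_of_comp _ _ _ _ _ r); rewrite mr; apply/iso_epi/iso_id.
Qed.

End TwistPowers.

(** * Indecomposable torsion objects *)

Section Indecomposable.
Variables (C : abelian) (B : line_bundles C).
Implicit Types X Y Z W U V L M N T S Q : C.
Local Notation lb := (lb B).

Section Prime.
Variable h : lb_twists B.
Local Notation F := (lb_tw h).
Hypothesis h_prime : forall L, lb L -> mono (twn F L) /\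
  exists Q (q : mor L Q), is_cokernel (twn F L) q /\ simple_obj Q.

Lemma lb_powE n L : lb (tw (tw_pow F n) L) <-> lb L.
Proof. by elim: n L => [|n IH] L //=; rewrite IH lb_twE. Qed.

Section Cyclic.
Variables (n : nat) (c : C).
Hypotheses (fl_c : finite_length c) (kc : killed (tw_pow F n.+1) c).
Hypothesis kNc : ~ killed (tw_pow F n) c.
Variables (D : C) (d : mor c D).
Hypotheses (cd : is_cokernel (twn F c) d) (sD : simple_obj D).

(** Nakayama: the cokernel [A] of [th] satisfies [h A = A], while [h] is nilpotent on it. *)
Lemma cyclic_epi X (th : mor X c) : d \co th <> 0 -> epi th.
Proof.
move=> /(simple_to_epi sD)/epiP edth.
have [A [a ca]] := ab_coker th; case/cokernelP: (ca) => ea ath _.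
have [ed dn dU] := (cokernelP _ _).1 cd.
have eA : epi (twn F A).
  apply/epiP => W w wA; move/epiP: (ea); apply.
  have [b bE] : exists b, w \co a = b \co d.
    by apply: dU; rewrite -compmA twnN compmA wA comp0m.
  have b0 : b = 0 by apply: edth; rewrite compmA -bE -compmA ath compm0.
  by rewrite bE b0 comp0m.
apply: (coker_zero_epi ca); apply: (killed_iso_zero (F := F) (n := n.+1)).
  by apply: twn_epi_iso => //; apply: fl_epi ea fl_c.
exact: killed_epi ea kc.
Qed.

(** The Baer criterion with [h M] in [M] as test inclusion. If [th] did not land in [h c], it would
    be onto by [cyclic_epi], and the n-th power would kill [c]. A map into [h c] lifts along
    [F c -> h c], because maps from line bundles lift along finite length kernels. *)
Lemma cyclic_extend_lb M (th : mor (tw F M) c) : lb M ->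
  th \co twn (tw_pow F n) (tw F M) = 0 -> exists psi : mor M c, psi \co twn F M = th.
Proof.
move=> lM th0; have [ed dn dU] := (cokernelP _ _).1 cd.
have dth : d \co th = 0.
  have [//|/cyclic_epi eth] := pselect (d \co th = 0); case: kNc.
  by move/epiP: (twm_epi (F := tw_pow F n) eth); apply; rewrite -twnN.
have [I [e [m [ee mm E]]]] := image (twn F c).
have sm : ses m d.
  apply/(_ : is_cokernel m d -> _).
    by move=> cm; split=> //; apply: mono_kernel.
  apply/cokernelP; split=> //.
    by apply: ee; rewrite -compmA -E dn comp0m.
  by move=> W w wm; apply: dU; rewrite E compmA wm comp0m.
have [th' thE] := ses_lift sm dth.
have [K [k sk]] := ses_of_epi ee.
have flFc : finite_length (tw F c).
  have [l lc] := fl_cfactors (fun _ => True) fl_c.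
  exact: cfactors_fl (tw_length F lc).
have [g gE] := lb_lift th' ((lb_twE h M).2 lM) (fl_ses sk flFc).1 sk.
have [psi psiE] := twm_full g.
by exists psi; rewrite twnN -psiE E -compmA gE.
Qed.

(** Baer's argument along a composition series of [V / U]: [V] is generated by [V'] and a line
    bundle [M] covering the new factor [T], and [h M] is the part of [M] that falls into [V']. *)
Lemma cyclic_extend U V Q (j : mor U V) (g : mor V Q) (r : mor U c) :
  finite_length V -> killed (tw_pow F n.+1) V -> ses j g ->
  exists r' : mor V c, r' \co j = r.
Proof.
move=> flV kV s; have flQ := (fl_ses s flV).2.
elim: flQ V j g flV kV s => [{}Q Q0|N {}Q T _ IH sT [i [t sit]]] V j g flV kV s.
  have [j' [j'j jj']] := ses_coker_zero s Q0.
  by exists (r \co j'); rewrite -compmA j'j compm1.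
have [V' [k [j' [g' [sk sj' jE gE]]]]] := ses_preimage s sit.
have flV' := (fl_ses sk flV).1.
have [r1 r1E] := IH _ _ _ flV' (killed_mono (ses_mono sk) kV) sj'.
have kT : killed F T.
  by apply: nilpotent_simple_killed sT _; apply: killed_epi (ses_epi sk) kV.
have [M [w [lM wN0]]] := lb_generate B (nonzero_id sT.1).
rewrite comp1m in wN0; have ew := simple_to_epi sT wN0.
have [m mE] := lb_lift w lM flV' sk.
have [mn sq] := h_prime lM.
have sw := prime_kernel sq mn sT ew kT.
have [th0 thE] : exists th0, m \co twn F M = k \co th0.
  by apply: (ses_lift sk); rewrite compmA mE (ses0 sw).
have [psi psiE] : exists psi : mor M c, psi \co twn F M = r1 \co th0.
  apply: cyclic_extend_lb lM _; rewrite -compmA.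
  suff -> : th0 \co twn (tw_pow F n) (tw F M) = 0 by rewrite compm0.
  apply: (ses_mono sk); rewrite compm0 compmA -thE -compmA.
  by apply: etrans (twnN (tw_pow F n.+1) m) _; rewrite kV comp0m.
have [P [i1 [i2 cop]]] := ab_sum V' M.
have [a [a1 a2]] := copair cop k m.
have [b [b1 b2]] := copair cop r1 psi.
have [p1 [p2 [e11 e12 e21 e22 S]]] := biproduct cop.
have ea : epi a.
  apply/epiP => W u ua; have uk : u \co k = 0 by rewrite -a1 compmA ua comp0m.
  have [u' uE] := ses_desc sk uk.
  have u'0 : u' = 0.
    by move/epiP: ew; apply; rewrite -mE compmA -uE -a2 compmA ua comp0m.
  by rewrite uE u'0 comp0m.
have [K [q sq']] := ses_of_epi ea.
have aE : a = k \co p1 + m \co p2.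
  by rewrite -(compm1 a) -S compmD !compmA a1 a2.
have bE : b = r1 \co p1 + psi \co p2.
  by rewrite -(compm1 b) -S compmD !compmA b1 b2.
(* On the kernel of [a] the component in [M] has the form [h z], and the component in [V'] is then
   [- th0 z]; there [r1] and [psi] cancel. *)
have [r' rE] : exists r', b = r' \co a.
  apply: (ses_desc sq').
  have aq := ses0 sq'; rewrite aE compDm -!compmA in aq.
  have [z zE] : exists z, p2 \co q = twn F M \co z.
    apply: (ses_lift sw); rewrite -mE -!compmA.
    have := congr1 (fun x => t \co g \co x) aq.
    by rewrite compm0 compmD !(compmA (t \co g)) (ses0 sk) !comp0m add0r -!compmA.
  have E2 : p1 \co q + th0 \co z = 0.
    by apply: (ses_mono sk); rewrite compm0 compmD [k \co (th0 \co _)]compmA -thE -!compmA -zE aq.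
  rewrite bE compDm -!compmA zE.
  rewrite [psi \co _]compmA psiE -compmA -compmD.
  by rewrite E2 compm0.
by exists r'; rewrite jE compmA -r1E -a1 !compmA -rE b1.
Qed.

End Cyclic.

End Prime.

(* An indecomposable torsion object S has a unique simple quotient: a suitable
   prime h is nilpotent on S, and a cyclic subobject of S on which h has maximal
   nilpotency order is relatively injective, so it is all of S. *)
Lemma indecomposable_top S : finite_length S -> indecomposable S ->
  exists D (d : mor S D), [/\ simple_obj D, epi d &
    forall T (t : mor S T), simple_obj T -> epi t ->
      exists2 u : mor D T, is_iso u & t = u \co d].
Proof.
move=> flS iS; have S0 := iS.1.
have [T0 [t0 [sT0 et0]]] := simple_quotient flS S0.
have [h [kT0 pr]] := lb_prime B sT0; set F := lb_tw _ in kT0 pr.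
have nil : exists n, killed (tw_pow F n) S.
  have [IS|//] := indecomposable_fitting F flS iS.
  case: sT0.1; apply/zero_objP.
  have : epi (t0 \co twn F S) by apply: epi_comp => //; apply: iso_epi.
  by rewrite twnN kT0 => /epiP; apply; rewrite !comp0m compm0.
have [n [kS kNS]] : exists n, killed (tw_pow F n.+1) S /\ ~ killed (tw_pow F n) S.
  case: nil => n; elim: n => [k0|n IH kS].
    by case: S0; apply/zero_objP.
  by have [/IH//|kN] := pselect (killed (tw_pow F n) S); exists n.
(* A line bundle detects that the n-th power is nonzero on [S]. Undoing the shift turns [w] into
   [c], an element of [S] with nonzero n-th multiple, and [I] is the subobject it generates. *)
have [L0 [w [lL0 wN0]]] := lb_generate B kNS.
have [L [e [c [Ie wE]]]] := twm_to w.
have lL : lb L by apply/(lb_powE h n); apply: lb_iso lL0; apply: iso_obj_sym; exists e.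
have cN0 : c \co twn (tw_pow F n) L <> 0.
  rewrite twnN -wE compmA => E; apply: wN0.
  by move/epiP: (iso_epi Ie); apply.
have [I [c' [i [ec' mi cE]]]] := image c.
have flI := fl_mono mi flS.
have kI := killed_mono mi kS.
have kNI : ~ killed (tw_pow F n) I.
  by move=> k0; apply: cN0; rewrite cE -compmA twnN k0 comp0m compm0.
have I0 : ~ zero_obj I by move=> I0; apply: kNI; apply: zero_to.
have [D [d cd]] := ab_coker (twn F I).
have [ed dn dU] := (cokernelP _ _).1 cd.
have [mn [Q [q [cq sQ]]]] := pr _ lL.
have [_ _ qU] := (cokernelP _ _).1 cq.
have D0 : ~ zero_obj D.
  move=> D0; apply: I0; apply: killed_iso_zero kI; apply: twn_epi_iso => //.
  exact: coker_zero_epi cd D0.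
(* [I] is a quotient of [L], so [I / h I] is a nonzero quotient of the simple object [L / h L]. *)
have sD : simple_obj D.
  have [u uE] : exists u, d \co c' = u \co q.
    by apply: qU; rewrite -compmA twnN compmA dn comp0m.
  have eu : epi u by apply: (@epi_of_comp _ _ _ _ _ q); rewrite -uE; apply: epi_comp.
  have uN0 : u <> 0.
    by move=> u0; apply: D0; apply/zero_objP; apply: eu; rewrite u0 !compm0.
  apply: (simple_iso _ sQ); exists u; apply: mono_epi_iso => //.
  exact: simple_from_mono sQ uN0.
have [Z [z sz]] := ses_of_mono mi.
have [r ri] := cyclic_extend pr flI kI kNI cd sD (idm I) flS kS sz.
have er : epi r by apply: (@epi_of_comp _ _ _ _ _ i); rewrite ri; apply/iso_epi/iso_id.
have [K [k sk]] := ses_of_epi er.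
have [//|K0] := iS.2 _ _ _ _ (split_coproduct sk ri).
have Ir := ses_ker_zero sk K0.
exists D, (d \co r); split=> //; first exact: epi_comp.
move=> T t sT et.
have kT : killed F T.
  by apply: nilpotent_simple_killed sT _; apply: killed_epi et kS.
have ir : i \co r = idm S by apply: (iso_mono Ir); rewrite compmA ri comp1m compm1.
have [u uE] : exists u, t \co i = u \co d.
  by apply: dU; rewrite -compmA twnN compmA twnN kT !comp0m.
have tE : t = u \co (d \co r) by rewrite compmA -uE -compmA ir compm1.
exists u => //; apply: simple_simple_iso => // u0; case: sT.1; apply/zero_objP.
by apply: et; rewrite tE u0 !comp0m compm0.
Qed.

(** The unique simple quotient [D] of [S] is also a quotient of [S''], so [c] maps onto [D]. A
    nonzero cokernel of [c] would have [D] as a quotient on which [c] vanishes. *)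
Lemma indecomposable_lift_epi S S'' X (p : mor S S'') (c : mor X S) :
  finite_length S -> indecomposable S -> epi p -> ~ zero_obj S'' ->
  epi (p \co c) -> epi c.
Proof.
move=> flS iS ep S''0 epc.
have [D [d [sD ed top]]] := indecomposable_top flS iS.
have [T [t [sT et]]] := simple_quotient (fl_epi ep flS) S''0.
have [u Iu uE] := top _ _ sT (epi_comp et ep).
have [A [a ca]] := ab_coker c; case/cokernelP: (ca) => ea ac _.
apply: (coker_zero_epi ca); have [//|A0] := pselect (zero_obj A).
have [T' [t' [sT' et']]] := simple_quotient (fl_epi ea flS) A0.
have [u' Iu' uE'] := top _ _ sT' (epi_comp et' ea).
have dc : d \co c = 0.
  by apply: (iso_mono Iu'); rewrite compmA -uE' -compmA ac !compm0.
case: sT.1; apply/zero_objP; apply: (epi_comp et epc).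
by rewrite comp1m comp0m compmA uE -compmA dc compm0.
Qed.

End Indecomposable.

(** * Hall numbers *)

Section HallNumbers.
Variable C : abelian.
Implicit Types X Y Z W M N A B : C.

Lemma same_subobj_eq M X (i : mor X M) Y (j : mor Y M) (u : mor X Y) :
  is_iso u -> i = j \co u ->
  same_subobj (existT (fun X => mor X M) X i) = same_subobj (existT (fun X => mor X M) Y j).
Proof.
move=> [v [vu uv]] ->; apply: funext => -[Z k]; apply: propext; split.
  move=> [w [/= Iw E]]; exists (w \co v); split=> /=.
    by apply: iso_comp => //; exists u.
  by rewrite compmA -E -compmA uv compm1.
move=> [w [/= Iw E]]; exists (w \co u); split=> /=.
  by apply: iso_comp => //; exists v.
by rewrite E compmA.
Qed.

Lemma hall_setP A B M K : hall_set A B M K <->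
  exists (f : mor B M) (g : mor M A), ses f g /\ K = same_subobj (existT (fun X => mor X M) B f).
Proof.
split=> [[X [i [mi [u Iu] [Q [q [cq [v Iv]]]] ->]]]|[f [g [s ->]]]].
  case: (Iu) => u' [u'u uu'].
  exists (i \co u'), (v \co q); split.
    apply: ses_isol; first by exists u.
    by apply: ses_isor => //; split=> //; apply: mono_kernel.
  by apply: same_subobj_eq Iu _; rewrite -compmA u'u compm1.
exists B, f; split=> //; [exact: ses_mono s|exact: iso_obj_refl|].
by exists A, g; split; [case: s|apply: iso_obj_refl].
Qed.

(** The automorphisms of [B] act freely on these monomorphisms, and the orbits are the
    subobjects. *)
Lemma card_sub_maps A B M : finite_card (fun _ : mor B M => True) -> finite_card (aut B) ->
  finite_card (hall_set A B M) /\
  has_card (fun f : mor B M => exists g : mor M A, ses f g)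
    (hall_number A B M * card_aut B).
Proof.
move=> finBM finB; pose sub (f : mor B M) := same_subobj (existT (fun X => mor X M) B f).
have finH : finite_card (hall_set A B M).
  apply: (finite_card_image (R := fun f K => K = sub f) _ _ finBM).
    by move=> x b b' _ -> ->.
  by move=> K /hall_setP[f [g [_ ->]]]; exists f.
split=> //.
apply: (has_card_fibre (f := sub) _ (finite_cardP finH)) => [f [g s]|K].
  by apply/hall_setP; exists f, g.
move=> /hall_setP[f0 [g0 [s0 ->]]].
apply: (has_card_img (f := fun u => f0 \co u) _ _ _ (finite_cardP finB)).
- move=> u Iu; split; first by exists g0; apply: ses_isol.
  exact: same_subobj_eq Iu erefl.
- by move=> u v _ _ /(ses_mono s0).
- move=> f [_ E]; have : sub f (existT (fun X => mor X M) B f).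
    by exists (idm _); split; [apply: iso_id|rewrite compm1].
  rewrite E => -[u [/= [v [vu uv]] E']]; exists v; first by exists u.
  by rewrite E' -compmA uv compm1.
Qed.

(** Dually, the automorphisms of [A] act freely on the epimorphisms with kernel [B], with the same
    orbits. *)
Lemma card_quot_maps A B M n : has_card (fun g : mor M A => exists f : mor B M, ses f g) n ->
  finite_card (aut A) ->
  finite_card (hall_set A B M) /\ n = (hall_number A B M * card_aut A)%N.
Proof.
move=> cE finA.
(* The class of the kernel of [g], written without choosing a kernel map. *)
pose sub (g : mor M A) : {X : C & mor X M} -> Prop := fun U =>
  exists2 f : mor B M, ses f g & same_subobj (existT (fun X => mor X M) B f) U.
have subE (f : mor B M) (g : mor M A) : ses f g ->
    sub g = same_subobj (existT (fun X => mor X M) B f).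
  move=> s; apply: funext => U; apply: propext; split=> [[f' s' H]|H]; last by exists f.
  have [u [_ [Iu uE _ _]]] := ses_kernel_iso s' s (ses0 s') (ses0 s).
  by rewrite -(same_subobj_eq Iu uE).
have finH : finite_card (hall_set A B M).
  apply: (finite_card_image (R := fun g K => K = sub g) _ _ (ex_intro _ n cE)).
    by move=> x b b' _ -> ->.
  by move=> K /hall_setP[f [g [s ->]]]; exists g; [exists f|rewrite (subE f)].
split=> //; apply: has_card_inj cE _.
apply: (has_card_fibre (f := sub) _ (finite_cardP finH)) => [g [f s]|K].
  by apply/hall_setP; exists f, g; split=> //; apply: subE.
move=> /hall_setP[f0 [g0 [s0 ->]]].
apply: (has_card_img (f := fun u => u \co g0) _ _ _ (finite_cardP finA)).
- move=> u Iu; have s1 : ses f0 (u \co g0) by apply: ses_isor.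
  by split; [exists f0|apply: subE].
- by move=> u v _ _ /(ses_epi s0).
- move=> g [_ E]; have : sub g (existT (fun X => mor X M) B f0).
    by rewrite E; exists (idm _); split; [apply: iso_id|rewrite compm1].
  move=> [f s [u [/= Iu uE]]].
  have [u' [v [_ _ Iv vE]]] : exists (u' : mor B B) (v : mor A A),
      [/\ is_iso u', f0 = f \co u', is_iso v & g = v \co g0].
    apply: ses_kernel_iso => //; last by rewrite uE compmA (ses0 s0) comp0m.
    by apply: (iso_epi Iu); rewrite comp0m -compmA -uE (ses0 s).
  by exists v.
Qed.

End HallNumbers.

(** * Exact sequences whose middle term is a direct sum *)

Section Counting.
Variables (C : abelian) (B : line_bundles C).
Variables (L L' S S' P : C) (i1 : mor L' P) (i2 : mor S' P).
Hypotheses (lL : lb B L) (lL' : lb B L') (flS : finite_length S) (flS' : finite_length S').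
Hypothesis cop : coproduct i1 i2.

Lemma ses_sum_split (f : mor L P) (g : mor P S) : ses f g ->
  mono (g \co i2) /\ forall Q (q : mor S Q), ses (g \co i2) q ->
    exists a : mor L L', ses a (q \co (g \co i1)).
Proof.
move=> s; have [p1 [p2 [e11 e12 e21 e22 E]]] := biproduct cop.
have mi2 : mono i2 by apply: (@mono_of_comp _ _ _ _ p2); rewrite e22; apply/iso_mono/iso_id.
have md : mono (g \co i2).
  have [K [k /kernelP[mk dk kU]]] := ab_ker (g \co i2).
  have [y yE] : exists y, i2 \co k = f \co y by apply: (ses_lift s); rewrite compmA.
  have K0 : zero_obj K.
    apply: (lb_no_fl lL (fl_mono mk flS') (f := y)).
    by apply: (@mono_of_comp _ _ _ _ f); rewrite -yE; apply: mono_comp.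
  by apply/monoP => W w /kU[w' ->]; rewrite (zero_to w' K0) compm0.
split=> // Q q sq; exists (p1 \co f); apply/sesP; split.
- apply/monoP => W w; rewrite -compmA => E0; move/monoP: (ses_mono s); apply.
  have fwE : f \co w = i2 \co (p2 \co (f \co w)).
    by rewrite -[LHS]comp1m -E compDm -!compmA E0 compm0 add0r.
  rewrite fwE; suff -> : p2 \co (f \co w) = 0 by rewrite compm0.
  by apply: md; rewrite -compmA -fwE compmA (ses0 s) comp0m compm0.
- apply/epiP => W u u0; move/epiP: (ses_epi sq); apply; move/epiP: (ses_epi s); apply.
  apply: (copair_eq cop); rewrite comp0m -!compmA //.
  by rewrite (ses0 sq) compm0.
- have -> : q \co (g \co i1) \co (p1 \co f) = q \co (g \co ((i1 \co p1) \co f)).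
    by rewrite !compmA.
  have -> : i1 \co p1 = idm P - i2 \co p2 by rewrite -E addrK.
  rewrite compBm comp1m compmB (ses0 s) sub0r compmN -!compmA.
  by rewrite (compmA g) (compmA q) (ses0 sq) comp0m oppr0.
(* An element of [L'] whose image lies in [S'] can be corrected by an element of [S'] so as to lie
   in the kernel of [g]. *)
- move=> W w; rewrite -compmA => /(ses_lift sq)[z zE].
  have [y yE] : exists y, i1 \co w - i2 \co z = f \co y.
    by apply: (ses_lift s); rewrite compmB !compmA zE subrr.
  exists y; rewrite -compmA -yE compmB !compmA e11 e12 comp0m subr0 comp1m //.
Qed.

Lemma ses_sum_glue S'' (d : mor S' S) (q : mor S S'') (a : mor L L') (g : mor P S) :
  ses d q -> g \co i2 = d -> ses a (q \co (g \co i1)) -> exists f : mor L P, ses f g.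
Proof.
move=> sd gd sa; have [p1 [p2 [e11 e12 e21 e22 E]]] := biproduct cop.
set c := g \co i1 in sa.
(* Since [q] annihilates [c a], this map falls into [S']; the component [- b] of the kernel map
   cancels it. *)
have [b bE] : exists b, c \co a = d \co b.
  by apply: (ses_lift sd); rewrite compmA (ses0 sa).
exists (i1 \co a - i2 \co b); apply/sesP; split.
- apply: (@mono_of_comp _ _ _ _ p1); rewrite compmB !compmA e11 e12 comp0m subr0 comp1m.
  exact: ses_mono sa.
- apply/epiP => W u ug.
  have ud : u \co d = 0 by rewrite -gd compmA ug comp0m.
  have [u' uE] := ses_desc sd ud; rewrite uE.
  suff -> : u' = 0 by rewrite comp0m.
  by move/epiP: (ses_epi sa); apply; rewrite compmA -uE compmA ug comp0m.
- by rewrite compmB !compmA -/c gd bE subrr.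
- move=> W w gw.
  have gwE : c \co (p1 \co w) + d \co (p2 \co w) = 0.
    by rewrite -gd /c -!compmA -compmD !compmA -compDm E comp1m.
  have [y yE] : exists y, p1 \co w = a \co y.
    apply: (ses_lift sa); have := congr1 (fun x => q \co x) gwE.
    by rewrite compm0 compmD (compmA q d) (ses0 sd) comp0m addr0 compmA.
  exists y; have wE : p2 \co w = - (b \co y).
    apply: (ses_mono sd); apply/eqP; rewrite compmN -subr_eq0 opprK addrC.
    by rewrite compmA -bE -compmA -yE gwE.
  by rewrite -[LHS]comp1m -E compDm -!compmA yE wE compmN compBm -!compmA.
Qed.

Lemma ses_sumE : short_exact L P S <->
  exists S'', short_exact S' S S'' /\ short_exact L L' S''.
Proof.
split=> [[f [g s]]|[S'' [[d [q sd]] [a [p sa]]]]].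
  have [md H] := ses_sum_split s.
  have [Q [q sq]] := ses_of_mono md; exists Q; split; first exact: ses_short sq.
  by have [a sa] := H _ _ sq; apply: ses_short sa.
have [c cE] := lb_lift p lL' flS' sd.
have [g [g1 g2]] := copair cop c d.
have [f s] : exists f : mor L P, ses f g.
  by apply: (ses_sum_glue (a := a) sd g2); rewrite g1 cE.
exact: ses_short s.
Qed.

Section Formula.
Variables (S'' : C) (d0 : mor S' S) (q0 : mor S S'') (a0 : mor L L') (p0 : mor L' S'').
Hypotheses (sd0 : ses d0 q0) (sa0 : ses a0 p0).

Let flS'' : finite_length S''.
Proof. exact: (fl_ses sd0 flS).2. Qed.

Lemma fin_aut (M : C) : finite_length M -> finite_card (aut M).
Proof. by move=> flM; apply: finite_card_sub (fl_fl_finite B flM flM). Qed.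

(** The automorphisms of [S''] act simply transitively on these maps; transitivity is
    [lb_quotient_unique]. *)
Lemma card_lb_epis : has_card (fun p : mor L' S'' => exists a : mor L L', ses a p) (card_aut S'').
Proof.
apply: (has_card_img (f := fun u => u \co p0) _ _ _ (finite_cardP (fin_aut flS''))).
- by move=> u Iu; exists a0; apply: ses_isor.
- by move=> u v _ _ /(ses_epi sa0).
- move=> p [a sa]; have [u Iu uE] := lb_quotient_unique lL' (ses_epi sa0) (ses_epi sa)
    flS'' flS'' (same_factors_refl (M := S'')).
  by exists u.
Qed.

(** The lifts of a single map form a coset of Hom(L', S'), nonempty by [lb_lift]. *)
Lemma card_lifts (d : mor S' S) (q : mor S S'') (A : mor L' S'' -> Prop) n :
  ses d q -> has_card A n ->
  has_card (fun c : mor L' S => A (q \co c)) (n * card_hom L' S').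
Proof.
move=> sd cA; apply: (has_card_fibre (f := fun c => q \co c) _ cA) => // p Ap.
have [c0 cE] := lb_lift p lL' flS' sd.
apply: (has_card_img (f := fun v : mor L' S' => c0 + d \co v) _ _ _
  (finite_cardP (lb_fl_finite lL' flS'))).
- by move=> v _; rewrite compmD cE compmA (ses0 sd) comp0m addr0.
- by move=> v v' _ _ /addrI/(ses_mono sd).
- move=> c [_ E]; have [v vE] : exists v, c - c0 = d \co v.
    by apply: (ses_lift sd); rewrite compmB E cE subrr.
  by exists v => //; rewrite -vE addrC subrK.
Qed.

Lemma sub_maps_finite : finite_card (hall_set S'' S' S) /\
  has_card (fun d : mor S' S => exists q : mor S S'', ses d q)
    (hall_number S'' S' S * card_aut S').
Proof. by apply: card_sub_maps; [apply: (fl_fl_finite B)|apply: fin_aut]. Qed.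

(** The number [n] of monomorphisms is kept as a parameter: in general it comes from a Hall number,
    but for indecomposable [S] it is found directly. *)
Lemma card_sum_quot_maps n :
  has_card (fun d : mor S' S => exists q : mor S S'', ses d q) n ->
  has_card (fun g : mor P S => exists f : mor L P, ses f g)
    (n * (card_aut S'' * card_hom L' S')).
Proof.
move=> cD; apply: (has_card_fibre (f := fun g => g \co i2) _ cD) => [g [f s]|d [q sd]].
  have [md H] := ses_sum_split s.
  have [Q [q sq]] := ses_of_mono md; have [a sa] := H _ _ sq.
  (* The cokernel [Q] is a priori another quotient of [S] by [S']. It has the factors of [S''], and
     both are quotients of [L'], so they are isomorphic. *)
  have sQ : same_factors S'' Q.
    apply: same_factors_coker flS flS (ses_short sd0) (ses_short sq) _ _;
    exact: same_factors_refl.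
  have [u [v [vu uv]] _] := lb_quotient_unique lL' (ses_epi sa0) (ses_epi sa) flS''
    (fl_ses sq flS).2 sQ.
  by exists (v \co q); apply: ses_isor => //; exists u.
apply: (has_card_bij (f := fun g => g \co i1) _ _ _ (card_lifts sd card_lb_epis)).
- move=> g [[f s] gd]; have [md H] := ses_sum_split s.
  by apply: H; rewrite gd.
- by move=> g g' [_ E1] [_ E2] E3; apply: (copair_eq cop) => //; rewrite E1 E2.
- move=> c [a sa]; have [g [g1 g2]] := copair cop c d.
  exists g => //; split=> //; apply: (ses_sum_glue (a := a) sd g2).
  by rewrite g1.
Qed.

Lemma hall_sum : finite_card (hall_set S L P) /\
  (hall_number S L P * card_aut S)%N =
  (hall_number S'' S' S * card_aut S' * (card_aut S'' * card_hom L' S'))%N.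
Proof.
have [fin <-] := card_quot_maps (card_sum_quot_maps sub_maps_finite.2) (fin_aut flS).
by [].
Qed.

End Formula.

Lemma card_aut_gt0 (M : C) : finite_card (aut M) -> (0 < card_aut M)%N.
Proof.
move=> /finite_cardP; rewrite /card_aut; case: (ncard _) => // /has_card0/(_ (idm M)).
by case; apply: iso_id.
Qed.

Lemma hall_sum_rat S'' : short_exact S' S S'' -> short_exact L L' S'' ->
  [/\ finite_card (hall_set S L P),
      finite_card (fun _ : mor L' S' => True),
      finite_card (hall_set S'' S' S),
      [/\ finite_card (aut S), finite_card (aut S') & finite_card (aut S'')]
    & ((hall_number S L P)%:R
       = (card_hom L' S')%:R * (hall_number S'' S' S)%:R
         * ((card_aut S')%:R * (card_aut S'')%:R / (card_aut S)%:R) :> rat)].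
Proof.
move=> [d [q sd]] [a [p sa]].
have [finE E] := hall_sum sd sa; have finS := fin_aut flS.
have flS'' := (fl_ses sd flS).2.
split=> //; [exact: lb_fl_finite lL' flS'|exact: (sub_maps_finite S'').1| |].
  by split=> //; apply: fin_aut.
have aS : (card_aut S)%:R != 0 :> rat by rewrite Num.Theory.pnatr_eq0 -lt0n card_aut_gt0.
apply: (mulIf aS); rewrite -[LHS]natrM E !mulrA mulfVK // -!natrM; congr (_%:R).
by rewrite mulnA mulnC !mulnA.
Qed.

Hypothesis iS : indecomposable S.

Lemma hall_sum_indec_iso : short_exact L P S -> iso_obj S S' ->
  hall_number S L P = card_hom L S.
Proof.
move=> /ses_sumE[S'' [[d [q sd]] [a [p sa]]]] SS'.
have [n lS] := fl_cfactors (fun _ => True) flS.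
have lS' := cfactors_iso SS' lS.
have flS'' := (fl_ses sd flS).2.
have [m lS''] := fl_cfactors (fun _ => True) flS''.
(* Lengths force [S''] to vanish. Then [L] is isomorphic to [L'], and the monomorphisms [S' -> S]
   are as many as the automorphisms of [S]. *)
have S''0 : zero_obj S''.
  apply: has_length0; suff <- : m = 0%N by [].
  have /eqP := has_length_inj (cfactors_ext lS' lS'' sd) lS.
  by rewrite -{2}(addn0 n) eqn_add2l => /eqP.
have Ia := ses_coker_zero sa S''0.
case: SS' => e Ie; have [e' [e'e ee']] := Ie.
have cD : has_card (fun d : mor S' S => exists q : mor S S'', ses d q) (card_aut S).
  apply: (has_card_img (f := fun u => u \co e') _ _ _ (finite_cardP (fin_aut flS))).
  - move=> u Iu; exists (0 : mor S S''); rewrite -(comp1m (u \co e')).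
    apply: ses_isol (ses_id_zero _ S''0); apply: iso_comp => //; by exists e.
  - by move=> u v _ _ E; rewrite -(compm1 u) -e'e compmA E -compmA e'e compm1.
  - move=> d' [q' s']; exists (d' \co e); last by rewrite -compmA ee' compm1.
    by apply: iso_comp => //; apply: ses_coker_zero s' S''0.
have aS'' : card_aut S'' = 1%N.
  apply: ncardE; apply: (has_card1 (a := idm S'')); first exact: iso_id.
  by move=> u _; apply: etrans (zero_to u S''0) (esym (zero_to _ S''0)).
have [_] := card_quot_maps (card_sum_quot_maps sd sa cD) (fin_aut flS).
rewrite aS'' mul1n mulnC => /eqP; rewrite eqn_pmul2r ?card_aut_gt0 //; last exact: fin_aut.
move=> /eqP <-; have finL := finite_cardP (lb_fl_finite lL' flS').
apply/esym/ncardE; have [a' [a'a aa']] := Ia.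
apply: (has_card_img (f := fun v : mor L' S' => e' \co v \co a) _ _ _ finL) => //.
- move=> u v _ _ E; apply: (iso_mono (f := e')); first by exists e.
  by apply: (iso_epi Ia).
- move=> v _; exists (e \co v \co a') => //.
  by rewrite !compmA e'e comp1m -compmA a'a compm1.
Qed.

Lemma hall_sum_indec_niso : short_exact L P S -> ~ iso_obj S S' ->
  hall_number S L P = card_aut S'.
Proof.
move=> /ses_sumE[S'' [[d [q sd]] [a [p sa]]]] SS'.
have flS'' := (fl_ses sd flS).2.
have S''0 : ~ zero_obj S''.
  by move=> S''0; apply: SS'; apply: iso_obj_sym; exists d; apply: ses_coker_zero sd S''0.
have lift_epi q' (c : mor L' S) : epi (q' : mor S S'') -> epi (q' \co c) -> epi c.
  by move=> eq'; apply: (indecomposable_lift_epi B flS iS eq' S''0).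
have [c0 c0E] := lb_lift p lL' flS' sd.
have ec0 : epi c0.
  by apply: lift_epi (ses_epi sd) _; rewrite c0E; apply: ses_epi sa.
have cD : has_card (fun d : mor S' S => exists q : mor S S'', ses d q) (card_aut S').
  apply: (has_card_img (f := fun u => d \co u) _ _ _ (finite_cardP (fin_aut flS'))).
  - by move=> u Iu; exists q; apply: ses_isol.
  - by move=> u v _ _ /(ses_mono sd).
  - move=> d' [q' s'].
    (* Both [q c0] and [q' c0] are quotients of [L'] with target [S'']; cancelling the epimorphism
       [c0] compares [q] with [q'], hence their kernels. *)
    have [u Iu uE] := lb_quotient_unique lL' (epi_comp (ses_epi sd) ec0)
      (epi_comp (ses_epi s') ec0) flS'' flS'' (same_factors_refl (M := S'')).
    have {}uE : q' = u \co q by apply: ec0; rewrite uE compmA.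
    have [v [_ [Iv vE _ _]]] : exists (v : mor S' S') (w : mor S'' S''),
        [/\ is_iso v, d' = d \co v, is_iso w & q = w \co q'].
      apply: (ses_kernel_iso s' sd); last by rewrite uE -compmA (ses0 sd) compm0.
      by apply: (iso_mono Iu); rewrite compmA -uE (ses0 s') compm0.
    by exists v.
have aS : card_aut S = (card_aut S'' * card_hom L' S')%N.
  apply: ncardE.
  have := card_lifts sd (card_lb_epis sd sa).
  apply: (has_card_bij (f := fun u => u \co c0)).
  - move=> u Iu; have eq : epi (q \co (u \co c0)).
      by do 2?apply: epi_comp => //; [apply: ses_epi sd|apply: iso_epi].
    have [v Iv vE] := lb_quotient_unique lL' (ses_epi sa) eq flS'' flS''
      (same_factors_refl (M := S'')).
    by exists a; rewrite vE; apply: ses_isor.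
  - by move=> u v _ _ /ec0.
  - move=> c [a' sa']; have ec : epi c by apply: lift_epi (ses_epi sd) (ses_epi sa').
    have [u Iu uE] := lb_quotient_unique lL' ec0 ec flS flS (same_factors_refl (M := S)).
    by exists u.
have [_] := card_quot_maps (card_sum_quot_maps sd sa cD) (fin_aut flS).
rewrite -aS => /eqP; rewrite eqn_pmul2r ?card_aut_gt0 //; last exact: fin_aut.
by move=> /eqP <-.
Qed.

End Counting.

(** * Noetherianity *)

Section Span.
Variables (R : comNzRingType) (M : lmodType R).
Implicit Types (s : seq M) (U : M -> Prop).

(** Inductive, so that repeated generators do no harm when sequences are concatenated or mapped;
    [lspan_sumP] recovers coefficients once repetitions are removed. *)
Inductive lspan s : M -> Prop :=
| LSpan0 : lspan s 0
| LSpanD a v u : v \in s -> lspan s u -> lspan s (a *: v + u).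

Definition submodule U := U 0 /\ forall a u v, U u -> U v -> U (a *: u + v).

Lemma submoduleD U u v : submodule U -> U u -> U v -> U (u + v).
Proof. by move=> [_ UD] Uu Uv; rewrite -(scale1r u); apply: UD. Qed.

Lemma submoduleZ U a u : submodule U -> U u -> U (a *: u).
Proof. by move=> [U0 UD] Uu; rewrite -(addr0 (_ *: _)); apply: UD. Qed.

Lemma submoduleB U u v : submodule U -> U u -> U v -> U (u - v).
Proof. by move=> sU Uu Uv; rewrite addrC -scaleN1r; case: sU => _; apply. Qed.

Lemma lspan_submodule s : submodule (lspan s).
Proof.
split=> [|a u v Su Sv]; first exact: LSpan0.
elim: Su => [|b w {}u ws _ IH]; first by rewrite scaler0 add0r.
by rewrite scalerDr scalerA -addrA; apply: LSpanD.
Qed.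

Lemma mem_lspan s v : v \in s -> lspan s v.
Proof. by move=> vs; rewrite -(addr0 v) -(scale1r v); apply: LSpanD vs (LSpan0 _). Qed.

Lemma lspan_min s U : submodule U -> (forall v, v \in s -> U v) -> forall u, lspan s u -> U u.
Proof. by move=> [U0 UD] sU u; elim=> // a v {}u /sU Uv _; apply: UD. Qed.

Lemma lspan_sub s s' : {subset s <= s'} -> forall u, lspan s u -> lspan s' u.
Proof.
by move=> ss'; apply: lspan_min (lspan_submodule _) _ => v /ss'; apply: mem_lspan.
Qed.

Lemma lspan_sumP s u : uniq s -> lspan s u <-> exists c : M -> R, u = \sum_(v <- s) c v *: v.
Proof.
move=> us; split=> [|[c ->]]; last first.
  rewrite big_seq; apply: (big_ind (lspan s)); first exact: LSpan0.
    by move=> v w; apply: submoduleD (lspan_submodule s).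
  by move=> v vs; apply: submoduleZ (lspan_submodule s) _; apply: mem_lspan.
elim=> [|a v {}u vs _ [c ->]].
  by exists (fun=> 0); rewrite big1 // => v _; rewrite scale0r.
exists (fun w => c w + (if w == v then a else 0)).
under [RHS]eq_bigr do rewrite scalerDl; rewrite big_split addrC; congr (_ + _).
rewrite (bigD1_seq v) //= eqxx big1 ?addr0 // => w /negPf ->.
by rewrite scale0r.
Qed.

Definition fin_gen U := exists2 s : seq M, (forall v, v \in s -> U v) &
  forall u, U u -> lspan s u.

End Span.

Definition noetherian (R : comNzRingType) :=
  forall I : R^o -> Prop, submodule I -> fin_gen I.

Lemma field_noetherian (k : fieldType) : noetherian k.
Proof.
move=> I sI; have [[x [Ix x0]]|N] := pselect (exists x : k, I x /\ x <> 0).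
  exists [:: x] => [v|u _]; first by rewrite inE => /eqP ->.
  rewrite -(mulfVK (introN eqP x0) u) -[_ * x]addr0.
  by apply: LSpanD (LSpan0 _); rewrite inE.
exists [::] => // u Iu; have [->|u0] := pselect (u = 0); first exact: LSpan0.
by case: N; exists u.
Qed.

Lemma noetherian_surj (R S : comNzRingType) (f : {rmorphism R -> S}) :
  (forall y, exists x, f x = y) -> noetherian R -> noetherian S.
Proof.
move=> fs nR I sI.
have [|s sI' gs] := nR (fun x => I (f x)).
  split=> [|a u v Iu Iv]; first by rewrite rmorph0; case: sI.
  by rewrite rmorphD rmorphM; case: sI => _; apply.
exists [seq f x | x <- s] => [_ /mapP[x xs ->]|y Iy]; first exact: sI'.
have [x xE] := fs y; rewrite -xE in Iy *.
elim: (gs _ Iy) => [|a v u vs _ IH]; first by rewrite rmorph0; apply: LSpan0.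
by rewrite rmorphD rmorphM; apply: LSpanD => //; apply: map_f.
Qed.

Section HilbertBasis.
Variable R : comNzRingType.
Hypothesis nR : noetherian R.
Variable I : {poly R}^o -> Prop.
Hypothesis sI : submodule I.

Let lead n (a : R^o) := exists p : {poly R}, [/\ I p, (size p <= n.+1)%N & p`_n = a].

Let lead_submodule n : submodule (lead n).
Proof.
split=> [|a u v [p [Ip sp <-]] [q [Iq sq <-]]].
  by exists 0; rewrite size_poly0 coef0; split=> //; case: sI.
exists (a%:P * p + q); split; first by case: sI => _; apply.
  rewrite (leq_trans (size_polyD _ _)) // geq_max sq mul_polyC.
  by rewrite (leq_trans (size_scale_leq _ _)).
by rewrite coefD coefCM.
Qed.

Let leadS n m a : (n <= m)%N -> lead n a -> lead m a.
Proof.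
move=> nm [p [Ip sp <-]]; exists ('X^(m - n) * p); split.
- exact: submoduleZ.
- rewrite (leq_trans (size_polyMleq _ _)) // size_polyXn addSn /=.
  by rewrite (leq_trans (leq_add (leqnn _) sp)) // addnS subnK.
- by rewrite coefXnM ltnNge leq_subr /= subKn.
Qed.

(** What one division step at degree [n] needs: subtracting [q] from [p] lowers the size. *)
Let good n (s : seq {poly R}^o) := forall p, I p -> (size p <= n.+1)%N ->
  exists q : {poly R}, [/\ lspan s q, (size q <= n.+1)%N & q`_n = p`_n].

Let good_of_span n m (t : seq {poly R}^o) (a : R^o) : (n <= m)%N ->
  (forall p : {poly R}, p \in t -> (size p <= n.+1)%N) ->
  lspan [seq (p : {poly R})`_n : R^o | p <- t] a ->
  exists q : {poly R}, [/\ lspan t q, (size q <= m.+1)%N & q`_m = a].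
Proof.
move=> nm ts; elim=> [|b _ u /mapP[p pt ->] _ [q [tq sq <-]]].
  by exists 0; rewrite size_poly0 coef0; split=> //; apply: LSpan0.
exists ((b%:P * 'X^(m - n)) * p + q); split.
- exact: LSpanD.
- rewrite (leq_trans (size_polyD _ _)) // geq_max sq andbT -mulrA mul_polyC.
  rewrite (leq_trans (size_scale_leq _ _)) // (leq_trans (size_polyMleq _ _)) //.
  rewrite size_polyXn addSn /= (leq_trans (leq_add (leqnn _) (ts _ pt))) //.
  by rewrite addnS subnK.
- by rewrite coefD -mulrA coefCM coefXnM ltnNge leq_subr /= subKn.
Qed.

Let lift_gens n (s : seq R^o) : (forall a, a \in s -> lead n a) ->
  exists t : seq {poly R}^o, [/\ forall p, p \in t -> I p,
    forall p : {poly R}, p \in t -> (size p <= n.+1)%N &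
    [seq (p : {poly R})`_n : R^o | p <- t] = s].
Proof.
elim: s => [|a s IH] sL; first by exists [::].
have [b bs|t [tI ts tE]] := IH; first by apply: sL; rewrite inE bs orbT.
have [|p [Ip sp pE]] := sL a; first by rewrite inE eqxx.
exists (p :: t); split=> [q|q|].
- by rewrite inE => /orP[/eqP ->|/tI].
- by rewrite inE => /orP[/eqP ->|/ts].
- by rewrite /= pE tE.
Qed.

Let good_sub n s s' : {subset s <= s'} -> good n s -> good n s'.
Proof.
move=> ss' gs p Ip sp; have [q [sq szq qE]] := gs _ Ip sp.
by exists q; split=> //; apply: lspan_sub sq.
Qed.

Let good_exists n : exists s : seq {poly R}^o, (forall p, p \in s -> I p) /\ good n s.
Proof.
have [s sL gs] := nR (lead_submodule n).
have [t [tI ts tE]] := lift_gens sL; exists t; split=> // p Ip sp.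
by apply: good_of_span (leqnn n) ts _; rewrite tE; apply: gs; exists p.
Qed.

Let good_below N : exists s : seq {poly R}^o, (forall p, p \in s -> I p) /\
  forall n, (n < N)%N -> good n s.
Proof.
elim: N => [|N [s [sI' gs]]]; first by exists [::].
have [t [tI gt]] := good_exists N; exists (s ++ t); split=> [p|n].
  by rewrite mem_cat => /orP[/sI'|/tI].
rewrite ltnS leq_eqVlt => /orP[/eqP ->|/gs].
  by apply: good_sub gt => p pt; rewrite mem_cat pt orbT.
by apply: good_sub => p pt; rewrite mem_cat pt.
Qed.

Lemma hilbert_basis_ideal : fin_gen I.
Proof.
pose J (a : R^o) := exists n, lead n a.
have sJ : submodule J.
  split=> [|a u v [n Lu] [m Lv]]; first by exists 0%N; case: (lead_submodule 0).
  exists (n + m)%N; case: (lead_submodule (n + m)) => _; apply.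
    by apply: leadS Lu; apply: leq_addr.
  by apply: leadS Lv; apply: leq_addl.
have [s sJ' gs] := nR sJ.
(* The leading ideals increase with the degree, so from [N] on they all equal [J]; the finitely many
   smaller degrees get their own generators [u]. *)
have [N sN] : exists N, forall a, a \in s -> lead N a.
  elim: s sJ' {gs} => [|a s IH] sJ'; first by exists 0%N.
  have [b bs|N sN] := IH; first by apply: sJ'; rewrite inE bs orbT.
  have [|n an] := sJ' a; first by rewrite inE eqxx.
  exists (n + N)%N => b; rewrite inE => /orP[/eqP ->|/sN].
    by apply: leadS an; apply: leq_addr.
  by apply: leadS; apply: leq_addl.
have [t [tI ts tE]] := lift_gens sN.
have [u [uI gu]] := good_below N.
exists (u ++ t) => [p|]; first by rewrite mem_cat => /orP[/uI|/tI].
have gall n : good n (u ++ t).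
  have [nN|Nn] := ltnP n N.
    by apply: good_sub (gu _ nN) => p pt; rewrite mem_cat pt.
  apply: (@good_sub n t) => [p pt|p Ip sp].
    by rewrite mem_cat pt orbT.
  by apply: good_of_span Nn ts _; rewrite tE; apply: gs; exists n, p.
move=> p Ip; move: {2}(size p) (leqnn (size p)) => n.
elim: n p Ip => [|n IH] p Ip sp.
  by move: sp; rewrite leqn0 size_poly_eq0 => /eqP ->; apply: LSpan0.
have [q [tq sq qE]] := gall n p Ip sp.
have Iq : I q.
  by apply: lspan_min tq => // v; rewrite mem_cat => /orP[/uI|/tI].
rewrite -(subrK q p); apply: submoduleD (lspan_submodule _) _ tq.
apply: IH; first exact: (submoduleB sI Ip Iq).
apply/leq_sizeP => j; rewrite leq_eqVlt => /orP[/eqP <-|nj].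
  by rewrite coefB qE subrr.
by rewrite coefB !nth_default ?subrr ?(leq_trans sq) ?(leq_trans sp).
Qed.

End HilbertBasis.

Lemma hilbert_basis (R : comNzRingType) : noetherian R -> noetherian {poly R}.
Proof. by move=> nR I sI; apply: hilbert_basis_ideal. Qed.

Section NoetherianModule.
Variables (R : comNzRingType) (M : lmodType R).
Hypothesis nR : noetherian R.

(** Induction on the generators: the coefficients of [v] occurring in [U] form an ideal [J], and the
    members of [U] that avoid [v] are covered by the induction hypothesis. *)
Lemma noetherian_submodule (s : seq M) (U : M -> Prop) :
  submodule U -> (forall u, U u -> lspan s u) -> fin_gen U.
Proof.
elim: s U => [|v s IH] U sU Us.
  exists [::] => // u /Us Su; apply: lspan_min Su => //; exact: lspan_submodule.
pose J (a : R^o) := exists2 u, U u & lspan s (u - a *: v).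
have sJ : submodule J.
  split=> [|a b c [u Uu Su] [w Uw Sw]].
    by exists 0; [case: sU|rewrite scale0r subrr; apply: LSpan0].
  exists (a *: u + w); first by case: sU => _; apply.
  rewrite scalerDl opprD addrACA -scalerA -scalerBr.
  by case: (lspan_submodule s) => _; apply.
have [t tJ gt] := nR sJ.
have [w [wU wt]] : exists w : seq M, (forall u, u \in w -> U u) /\
    forall a : R^o, a \in t -> exists2 u, u \in w & lspan s (u - a *: v).
  elim: t tJ {gt} => [|a t IHt] tJ; first by exists [::].
  have [b bt|w [wU wt]] := IHt; first by apply: tJ; rewrite inE bt orbT.
  have [|u Uu Su] := tJ a; first by rewrite inE eqxx.
  exists (u :: w); split=> [x|b]; first by rewrite inE => /orP[/eqP ->|/wU].
  rewrite inE => /orP[/eqP ->|/wt[x xw Sx]]; first by exists u; rewrite ?inE ?eqxx.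
  by exists x => //; rewrite inE xw orbT.
have [|u []//|z zU gz] := IH (fun u => U u /\ lspan s u).
  split=> [|a x y [Ux Sx] [Uy Sy]]; first by split; [case: sU|apply: LSpan0].
  by split; [case: sU => _; apply|case: (lspan_submodule s) => _; apply].
exists (w ++ z) => [x|x Ux]; first by rewrite mem_cat => /orP[/wU|/zU[]].
have key a : lspan t a -> exists2 y, lspan w y & lspan s (y - a *: v).
  elim=> [|b c d ct _ [y wy Sy]].
    by exists 0; [apply: LSpan0|rewrite scale0r subrr; apply: LSpan0].
  have [u uw Su] := wt _ ct; exists (b *: u + y); first exact: LSpanD.
  rewrite scalerDl opprD addrACA -[b *: c]/(b * c) -scalerA -scalerBr.
  by case: (lspan_submodule s) => _; apply.
have [a [y0 [xE Sy]]] : exists a y, x = a *: v + y /\ lspan s y.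
  elim: (Us _ Ux) => [|b c d + _ [a [y [-> Sy]]]].
    by exists 0, 0; rewrite scale0r addr0; split=> //; apply: LSpan0.
  rewrite inE => /orP[/eqP ->|cs].
    by exists (b + a), y; rewrite scalerDl addrA.
  by exists a, (b *: c + y); rewrite addrCA; split=> //; apply: LSpanD.
have Ja : J a by exists x => //; rewrite xE addrC addKr.
have [y wy Sy'] := key _ (gt _ Ja).
have Uy : U y by apply: lspan_min wy.
rewrite -(subrK y x) addrC; apply: submoduleD (lspan_submodule _) _ _.
  by apply: lspan_sub wy => i iw; rewrite mem_cat iw.
apply: (lspan_sub (s := z)) => [i iz|]; first by rewrite mem_cat iz orbT.
apply: gz; split; first exact: submoduleB.
have -> : x - y = y0 - (y - a *: v) by rewrite xE opprB addrA (addrC y0).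
exact: submoduleB (lspan_submodule _) _ _.
Qed.

End NoetherianModule.

(** [R] is the iterated polynomial ring in [n] variables, so that Hilbert's theorem is applied one
    variable at a time. *)
Lemma finite_type_noetherian (k : fieldType) (A : comNzRingType) (g : {rmorphism k -> A})
    n (f : 'I_n -> A) :
  exists (R : comNzRingType) (phi : {rmorphism R -> A}),
    [/\ noetherian R, forall c, exists x, phi x = g c & forall i, exists x, phi x = f i].
Proof.
elim: n f => [|n IH] f.
  by exists k, g; split=> [|c|[]//]; [apply: field_noetherian|exists c].
have [R [phi [nR phig phif]]] := IH (fun i => f (lift ord0 i)).
have cf : commr_rmorph phi (f ord0) by move=> x; apply: mulrC.
exists {poly R}, (horner_morph cf); split=> [|c|i]; first exact: hilbert_basis.
  by have [x xE] := phig c; exists x%:P; rewrite /= horner_morphC.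
case: (unliftP ord0 i) => [j ->|->].
  by have [x xE] := phif j; exists x%:P; rewrite /= horner_morphC.
by exists 'X; rewrite /= horner_morphX.
Qed.

Lemma Apr1 (k : fieldType) (X : wpl k) : Apr 1 = 1 :> AA X.
Proof. by rewrite /Apr rmorph1. Qed.

Section ANoetherian.
Variables (k : fieldType) (X : wpl k).
Local Notation t := (wl_n X).+2.
Local Notation A := (AA X).

Definition Xvar (i : 'I_t) : A := Apr ('X_i : {mpoly k[t]}).
Definition Aconst (c : k) : A := Apr (c%:MP : {mpoly k[t]}).

Fact Aconst_zmod_morphism : zmod_morphism Aconst.
Proof. by move=> a b; rewrite /Aconst mpolyCB /Apr raddfB. Qed.

Fact Aconst_monoid_morphism : monoid_morphism Aconst.
Proof.
split; first by rewrite /Aconst /Apr rmorph1.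
by move=> a b; rewrite /Aconst rmorphM /= AprM.
Qed.

HB.instance Definition _ := GRing.isZmodMorphism.Build k A Aconst Aconst_zmod_morphism.
HB.instance Definition _ := GRing.isMonoidMorphism.Build k A Aconst Aconst_monoid_morphism.

Lemma AprXn (f : {mpoly k[t]}) n : Apr (f ^+ n) = (Apr f : A) ^+ n.
Proof. by elim: n => [|n IH]; rewrite ?expr0 ?exprS ?AprM ?IH // Apr1. Qed.

Lemma Apr_sum (I : Type) (r : seq I) (P : pred I) (F : I -> {mpoly k[t]}) :
  Apr (\sum_(i <- r | P i) F i) = \sum_(i <- r | P i) (Apr (F i) : A).
Proof. exact: (big_morph _ (@AprD k X) (@Apr0 k X)). Qed.

Lemma AprZ c (f : {mpoly k[t]}) : Apr (c *: f) = Aconst c * Apr f.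
Proof. by rewrite -AprM mul_mpolyC. Qed.

Lemma AprX (m : 'X_{1..t}) : Apr ('X_[m] : {mpoly k[t]}) = \prod_i Xvar i ^+ m i.
Proof.
rewrite mpolyXE_id (big_morph _ (@AprM k X) (@Apr1 k X)).
by apply: eq_bigr => i _; rewrite AprXn.
Qed.

Lemma A_noetherian : noetherian A.
Proof.
have [R [phi [nR phic phiX]]] := finite_type_noetherian Aconst Xvar.
apply: (noetherian_surj (f := phi)) nR => a.
have [f ->] := Apr_surj a; rewrite (mpolyE f) Apr_sum.
elim: (msupp f) => [|m s [y yE]]; first by exists 0; rewrite big_nil rmorph0.
have [c cE] := phic f@_m.
have [z zE] : exists z, phi z = \prod_i Xvar i ^+ m i.
  apply: (big_ind (fun b => exists z, phi z = b)) => [|b b' [z <-] [z' <-]|i _].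
  - by exists 1; rewrite rmorph1.
  - by exists (z * z'); rewrite rmorphM.
  - by have [z zE] := phiX i; exists (z ^+ m i); rewrite rmorphXn zE.
by exists (c * z + y); rewrite big_cons rmorphD rmorphM cE zE yE AprZ AprX.
Qed.

End ANoetherian.

(** * Graded submodules and quotient modules *)

Section GradedModules.
Variables (k : fieldType) (X : wpl k).
Local Notation A := (AA X).
Local Notation L := (LL X).
Local Notation gmod := (gmod X).

Lemma gsub_submodule (M : gmod) (U : set M) : gsub U -> submodule U.
Proof. by move=> gU; split=> [|a u v Uu Uv]; case: gU => // _ UD UZ _; apply/UD/Uv/UZ. Qed.

Lemma gmod_span (M : gmod) : exists s : seq M, forall u, lspan s u.
Proof.
have [s sE] := gmod_fg M; exists s => u; have [c ->] := sE u.
rewrite big_seq; apply: (big_ind (lspan s)); first exact: LSpan0.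
  by move=> v w; apply: submoduleD (lspan_submodule s).
by move=> v vs; apply: submoduleZ (lspan_submodule s) _; apply: mem_lspan.
Qed.

Lemma span_gmod_fg (M : lmodType A) (s : seq M) : (forall u, lspan s u) ->
  exists s : seq M, forall u, exists c : M -> A, u = \sum_(v <- s) c v *: v.
Proof.
move=> ss; exists (undup s) => u; apply/lspan_sumP; first exact: undup_uniq.
by apply: lspan_sub (ss u) => v; rewrite mem_undup.
Qed.

Lemma gsub_fin_gen (M : gmod) (U : set M) : gsub U -> fin_gen U.
Proof.
move=> gU; have [s ss] := gmod_span M.
exact: noetherian_submodule (@A_noetherian k X) _ _ (gsub_submodule gU) (fun u _ => ss u).
Qed.

Lemma hcompN (M : gmod) (x : L) (u : M) : hcomp x (- u) = - hcomp x u.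
Proof. by apply: (addIr (hcomp x u)); rewrite -hcompD !addNr hcomp0. Qed.

Lemma hcompB (M : gmod) (x : L) (u v : M) : hcomp x (u - v) = hcomp x u - hcomp x v.
Proof. by rewrite hcompD hcompN. Qed.

Lemma hcomp_sumE (M : gmod) (x : L) (I : Type) (r : seq I) (P : pred I) (F : I -> M) :
  hcomp x (\sum_(i <- r | P i) F i) = \sum_(i <- r | P i) hcomp x (F i).
Proof. exact: (big_morph _ (hcompD x) (hcomp0 M x)). Qed.

Section Sub.
Variables (M : gmod) (U : set M) (gU : gsub U).

(** The proof of [gsub U] serves as a key by which the closure properties are attached to the
    predicate. *)
Definition subpred of gsub U : {pred M} := fun u => `[< U u >].

Fact subpred_closed : submod_closed (subpred gU).
Proof.
split=> [|a u v /asboolP Uu /asboolP Uv]; apply/asboolP; first exact: gsub0.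
by have [_] := gsub_submodule gU; apply.
Qed.

HB.instance Definition _ := GRing.isSubmodClosed.Build A M (subpred gU) subpred_closed.

Record subcar := SubCar { subval :> M; _ : subval \in subpred gU }.

HB.instance Definition _ := [isSub for subval].
HB.instance Definition _ := [Choice of subcar by <:].
HB.instance Definition _ := [SubChoice_isSubLmodule of subcar by <:].

Lemma subcarP (u : subcar) : U (val u).
Proof. by apply/asboolP; apply: (valP u). Qed.

Definition mksub u (Uu : U u) : subcar := SubCar (asboolT Uu : u \in subpred gU).

Let hc (x : L) (u : subcar) : subcar :=
  mksub (let: And4 _ _ _ h := gU in h x _ (subcarP u)).

Fact sub_hcompD x : {morph hc x : u v / u + v}.
Proof. by move=> u v; apply: val_inj; rewrite /= hcompD. Qed.

Fact sub_hcompK x y u : hc x (hc y u) = if x == y then hc y u else 0.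
Proof. by apply: val_inj; rewrite /= hcompK; case: eqP. Qed.

Fact sub_hcomp_sum u : exists s : seq L, uniq s /\ u = \sum_(x <- s) hc x u.
Proof.
have [s [us uE]] := hcomp_sum (val u); exists s; split=> //.
by apply: val_inj; rewrite raddf_sum.
Qed.

Fact sub_hcompZ x y a u : Ahomog x a -> hc y u = u -> hc (x + y) (a *: u) = a *: u.
Proof.
by move=> ha /(congr1 val) /= E; apply: val_inj; rewrite /= hcompZ.
Qed.

Fact sub_fg : exists s : seq subcar, forall u, exists c : subcar -> A,
  u = \sum_(v <- s) c v *: v.
Proof.
have [s sU sE] := gsub_fin_gen gU.
apply: (@span_gmod_fg _ (pmap insub s)) => u.
have memS v (Uv : U v) : v \in s -> mksub Uv \in pmap insub s.
  move=> vs; rewrite mem_pmap; apply/mapP; exists v => //.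
  by rewrite insubT; [apply/asboolP|move=> ?; congr Some; apply: val_inj].
move: (sE _ (subcarP u)); move E: (val u) => w Sw.
elim: Sw u E => [|a v {}w vs Sw IH] u E.
  by rewrite (_ : u = 0); [apply: LSpan0|apply: val_inj].
have Uv := sU _ vs.
have Uw : U w by apply: lspan_min Sw => //; apply: gsub_submodule.
rewrite (_ : u = a *: mksub Uv + mksub Uw); last by apply: val_inj.
by apply: LSpanD; [apply: memS|apply: IH].
Qed.

Definition subgmod : gmod :=
  GMod sub_hcompD sub_hcompK sub_hcomp_sum sub_hcompZ sub_fg.

End Sub.

Section Quot.
Variables (M : gmod) (U : set M) (gU : gsub U).

Fact quot_closed : zmod_closed (subpred gU).
Proof.
split=> [|u v /asboolP Uu /asboolP Uv]; apply/asboolP; first exact: gsub0.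
exact: gsubB.
Qed.

Definition quotcl : zmodClosed M :=
  HB.pack (subpred gU) (GRing.isZmodClosed.Build M (subpred gU) quot_closed).

Definition quotz : zmodType := Quotient.quot quotcl.

Definition qcl (u : M) : quotz := \pi_(Quotient.quot quotcl) u.

Lemma qclP u v : qcl u = qcl v <-> U (u - v).
Proof.
split=> [/eqP|Uuv].
  by rewrite -Quotient.idealrBE => /asboolP.
by apply/eqP; rewrite -Quotient.idealrBE; apply/asboolP.
Qed.

Lemma qclD u v : qcl (u + v) = qcl u + qcl v.
Proof. by rewrite /qcl raddfD. Qed.

Lemma qcl0 : qcl 0 = 0. Proof. by rewrite /qcl raddf0. Qed.

Lemma qcl_surj x : exists u, x = qcl u.
Proof. by exists (repr x); rewrite /qcl reprK. Qed.

Lemma qcl_repr u : U (repr (qcl u) - u).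
Proof. by apply/qclP; rewrite {1}/qcl reprK. Qed.

Definition qscale (a : A) (x : quotz) : quotz := qcl (a *: repr x).

Lemma qscaleE a u : qscale a (qcl u) = qcl (a *: u).
Proof.
apply/qclP; rewrite -scalerBr; case: gU => _ _ UZ _; apply: UZ; exact: qcl_repr.
Qed.

Fact qscaleA a b x : qscale a (qscale b x) = qscale (a * b) x.
Proof. by have [u ->] := qcl_surj x; rewrite !qscaleE scalerA. Qed.

Fact qscale1 : left_id 1 qscale.
Proof. by move=> x; have [u ->] := qcl_surj x; rewrite qscaleE scale1r. Qed.

Fact qscaleDr : right_distributive qscale +%R.
Proof.
move=> a x y; have [u ->] := qcl_surj x; have [v ->] := qcl_surj y.
by rewrite -qclD !qscaleE scalerDr qclD.
Qed.

Fact qscaleDl x : {morph qscale^~ x : a b / a + b}.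
Proof. by move=> a b; have [u ->] := qcl_surj x; rewrite !qscaleE scalerDl qclD. Qed.

HB.instance Definition _ := GRing.Zmodule.on quotz.
HB.instance Definition _ :=
  GRing.Zmodule_isLmodule.Build A quotz qscaleA qscale1 qscaleDr qscaleDl.

Lemma qclZ a u : qcl (a *: u) = a *: qcl u.
Proof. by rewrite -qscaleE. Qed.

Let hc (x : L) (u : quotz) : quotz := qcl (hcomp x (repr u)).

Lemma quot_hcE x u : hc x (qcl u) = qcl (hcomp x u).
Proof.
apply/qclP; rewrite -hcompB; case: gU => _ _ _; apply; exact: qcl_repr.
Qed.

Fact quot_hcompD x : {morph hc x : u v / u + v}.
Proof.
move=> a b; have [u ->] := qcl_surj a; have [v ->] := qcl_surj b.
by rewrite -qclD !quot_hcE hcompD qclD.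
Qed.

Fact quot_hcompK x y a : hc x (hc y a) = if x == y then hc y a else 0.
Proof.
have [u ->] := qcl_surj a; rewrite !quot_hcE hcompK.
by case: eqP => // _; apply: qcl0.
Qed.

Fact quot_hcomp_sum a : exists s : seq L, uniq s /\ a = \sum_(x <- s) hc x a.
Proof.
have [u ->] := qcl_surj a; have [s [us uE]] := hcomp_sum u; exists s; split=> //.
under eq_bigr do rewrite quot_hcE.
by rewrite -(big_morph _ qclD qcl0) -uE.
Qed.

Fact quot_hcompZ x y a u : Ahomog x a -> hc y u = u -> hc (x + y) (a *: u) = a *: u.
Proof.
have [v ->] := qcl_surj u; rewrite quot_hcE => ha <-.
by rewrite -qclZ quot_hcE (hcompZ ha) // hcompK eqxx.
Qed.

Fact quot_fg : exists s : seq quotz, forall u, exists c : quotz -> A,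
  u = \sum_(v <- s) c v *: v.
Proof.
have [s ss] := gmod_span M.
apply: (@span_gmod_fg _ (map qcl s)) => a; have [u ->] := qcl_surj a.
elim: (ss u) => [|b v w vs _ IH]; first by rewrite qcl0; apply: LSpan0.
by rewrite qclD qclZ; apply: LSpanD => //; apply: map_f.
Qed.

Definition quotgmod : gmod :=
  GMod quot_hcompD quot_hcompK quot_hcomp_sum quot_hcompZ quot_fg.

End Quot.

End GradedModules.

(** * The abelian category of graded modules modulo finite length *)

Section FracCalculus.
Variables (k : fieldType) (X : wpl k).
Local Notation gmod := (gmod X).

Lemma gflen0_sub (M : gmod) (U V : set M) :
  gsub U -> U `<=` V -> gflen [set 0] V -> gflen [set 0] U.
Proof.
move=> gU UV; apply: gflen_sub => //; first exact: gsub_set0.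
by move=> u ->; apply: gsub0.
Qed.

Lemma gflen0_trivial (M : gmod) (U : set M) :
  gsub U -> U `<=` [set 0] -> gflen [set 0] U.
Proof. by move=> gU U0; apply: gflen0_sub U0 (GFlen0 (gsub_set0 M)). Qed.

Section Sets.
Variables (M N : gmod) (f : frac M N).

(** When [f] stands for a map from [M'] to [N / N'], this is its kernel in [M'], and [frange] is the
    preimage in [N] of its image. *)
Definition fker : set M := [set u | fcorr f u 0].
Definition frange : set N := rimg (fcorr f) setT.

Lemma fcorr00 : fcorr f 0 0. Proof. by case: (fcorr_gcorr f). Qed.

Lemma fcorrB u v u' v' : fcorr f u v -> fcorr f u' v' -> fcorr f (u - u') (v - v').
Proof. exact: (gcorrB (fcorr_gcorr f)). Qed.

Lemma gsub_fker : gsub fker.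
Proof.
have [f0 fD fZ fh] := fcorr_gcorr f; split=> //.
- by move=> u v fu fv; have := fD _ _ _ _ fu fv; rewrite addr0.
- by move=> a u fu; have := fZ a _ _ fu; rewrite scaler0.
- by move=> x u fu; have := fh x _ _ fu; rewrite hcomp0.
Qed.

Lemma gsub_frange : gsub frange.
Proof. by apply: gsub_rimg; [apply: fcorr_gcorr|apply: gsubT]. Qed.

Lemma fkerE : fker = rimg (rinv (fcorr f)) [set 0].
Proof. by apply/seteqP; split=> [u fu|u [_ -> fu]] //; exists 0. Qed.

End Sets.

Lemma eqv_restrict (M N : gmod) (f g : frac M N) (U : set M) :
  gflen U setT -> U `<=` rdom (fcorr g) ->
  (forall u v, U u -> fcorr g u v -> fcorr f u v) -> frac_eqv f g.
Proof.
move=> flU Ug gf; exists U, (fcorr f 0); split=> //.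
- exact: fcorr_ind.
- by move=> u Uu; have [v guv] := Ug _ Uu; exists v; apply: gf.
- move=> u v w Uu fuv /(gf _ _ Uu) fuw.
  by have := fcorrB fuv fuw; rewrite subrr.
Qed.

Lemma eqv_sub (M N : gmod) (f g : frac M N) :
  (forall u v, fcorr g u v -> fcorr f u v) -> frac_eqv f g.
Proof. by move=> gf; apply: eqv_restrict (fcorr_dom g) _ _ => // u v _; apply: gf. Qed.

Lemma frange_comp (M N P : gmod) (g : frac N P) (f : frac M N) :
  frange (fcomp g f) = rimg (fcorr g) (frange f).
Proof.
apply/seteqP; split=> [w [u _ [v fuv gvw]]|w [v [u _ fuv] gvw]].
  by exists v => //; exists u.
by exists u => //; exists v.
Qed.

Lemma dom_comp (M N P : gmod) (g : frac N P) (f : frac M N) (V : set P) :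
  rimg (rinv (fcorr (fcomp g f))) V = rimg (rinv (fcorr f)) (rimg (rinv (fcorr g)) V).
Proof.
apply/seteqP; split=> [u [w Vw [v fuv gvw]]|u [v [w Vw gvw] fuv]].
  by exists v => //; exists w.
by exists w => //; exists v.
Qed.

Section Hom.
Variables M N : gmod.

Definition ghom (p : M -> N) := [/\ {morph p : u v / u + v},
  forall a u, p (a *: u) = a *: p u & forall x u, p (hcomp x u) = hcomp x (p u)].

Section FHom.
Variables (p : M -> N) (hp : ghom p).

Let r u v := v = p u.

Fact ghom0 : p 0 = 0.
Proof. by case: hp => _ pZ _; rewrite -(scale0r (0 : M)) pZ scale0r. Qed.

Fact fhom_gcorr : gcorr r.
Proof.
case: hp => pD pZ ph; rewrite /r; split.
- by rewrite ghom0.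
- by move=> u v u' v' -> ->; rewrite pD.
- by move=> a u v ->; rewrite pZ.
- by move=> x u v ->; rewrite ph.
Qed.

Fact fhom_dom : gflen (rdom r) setT.
Proof.
rewrite (_ : rdom _ = setT); first exact/GFlen0/gsubT.
by apply/seteqP; split=> // u _; exists (p u).
Qed.

Fact fhom_ind : gflen [set 0] (r 0).
Proof.
rewrite (_ : r 0 = [set 0]); first exact/GFlen0/gsub_set0.
by rewrite /r ghom0.
Qed.

Definition fhom : frac M N := Frac fhom_gcorr fhom_dom fhom_ind.

End FHom.

Section Add.
Variables f g : frac M N.

Let r u v := exists v1 v2, [/\ fcorr f u v1, fcorr g u v2 & v = v1 + v2].

Fact fadd_gcorr : gcorr r.
Proof.
have [f0 fD fZ fh] := fcorr_gcorr f; have [g0 gD gZ gh] := fcorr_gcorr g; split.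
- by exists 0, 0; split=> //; rewrite addr0.
- move=> u v u' v' [v1 [v2 [? ? ->]]] [w1 [w2 [? ? ->]]].
  by exists (v1 + w1), (v2 + w2); split; [apply: fD|apply: gD|rewrite addrACA].
- move=> a u v [v1 [v2 [? ? ->]]].
  by exists (a *: v1), (a *: v2); split; [apply: fZ|apply: gZ|rewrite scalerDr].
- move=> x u v [v1 [v2 [? ? ->]]].
  by exists (hcomp x v1), (hcomp x v2); split; [apply: fh|apply: gh|rewrite hcompD].
Qed.

Fact fadd_dom : gflen (rdom r) setT.
Proof.
have := gflenIT (fcorr_dom f) (fcorr_dom g).
congr (gflen _ _); apply/seteqP; split=> [u [[v fv] [w gw]]|u [_ [v [w [fv gw _]]]]].
  by exists (v + w), v, w.
by split; [exists v|exists w].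
Qed.

Fact fadd_ind : gflen [set 0] (r 0).
Proof. exact: (gflen0_gadd (fcorr_ind f) (fcorr_ind g)). Qed.

Definition fadd : frac M N := Frac fadd_gcorr fadd_dom fadd_ind.

Let ro u v := fcorr f u (- v).

Fact fopp_gcorr : gcorr ro.
Proof.
have [f0 fD fZ fh] := fcorr_gcorr f; rewrite /ro; split.
- by rewrite oppr0.
- by move=> u v u' v' fu fu'; rewrite opprD; apply: fD.
- by move=> a u v fu; rewrite -scalerN; apply: fZ.
- by move=> x u v fu; rewrite -hcompN; apply: fh.
Qed.

Fact fopp_dom : gflen (rdom ro) setT.
Proof.
have := fcorr_dom f.
by congr (gflen _ _); apply/seteqP; split=> u [v fv]; exists (- v); rewrite /ro ?opprK.
Qed.

Fact fopp_ind : gflen [set 0] (ro 0).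
Proof.
have := fcorr_ind f; congr (gflen _ _); apply/seteqP; split=> v; rewrite /ro => fv.
  by have := fcorrB (fcorr00 f) fv; rewrite subrr sub0r.
by have := fcorrB (fcorr00 f) fv; rewrite subrr sub0r opprK.
Qed.

Definition fopp : frac M N := Frac fopp_gcorr fopp_dom fopp_ind.

End Add.

Fact zero_ghom : ghom (fun _ : M => 0 : N).
Proof.
by split=> [u v|a u|x u]; rewrite ?addr0 ?scaler0 ?hcomp0.
Qed.

Definition fzero : frac M N := fhom zero_ghom.

Lemma fadd_eqv f f' g g' : frac_eqv f f' -> frac_eqv g g' -> frac_eqv (fadd f g) (fadd f' g').
Proof.
move=> [U [V [flU flV Uf Uf' E]]] [U' [V' [flU' flV' Ug Ug' E']]].
exists (U `&` U'), (gadd V V'); split.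
- exact: gflenIT.
- exact: gflen0_gadd.
- by move=> u [/Uf[v fv] /Ug[w gw]]; exists (v + w), v, w.
- by move=> u [/Uf'[v fv] /Ug'[w gw]]; exists (v + w), v, w.
- move=> u _ _ [Uu Uu'] [v1 [v2 [f1 g2 ->]]] [w1 [w2 [f1' g2' ->]]].
  exists (v1 - w1), (v2 - w2); split; [exact: E f1 f1'|exact: E' g2 g2'|].
  by rewrite opprD addrACA.
Qed.

Lemma fopp_eqv f f' : frac_eqv f f' -> frac_eqv (fopp f) (fopp f').
Proof.
move=> [U [V [flU flV Uf Uf' E]]]; exists U, V; split=> //.
- by move=> u /Uf[v fv]; exists (- v); rewrite /= opprK.
- by move=> u /Uf'[v fv]; exists (- v); rewrite /= opprK.
- move=> u v w Uu /= fv fw; have := gsubN (gflen_gsubr flV) (E _ _ _ Uu fv fw).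
  by rewrite opprB opprK addrC.
Qed.

Definition qadd (f g : qhom M N) : qhom M N := qpi (fadd (repr f) (repr g)).
Definition qopp (f : qhom M N) : qhom M N := qpi (fopp (repr f)).

Lemma qadd_pi f g : qadd (qpi f) (qpi g) = qpi (fadd f g).
Proof. by apply/qpiP; apply: fadd_eqv; apply/qpiP; rewrite /qpi reprK. Qed.

Lemma qopp_pi f : qopp (qpi f) = qpi (fopp f).
Proof. by apply/qpiP; apply: fopp_eqv; apply/qpiP; rewrite /qpi reprK. Qed.

Fact qaddA : associative qadd.
Proof.
move=> f g h; have [f' ->] := qpi_surj f; have [g' ->] := qpi_surj g.
have [h' ->] := qpi_surj h; rewrite !qadd_pi; apply/qpiP/frac_eqv_ext => u v; split.
  move=> [a [_ [fa [b [c [gb hc ->]]] ->]]].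
  by exists (a + b), c; rewrite addrA; split=> //; exists a, b.
move=> [_ [c [[a [b [fa gb ->]]] hc ->]]].
by exists a, (b + c); rewrite addrA; split=> //; exists b, c.
Qed.

Fact qaddC : commutative qadd.
Proof.
move=> f g; have [f' ->] := qpi_surj f; have [g' ->] := qpi_surj g.
rewrite !qadd_pi; apply/qpiP/frac_eqv_ext => u v.
by split=> -[a [b [fa gb ->]]]; exists b, a; rewrite addrC.
Qed.

Fact qadd0 : left_id (qpi fzero) qadd.
Proof.
move=> f; have [f' ->] := qpi_surj f; rewrite qadd_pi; apply/qpiP/frac_eqv_ext => u v.
split=> [[_ [b [-> fb ->]]]|fv]; first by rewrite add0r.
by exists 0, v; rewrite add0r.
Qed.

Fact qaddN : left_inverse (qpi fzero) qopp qadd.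
Proof.
move=> f; have [f' ->] := qpi_surj f; rewrite qopp_pi qadd_pi; apply/qpiP.
apply: eqv_restrict (fcorr_dom f') _ _ => [u _|u _ [w fw] ->]; first by exists 0.
by exists (- w), w; rewrite /= opprK addNr.
Qed.

HB.instance Definition _ := Choice.on (qhom M N).
HB.instance Definition _ := GRing.isZmodule.Build (qhom M N) qaddA qaddC qadd0 qaddN.

(** Enlarging [N'] by an image of finite length makes the map zero. *)
Lemma qpi_eq0 (f : frac M N) : qpi f = 0 :> qhom M N <-> gflen [set 0] (frange f).
Proof.
split=> [/qpiP[U [V [flU flV Uf _ E]]]|fl].
  apply: gflen_trans (rimg_gflen (fcorr_gcorr f) flU).
  apply: gflen0_sub flV; first by apply: gsub_rimg (fcorr_gcorr f) (gflen_gsubl flU).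
  by move=> v [u Uu fv]; have := E u v 0 Uu fv erefl; rewrite subr0.
apply/qpiP; exists (rdom (fcorr f)), (frange f); split=> //.
- exact: fcorr_dom.
- by move=> u _; exists 0.
- by move=> u v _ _ fv ->; rewrite subr0; exists u.
Qed.

End Hom.

Lemma qcompDl (M N P : gmod) (g h : qhom N P) (f : qhom M N) :
  qcomp (g + h) f = qcomp g f + qcomp h f.
Proof.
have [g' ->] := qpi_surj g; have [h' ->] := qpi_surj h; have [f' ->] := qpi_surj f.
rewrite [qpi g' + _]qadd_pi !qcomp_pi [RHS]qadd_pi; apply/qpiP; apply/frac_eqv_sym/eqv_sub.
move=> u w [v fv [w1 [w2 [gw hw ->]]]]; exists w1, w2; split=> //; by exists v.
Qed.

Lemma qcompDr (M N P : gmod) (h : qhom N P) (f g : qhom M N) :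
  qcomp h (f + g) = qcomp h f + qcomp h g.
Proof.
have [g' ->] := qpi_surj g; have [h' ->] := qpi_surj h; have [f' ->] := qpi_surj f.
rewrite [qpi f' + _]qadd_pi !qcomp_pi [RHS]qadd_pi; apply/qpiP; apply/eqv_sub.
move=> u w [w1 [w2 [[v1 f1 h1] [v2 g2 h2] ->]]]; exists (v1 + v2).
  by exists v1, v2.
by case: (fcorr_gcorr h') => _ hD _ _; apply: hD.
Qed.

Definition coh_pre : preadditive_category :=
  @PreadditiveCategory (coh X) (fun M N => GRing.Zmodule.class (qhom M N)).

Definition zero_gmod : gmod := subgmod (gsub_set0 (twist (X := X) 0)).

Lemma zero_gmodP (u : zero_gmod) : u = 0.
Proof. by apply: val_inj; apply: (subcarP u). Qed.

Lemma coh_zero : exists Z : coh_pre, zero_obj Z.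
Proof.
exists zero_gmod => M; split; exists 0; split=> // f _; have [f' ->] := qpi_surj f;
  apply/esym/qpi_eq0.
  by apply: gflen0_trivial (gsub_frange f') _ => u _; apply: zero_gmodP.
have := fcorr_ind f'; congr (gflen _ _); apply/seteqP; split=> [v fv|v [u _]].
  by exists 0.
by rewrite (zero_gmodP u).
Qed.

Definition coh_add : additive_category :=
  @AdditiveCategory coh_pre qcompDl qcompDr coh_zero.

(** A submodule of the domain of [f] whose image has finite length has finite length itself, being
    an extension by a part of [fker f]. *)
Lemma coh_monoP (M N : coh_add) (f : frac M N) :
  gflen [set 0] (fker f) -> mono (qpi f : @mor coh_add M N).
Proof.
move=> flK; apply/monoP => W w0; have [w ->] := qpi_surj w0.
rewrite /= qcomp_pi => /qpi_eq0; rewrite frange_comp => fl; apply/qpi_eq0.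
have gV := gsub_frange w; set V := frange w in fl gV *.
have flI := gflenI gV (fcorr_dom f); rewrite setTI in flI.
apply: gflen_trans flI.
have := rimg_gflen (gcorr_rinv (fcorr_gcorr f)) fl; rewrite -fkerE => fl'.
apply: gflen0_sub (gflen_trans flK fl').
  by apply: gsubI => //; apply: gsub_rdom (fcorr_gcorr f).
by move=> v [[z fz] Vv]; exists z => //; exists v.
Qed.

Lemma coh_epiP (M N : coh_add) (f : frac M N) :
  gflen (frange f) setT -> epi (qpi f : @mor coh_add M N).
Proof.
move=> flR; apply/epiP => W w0; have [w ->] := qpi_surj w0.
rewrite /= qcomp_pi => /qpi_eq0; rewrite frange_comp => fl; apply/qpi_eq0.
exact: gflen_trans fl (rimg_gflen (fcorr_gcorr w) flR).
Qed.

Lemma val_ghom (M : gmod) (U : set M) (gU : gsub U) : ghom (val : subgmod gU -> M).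
Proof. by []. Qed.

Lemma qcl_ghom (M : gmod) (U : set M) (gU : gsub U) : ghom (qcl gU : M -> quotgmod gU).
Proof.
split=> [u v|a u|x u]; [exact: qclD|exact: qclZ|].
by apply/esym/quot_hcE.
Qed.

Definition finc (M : gmod) (U : set M) (gU : gsub U) : frac (subgmod gU) M :=
  fhom (val_ghom gU).

Definition fprj (M : gmod) (U : set M) (gU : gsub U) : frac M (quotgmod gU) :=
  fhom (qcl_ghom gU).

Lemma finc_range (M : gmod) (U : set M) (gU : gsub U) : frange (finc gU) = U.
Proof.
apply/seteqP; split=> [_ [u _ ->]|u Uu]; first exact: subcarP.
by exists (mksub gU Uu).
Qed.

Lemma finc_mono (M : gmod) (U : set M) (gU : gsub U) :
  mono (qpi (finc gU) : @mor coh_add (subgmod gU) M).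
Proof.
apply: coh_monoP; apply: gflen0_trivial; first exact: gsub_fker.
by move=> u /= E; apply: val_inj.
Qed.

Lemma fprj_epi (M : gmod) (U : set M) (gU : gsub U) :
  epi (qpi (fprj gU) : @mor coh_add M (quotgmod gU)).
Proof.
apply: coh_epiP; rewrite (_ : frange _ = setT); first exact/GFlen0/gsubT.
by apply/seteqP; split=> // x _; have [u ->] := qcl_surj x; exists u.
Qed.

Lemma frange_zero_dom (M N : gmod) (f : frac M N) :
  gflen [set 0] (frange f) -> gflen (fker f) setT.
Proof.
move=> fl; have := rimg_gflen (gcorr_rinv (fcorr_gcorr f)) fl.
rewrite -fkerE => /gflen_trans; apply.
rewrite (_ : rimg _ _ = rdom (fcorr f)); first exact: fcorr_dom.
apply/seteqP; split=> u [v]; first by exists v.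
by exists v => //; exists u.
Qed.

Section Restr.
Variables (W M : gmod) (w : frac W M) (U : set M) (gU : gsub U).
Hypothesis flU : gflen (rimg (rinv (fcorr w)) U) setT.

Let r (x : W) (u : subgmod gU) := fcorr w x (val u).

Fact frestr_gcorr : gcorr r.
Proof.
by have [w0 wD wZ wh] := fcorr_gcorr w; split=> *; [exact: w0|exact: wD|exact: wZ|exact: wh].
Qed.

Fact frestr_dom : gflen (rdom r) setT.
Proof.
have := flU; congr (gflen _ _); apply/seteqP; split=> [x [u Uu wu]|x [u wu]].
  by exists (mksub gU Uu).
by exists (val u) => //; apply: subcarP.
Qed.

Fact frestr_ind : gflen [set 0] (r 0).
Proof.
have := rimg_gflen (gcorr_rinv (fhom_gcorr (val_ghom gU))) (gflenI gU (fcorr_ind w)).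
congr (gflen _ _); apply/seteqP.
  split=> [u [v [/= v0 _] E]|u ->] /=; first by apply: val_inj; rewrite /= -v0 E.
  by exists 0 => //; split=> //; apply: gsub0.
split=> [u [v [wv _] E]|u ru] /=; first by rewrite /r -E.
by exists (val u) => //; split=> //; apply: subcarP.
Qed.

Definition frestr : frac W (subgmod gU) := Frac frestr_gcorr frestr_dom frestr_ind.

Lemma frestrE : qcomp (qpi (finc gU)) (qpi frestr) = qpi w.
Proof.
rewrite qcomp_pi; apply/qpiP; apply/frac_eqv_sym/eqv_sub.
by move=> x v [u ru ->].
Qed.

End Restr.

Lemma coh_kernel (M N : coh_add) (f : frac M N) :
  is_kernel (qpi (finc (gsub_fker f)) : @mor coh_add _ M) (qpi f : mor M N).
Proof.
apply/kernelP; split; first exact: finc_mono.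
  rewrite /= qcomp_pi; apply/qpi_eq0; rewrite frange_comp finc_range.
  rewrite (_ : rimg _ _ = fcorr f 0); first exact: fcorr_ind.
  apply/seteqP; split=> [v [u fu fv]|v fv].
    by have := fcorrB fv fu; rewrite subrr subr0.
  by exists 0 => //; apply: fcorr00.
move=> W w0; have [w ->] := qpi_surj w0; rewrite /= qcomp_pi => /qpi_eq0/frange_zero_dom fl.
have flU : gflen (rimg (rinv (fcorr w)) (fker f)) setT.
  by move: fl; rewrite fkerE dom_comp -fkerE.
by exists (qpi (frestr (gsub_fker f) flU)); rewrite frestrE.
Qed.

Section Desc.
Variables (M N W : gmod) (g : frac M N) (w : frac M W).
Hypotheses (flR : gflen (frange g) setT) (flK : gflen [set 0] (rimg (fcorr w) (fker g))).

(** The relation [w] after the inverse of [g]: [flR] makes its domain cofinite and [flK] makes its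
    indeterminacy of finite length. *)
Let r v z := exists2 u, fcorr g u v & fcorr w u z.

Fact fdesc_gcorr : gcorr r.
Proof. exact: (gcorr_rcomp (fcorr_gcorr w) (gcorr_rinv (fcorr_gcorr g))). Qed.

Fact fdesc_dom : gflen (rdom r) setT.
Proof.
have := gflen_trans (rimg_gflen (fcorr_gcorr g) (fcorr_dom w)) flR.
congr (gflen _ _); apply/seteqP; split=> [v [u [z wz] gv]|v [z [u gv wz]]].
  by exists z, u.
by exists u => //; exists z.
Qed.

Fact fdesc_ind : gflen [set 0] (r 0).
Proof. by have := flK; congr (gflen _ _); apply/seteqP; split=> z [u]; exists u. Qed.

Definition fdesc : frac N W := Frac fdesc_gcorr fdesc_dom fdesc_ind.

Lemma fdescE : qcomp (qpi fdesc) (qpi g) = qpi w.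
Proof.
rewrite qcomp_pi; apply/qpiP.
apply: eqv_restrict (gflenIT (fcorr_dom g) (fcorr_dom w)) _ _ => [u []//|u z [[v gv] _] wz].
by exists v => //; exists u.
Qed.

End Desc.

Lemma coh_epi_cokernel (M N : coh_add) (g : frac M N) : gflen (frange g) setT ->
  is_cokernel (qpi (finc (gsub_fker g)) : @mor coh_add _ M) (qpi g : mor M N).
Proof.
move=> flR; apply/cokernelP; split; first exact: coh_epiP.
  by case/kernelP: (coh_kernel g).
move=> W w0; have [w ->] := qpi_surj w0; rewrite /= qcomp_pi => /qpi_eq0.
rewrite frange_comp finc_range => fl.
by exists (qpi (fdesc flR fl)); rewrite fdescE.
Qed.

Lemma fprj_ker (M : gmod) (U : set M) (gU : gsub U) : fker (fprj gU) = U.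
Proof.
apply/seteqP; split=> u /=; rewrite -(qcl0 gU).
  by move/esym/qclP; rewrite subr0.
by move=> Uu; apply/esym/qclP; rewrite subr0.
Qed.

Lemma fprj_range (M : gmod) (U : set M) (gU : gsub U) : frange (fprj gU) = setT.
Proof. by apply/seteqP; split=> // x _; have [u ->] := qcl_surj x; exists u. Qed.

Lemma coh_cokernel (M N : coh_add) (f : frac M N) :
  is_cokernel (qpi f : mor M N) (qpi (fprj (gsub_frange f)) : @mor coh_add N _).
Proof.
have flR : gflen (frange (fprj (gsub_frange f))) setT.
  by rewrite fprj_range; apply/GFlen0/gsubT.
apply/cokernelP; split; first exact: fprj_epi.
  rewrite /= qcomp_pi; apply/qpi_eq0; rewrite frange_comp.
  rewrite (_ : rimg _ _ = [set 0]); first exact/GFlen0/gsub_set0.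
  apply/seteqP; split=> [x [v fv ->]|_ ->] /=.
    by rewrite -(qcl0 (gsub_frange f)); apply/qclP; rewrite subr0.
  by exists 0; [apply: gsub0; apply: gsub_frange|rewrite /= qcl0].
move=> W w0; have [w ->] := qpi_surj w0; rewrite /= qcomp_pi => /qpi_eq0.
rewrite frange_comp -[X in rimg _ X](fprj_ker (gsub_frange f)) => fl.
by exists (qpi (fdesc flR fl)); rewrite fdescE.
Qed.

Lemma coh_mono_ker (M N : coh_add) (f : frac M N) :
  mono (qpi f : @mor coh_add M N) -> gflen [set 0] (fker f).
Proof.
case/kernelP: (coh_kernel f) => _ E _ /monoP/(_ _ _ E)/qpi_eq0.
by rewrite finc_range.
Qed.

Lemma coh_epi_range (M N : coh_add) (f : frac M N) :
  epi (qpi f : @mor coh_add M N) -> gflen (frange f) setT.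
Proof.
case/cokernelP: (coh_cokernel f) => _ E _ /epiP/(_ _ _ E)/qpi_eq0/frange_zero_dom.
by rewrite fprj_ker.
Qed.

Section Inv.
Variables (M N W : gmod) (f : frac M N) (w : frac W N).
Hypotheses (flK : gflen [set 0] (fker f)) (flD : gflen (rimg (rinv (fcorr w)) (frange f)) setT).

(** Here the inverse of [f] comes after [w]: [flD] controls the domain and [flK] the
    indeterminacy. *)
Let r x u := exists2 v, fcorr w x v & fcorr f u v.

Fact finvr_gcorr : gcorr r.
Proof. exact: (gcorr_rcomp (gcorr_rinv (fcorr_gcorr f)) (fcorr_gcorr w)). Qed.

Fact finvr_dom : gflen (rdom r) setT.
Proof.
have := flD; congr (gflen _ _); apply/seteqP; split=> [x [v [u _ fv] wv]|x [u [v wv fv]]].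
  by exists u, v.
by exists v => //; exists u.
Qed.

Fact finvr_ind : gflen [set 0] (r 0).
Proof.
have := gflen_trans flK (eq_ind _ (fun Z => gflen Z _)
  (rimg_gflen (gcorr_rinv (fcorr_gcorr f)) (fcorr_ind w)) _ (esym (fkerE f))).
by congr (gflen _ _); apply/seteqP; split=> u [v]; exists v.
Qed.

Definition finvr : frac W M := Frac finvr_gcorr finvr_dom finvr_ind.

Lemma finvrE : qcomp (qpi f) (qpi finvr) = qpi w.
Proof.
rewrite -(frestrE (gsub_frange f) flD) !qcomp_pi; apply/qpiP/eqv_sub => x _ [[v fr] /= wv ->].
by have [u _ fv] := subcarP (SubCar fr); exists u => //; exists v.
Qed.

End Inv.

Lemma coh_mono_kernel (M N : coh_add) (f : frac M N) : gflen [set 0] (fker f) ->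
  is_kernel (qpi f : mor M N) (qpi (fprj (gsub_frange f)) : @mor coh_add N _).
Proof.
move=> flK; apply/kernelP; split; first exact: coh_monoP.
  by case/cokernelP: (coh_cokernel f).
move=> W w0; have [w ->] := qpi_surj w0; rewrite /= qcomp_pi => /qpi_eq0/frange_zero_dom.
rewrite fkerE dom_comp -fkerE fprj_ker => fl.
by exists (qpi (finvr flK fl)); rewrite finvrE.
Qed.

(** Kept transparent, so that objects and morphisms reduce to those of [coh X]. *)
Definition coh_ab : abelian.
Proof.
apply: (@Abelian coh_add).
- by move=> M N f0; have [f ->] := qpi_surj f0; eexists; eexists; apply: coh_kernel.
- by move=> M N f0; have [f ->] := qpi_surj f0; eexists; eexists; apply: coh_cokernel.
- by move=> M N; exists (dsum M N), (qpi (finl M N)), (qpi (finr M N)); apply: dsum_coproduct.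
- move=> M N f0; have [f ->] := qpi_surj f0 => /coh_mono_ker flK.
  by eexists; eexists; apply: coh_mono_kernel.
- move=> M N f0; have [f ->] := qpi_surj f0 => /coh_epi_range flR.
  by eexists; eexists; apply: coh_epi_cokernel.
Defined.

End FracCalculus.

(** * Homogeneous components of A *)

Section Degrees.
Variables (k : fieldType) (X : wpl k).
Local Notation t := (wl_n X).+2.
Local Notation p := (@wl_weight k X).
Local Notation A := (AA X).
Local Notation L := (LL X).

(** The degree of [m] has the normal form sum of [(m i %% p i) x_i] plus [l c]; this is [l]. *)
Definition mquot (m : 'X_{1..t}) := (\sum_i (m i %/ p i))%N.

Lemma mdegL_eq (m m' : 'X_{1..t}) : mdegL m = mdegL m' :> L ->
  (forall i, m i %% p i = m' i %% p i)%N /\ mquot m = mquot m'.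
Proof.
pose v (m : 'X_{1..t}) : 'rV[int]_t := \sum_i delta_mx 0 i *+ m i.
have vE m0 : mdegL m0 = \pi_(Quotient.quot (Lsub X)) (v m0).
  by rewrite /v raddf_sum /=; apply: eq_bigr => i _; rewrite raddfMn.
have vc m0 i : v m0 0 i = (m0 i)%:Z.
  rewrite summxE (bigD1 i) //= big1 ?addr0 => [|j ji].
    by rewrite mulmxnE mxE !eqxx mulr1n natz.
  by rewrite mulmxnE mxE eqxx /= eq_sym (negPf ji) mul0rn.
have zE (w : 'rV[int]_t) (z : int) i : (w *~ z) 0 i = w 0 i *~ z.
  by case: z => n; rewrite ?NegzE ?mulrNz ?mxE -!pmulrn mulmxnE.
rewrite !vE => /eqP; rewrite -Quotient.idealrBE => /asboolP[c E].
(* An element of the relation lattice changes the [i]-th exponent by [p i] times [e i], and the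
   [e i] add up to zero. *)
pose e (i : 'I_t) : int := \sum_j c i j - \sum_j c j i.
have mE i : (m i)%:Z - (m' i)%:Z = (p i)%:Z * e i.
  have := congr1 (fun w : 'rV_t => w 0 i) E; rewrite !mxE !vc => ->.
  rewrite summxE /e mulrBr !mulr_sumr.
  under eq_bigr => a _ do rewrite summxE.
  under eq_bigr => a _ do under eq_bigr => b _ do
    rewrite zE !mxE !mulmxnE !mxE eqxx /= mulrzBl.
  under eq_bigr => a _ do rewrite sumrB.
  rewrite sumrB; congr (_ - _).
    rewrite (bigD1 i) //= [X in _ + X]big1 ?addr0 => [|a ai].
      by apply: eq_bigr => b _; rewrite eqxx mulr1n natz -mulrzr intz.
    by rewrite big1 // => b _; rewrite eq_sym (negPf ai) mul0rn mul0rz.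
  rewrite exchange_big /= (bigD1 i) //= [X in _ + X]big1 ?addr0 => [|a ai].
    by apply: eq_bigr => b _; rewrite eqxx mulr1n natz -mulrzr intz.
  by rewrite big1 // => b _; rewrite eq_sym (negPf ai) mul0rn mul0rz.
have e0 : \sum_i e i = 0.
  by rewrite sumrB [X in _ - X]exchange_big subrr.
have qE i : (m i %% p i = m' i %% p i)%N /\ (m i %/ p i)%:Z - (m' i %/ p i)%:Z = e i.
  have pi0 : (p i)%:Z != 0 by rewrite -lt0n wl_weight_gt0.
  have {}mE : (m i)%:Z = e i * (p i)%:Z + (m' i)%:Z by rewrite mulrC -mE subrK.
  split.
    apply/eqP; rewrite -eqz_nat -!modz_nat mE; apply/eqP.
    by rewrite modzMDl.
  by rewrite -!divz_nat mE divzMDl // addrK.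
split=> [i|]; first by have [] := qE i.
apply/eqP; rewrite -eqz_nat -subr_eq0 /mquot.
rewrite -!natz !natr_sum -sumrB; apply/eqP; rewrite -[RHS]e0.
by apply: eq_bigr => i _; rewrite !natz; have [_] := qE i.
Qed.

Lemma mdegL_inj_res (m m' : 'X_{1..t}) : mdegL m = mdegL m' :> L ->
  (forall i, (m i %/ p i = m' i %/ p i)%N) -> m = m'.
Proof.
move=> /mdegL_eq[mE _] qE; apply/mnmP => i.
by rewrite (divn_eq (m i) (p i)) (divn_eq (m' i) (p i)) mE qE.
Qed.

Lemma mdegL0 : mdegL 0%MM = 0 :> L.
Proof. by rewrite /mdegL big1 // => i _; rewrite mnm0E mulr0n. Qed.

Lemma mdegL_eq0 (m : 'X_{1..t}) : mdegL m = 0 :> L -> m = 0%MM.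
Proof.
rewrite -mdegL0 => E; apply: mdegL_inj_res => // i; have [_] := mdegL_eq E.
rewrite [RHS]big1 => [|j _]; last by rewrite mnm0E div0n.
by move=> /eqP; rewrite sum_nat_eq0 => /forallP/(_ i)/eqP ->; rewrite mnm0E div0n.
Qed.

Lemma mdegLU i : mdegL U_(i) = xvec i :> L.
Proof.
rewrite /mdegL (bigD1 i) //= big1 ?addr0 => [|j ji]; first by rewrite mnm1E eqxx.
by rewrite mnm1E eq_sym (negPf ji) mulr0n.
Qed.

Lemma mdegLMn (m : 'X_{1..t}) n : mdegL (m *+ n) = mdegL m *+ n :> L.
Proof.
by elim: n => [|n IH]; [rewrite mulm0n mdegL0|rewrite mulmS mdegLD IH mulrS].
Qed.

Lemma xvec_inj i n m : xvec i *+ n = xvec i *+ m :> L -> n = m.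
Proof.
rewrite -mdegLU -!mdegLMn => /mdegL_eq[mE qE].
have E a b : (U_(i) *+ a)%MM b = (if b == i then a else 0%N) :> nat.
  by rewrite mulmnE mnm1E eq_sym; case: eqP; rewrite ?mul1n ?mul0n.
have Q a : mquot (U_(i) *+ a)%MM = (a %/ p i)%N.
  rewrite /mquot (bigD1 i) //= big1 ?addn0 => [|j ji]; first by rewrite E eqxx.
  by rewrite E (negPf ji) div0n.
have := mE i; rewrite !E eqxx => {}mE.
by rewrite (divn_eq n (p i)) (divn_eq m (p i)) mE -!Q qE.
Qed.

Lemma Xvar_homog i : Ahomog (xvec i) (Xvar i : A).
Proof. by exists 'X_i; split=> //; rewrite -mdegLU; apply: mhomogX. Qed.

Lemma Aconst_homog c : Ahomog 0 (Aconst X c).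
Proof.
exists c%:MP; split=> // m; rewrite msuppC; case: eqP => // _.
by rewrite inE => /eqP ->; apply: mdegL0.
Qed.

Lemma AhomogM x y (a b : A) : Ahomog x a -> Ahomog y b -> Ahomog (x + y) (a * b).
Proof.
move=> [f [hf ->]] [g [hg ->]]; exists (f * g); split; first exact: mhomogM.
by rewrite AprM.
Qed.

Lemma AhomogD x (a b : A) : Ahomog x a -> Ahomog x b -> Ahomog x (a + b).
Proof.
move=> [f [hf ->]] [g [hg ->]]; exists (f + g); split; first exact: mhomogD.
by rewrite AprD.
Qed.

Lemma Ahomog0 x : Ahomog x (0 : A).
Proof. by exists 0; split; [rewrite /mhomog msupp0|rewrite Apr0]. Qed.

Lemma Ahomog1 : Ahomog 0 (1 : A).
Proof. by have := Aconst_homog 1; rewrite rmorph1. Qed.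

Lemma AhomogX x (a : A) n : Ahomog x a -> Ahomog (x *+ n) (a ^+ n).
Proof.
move=> ha; elim: n => [|n IH]; first exact: Ahomog1.
by rewrite exprS mulrS; apply: AhomogM.
Qed.

Lemma Ahomog_neg i (a : A) : Ahomog (- xvec i) a -> a = 0.
Proof.
move=> [f [hf ->]]; suff -> : f = 0 by rewrite Apr0.
apply/mpolyP => m; rewrite mcoeff0; apply: memN_msupp_eq0.
apply/negP => /hf E; have : mdegL (m + U_(i)) = 0 :> L by rewrite mdegLD mdegLU E addNr.
by move/mdegL_eq0/mnmP/(_ i); rewrite mnmDE mnm1E eqxx mnm0E addn1.
Qed.

Lemma Ahc_homog x (a : A) : Ahomog x (Ahc x a).
Proof.
exists (mhc x (repr a)); split=> // m.
by rewrite mcoeff_msupp mcoeff_mhc; case: (mdegL m =P x) => // _; rewrite eqxx.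
Qed.

Lemma Ahc_sum (a : A) : exists s : seq L, uniq s /\ a = \sum_(x <- s) Ahc x a.
Proof.
have [s [us E]] := twist_hcomp_sum 0 a; exists s; split=> //.
by rewrite [LHS]E; apply: eq_bigr => x _; rewrite add0r.
Qed.

Lemma Ahomog_Ahc x y (a : A) : Ahomog y a -> Ahc x a = if x == y then a else 0.
Proof.
move=> [f [hf ->]]; rewrite Ahc_pi (mhc_homog _ hf).
by case: eqP => // _; rewrite Apr0.
Qed.

End Degrees.

Section NormalForm.
Variables (k : fieldType) (X : wpl k).
Local Notation t := (wl_n X).+2.
Local Notation p := (@wl_weight k X).
Local Notation A := (AA X).
Implicit Types q r : {poly k}.

Definition T0 : A := Xvar ord0 ^+ p ord0.
Definition T1 : A := Xvar ord_snd ^+ p ord_snd.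

(* The homogenization of degree n in T0, T1 of a polynomial of degree at most n. *)
Definition hform n q : A := \sum_(j < n.+1) Aconst X q`_j * (T0 ^+ (n - j) * T1 ^+ j).

(** The relation [f_i] makes [X_i ^ p_i] equal to [T1 - lambda_i T0]; this is its value at [T0 = 1],
    [T1 = 'X], where infinity contributes [T0], that is 1. *)
Definition ell (i : 'I_t) : {poly k} :=
  if wl_point i is Some l then 'X - l%:P else 1.

Lemma hformD n q r : hform n (q + r) = hform n q + hform n r.
Proof.
rewrite /hform -big_split; apply: eq_bigr => j _.
by rewrite coefD rmorphD mulrDl.
Qed.

Lemma hformZ n c q : hform n (c *: q) = Aconst X c * hform n q.
Proof.
rewrite /hform mulr_sumr; apply: eq_bigr => j _.
by rewrite coefZ rmorphM -mulrA.
Qed.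

Lemma hform0 n : hform n 0 = 0.
Proof. by rewrite -(scale0r 0) hformZ rmorph0 mul0r. Qed.

Lemma hform_sum n (I : Type) (s : seq I) (F : I -> {poly k}) :
  hform n (\sum_(i <- s) F i) = \sum_(i <- s) hform n (F i).
Proof. exact: (big_morph _ (hformD n) (hform0 n)). Qed.

Lemma hformXn n j : (j <= n)%N -> hform n 'X^j = T0 ^+ (n - j) * T1 ^+ j.
Proof.
move=> jn; rewrite /hform (bigD1 (Ordinal (jn : j < n.+1)%N)) //= big1 => [|i ij].
  by rewrite coefXn eqxx rmorph1 mul1r addr0.
rewrite coefXn; case: eqP => [E|_]; last by rewrite rmorph0 mul0r.
by case/eqP: ij; apply: val_inj.
Qed.

(** The size bounds guarantee that [hform] truncates neither argument. *)
Lemma hformM n m q r : (size q <= n.+1)%N -> (size r <= m.+1)%N ->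
  hform n q * hform m r = hform (n + m) (q * r).
Proof.
move=> sq sr.
have qE (s : {poly k}) l : (size s <= l.+1)%N -> s = \sum_(i < l.+1) s`_i *: 'X^i :> {poly k}.
  move=> sl; rewrite -{1}(coefK s) poly_def.
  rewrite (big_ord_widen _ (fun i : nat => s`_i *: 'X^i) sl) [LHS]big_mkcond.
  apply: eq_bigr => i _; case: ltnP => // si.
  by rewrite nth_default // scale0r.
rewrite [in RHS](qE q n) // [in RHS](qE r m) // mulr_suml [in RHS]mulr_suml hform_sum.
apply: eq_bigr => i _; rewrite mulr_sumr [in RHS]mulr_sumr hform_sum; apply: eq_bigr => j _.
rewrite -scalerAl -scalerAr scalerA -exprD hformZ rmorphM hformXn; last first.
  by rewrite leq_add // -ltnS.
have -> : (n + m - (i + j) = (n - i) + (m - j))%N.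
  by rewrite subnDA addnC -addnBA -1?ltnS // addnC -addnBA -1?ltnS // addnC.
by rewrite !exprD mulrACA; congr (_ * _); rewrite mulrACA.
Qed.

Lemma hform1X q : hform 0 q = Aconst X q`_0.
Proof. by rewrite /hform big_ord1 subnn !expr0 !mulr1. Qed.

Lemma T0E : T0 = hform 1 1.
Proof. by rewrite -(expr0 'X) hformXn // subn0 expr1 expr0 mulr1. Qed.

Lemma T1E : T1 = hform 1 'X.
Proof. by rewrite -(expr1 'X) hformXn // subnn expr0 mul1r expr1. Qed.

Lemma size_ell i : (size (ell i) <= 2)%N.
Proof. by rewrite /ell; case: wl_point => [l|]; rewrite ?size_XsubC ?size_poly1. Qed.

Lemma ell_neq0 i : ell i != 0.
Proof. by rewrite /ell; case: wl_point => [l|]; rewrite ?polyXsubC_eq0 ?oner_eq0. Qed.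

Lemma wl_point_some (i : 'I_t) : i != ord0 -> exists l, wl_point i = Some l.
Proof.
case E: (wl_point i) => [l|] i0; first by exists l.
by case/eqP: i0; apply: (@wl_point_inj _ X); rewrite E wl_point1.
Qed.

Lemma Xvar_pow i : Xvar i ^+ p i = hform 1 (ell i).
Proof.
have [->|i0] := eqVneq i ord0; first by rewrite -/T0 T0E /ell wl_point1.
have [l lE] := wl_point_some i0.
have hE : hform 1 ('X - l%:P) = T1 - Aconst X l * T0.
  rewrite hformD -T1E -polyCN -[(- l)%:P]mulr1 mul_polyC hformZ -T0E.
  by rewrite rmorphN mulNr.
rewrite /ell lE hE.
have [i1|i1] := eqVneq i ord_snd.
  move: lE; rewrite i1 wl_point2 => -[<-]; rewrite rmorph0 mul0r subr0 //.
have : Apr (wl_rel i : wl_poly X) = 0 :> A.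
  rewrite -Apr0; apply/eqP; rewrite /Apr -Quotient.idealrBE subr0; apply/asboolP.
  exists (fun j => (j == i)%:R); rewrite (bigD1 i) /=; last first.
    by case: (i : nat) (i0 : (i : nat) != 0%N) (i1 : (i : nat) != 1%N) => [|[]].
  by rewrite eqxx mul1r big1 ?addr0 // => j /andP[_ /negPf ->]; rewrite mul0r.
rewrite /wl_rel lE !AprD -scaleN1r !AprZ !AprXn rmorphN1 mulN1r.
by move=> /eqP; rewrite addr_eq0 => /eqP E; rewrite -[LHS](subrK T1) E addrC.
Qed.

End NormalForm.

Section Arithmetic.
Variables (k : fieldType) (X : wpl k).
Local Notation t := (wl_n X).+2.
Local Notation p := (@wl_weight k X).
Local Notation A := (AA X).
Local Notation T0 := (T0 X).
Local Notation T1 := (T1 X).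
Local Notation hform := (hform X).
Implicit Types q r : {poly k}.

Definition Xres (m : 'X_{1..t}) : A := \prod_i Xvar i ^+ (m i %% p i).

Lemma size_mul_form n m q r : (size q <= n.+1)%N -> (size r <= m.+1)%N ->
  (size (q * r)%R <= (n + m).+1)%N.
Proof.
move=> sq sr; rewrite (leq_trans (size_polyMleq _ _)) // -subn1 leq_subLR add1n.
by rewrite (leq_trans (leq_add sq sr)) // addSn addnS.
Qed.

Lemma hform_exp n q e : (size q <= n.+1)%N ->
  hform n q ^+ e = hform (e * n) (q ^+ e) /\ (size (q ^+ e)%R <= (e * n).+1)%N.
Proof.
move=> sq; elim: e => [|e [IH IHs]].
  by rewrite !expr0 hform1X coef1 rmorph1 size_poly1.
by rewrite !exprS IH hformM // mulSn; split=> //; apply: size_mul_form.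
Qed.

Lemma hform_prod (s : seq 'I_t) (e : 'I_t -> nat) :
  \prod_(i <- s) (Xvar i ^+ p i) ^+ e i
    = hform (\sum_(i <- s) e i)%N (\prod_(i <- s) ell i ^+ e i) /\
  (size (\prod_(i <- s) ell i ^+ e i)%R <= (\sum_(i <- s) e i).+1)%N.
Proof.
elim: s => [|i s [IH IHs]].
  by rewrite !big_nil hform1X coef1 rmorph1 size_poly1.
have [E sE] := hform_exp (e i) (size_ell i); rewrite muln1 in E sE.
by rewrite !big_cons IH Xvar_pow E hformM //; split=> //; apply: size_mul_form.
Qed.

Lemma AprX_nf (m : 'X_{1..t}) : exists2 q : {poly k}, (size q <= (mquot m).+1)%N &
  Apr ('X_[m] : {mpoly k[t]}) = Xres m * hform (mquot m) q.
Proof.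
have [E sE] := hform_prod (index_enum 'I_t) (fun i => (m i %/ p i)%N).
exists (\prod_i ell i ^+ (m i %/ p i)) => //; rewrite -E AprX /Xres -big_split /=.
by apply: eq_bigr => i _; rewrite -exprM -exprD addnC mulnC -divn_eq.
Qed.

(** All monomials of one degree have the same exponents modulo the weights, so the same [Xres m]
    comes out of each of them. *)
Lemma Ahomog_nf (m : 'X_{1..t}) (a : A) : Ahomog (mdegL m) a ->
  exists2 q : {poly k}, (size q <= (mquot m).+1)%N & a = Xres m * hform (mquot m) q.
Proof.
move=> [f [hf ->]]; rewrite (mpolyE f) Apr_sum.
have : {subset msupp f <= msupp f} by [].
elim: {1 3}(msupp f) => [|m' s IH] sf.
  by exists 0; rewrite ?size_poly0 // big_nil hform0 mulr0.
have [r sr rE] := IH (fun i H => sf _ (mem_behead (s := m' :: s) H)).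
have /hf/mdegL_eq[mE qE] := sf _ (mem_head _ _).
have [q sq qE'] := AprX_nf m'; rewrite qE in sq qE'.
exists (f@_m' *: q + r).
  rewrite (leq_trans (size_polyD _ _)) // geq_max sr andbT.
  exact: leq_trans (size_scale_leq _ _) sq.
rewrite big_cons rE AprZ qE' hformD hformZ mulrDr; congr (_ + _).
rewrite mulrCA; congr (_ * (_ * _)); apply: eq_bigr => i _; congr (_ ^+ _).
exact: mE.
Qed.

Lemma Ahomog_zero x (a : A) : (forall m : 'X_{1..t}, mdegL m <> x) -> Ahomog x a -> a = 0.
Proof.
move=> N [f [hf ->]]; suff -> : f = 0 by rewrite Apr0.
by apply/mpolyP => m; rewrite mcoeff0; apply: memN_msupp_eq0; apply/negP => /hf /N.
Qed.

Lemma Ahomog_monomial x (a : A) : Ahomog x a -> a != 0 ->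
  exists m : 'X_{1..t}, mdegL m = x.
Proof.
move=> ha a0; apply: contrapT => N; case/eqP: a0; apply: (Ahomog_zero _ ha) => m E.
by apply: N; exists m.
Qed.

Definition psi (m : 'X_{1..t}) : {poly k} := \prod_i ell i ^+ (m i %/ p i).

(** A linear map to {poly k} that forgets exponents modulo the weights and dehomogenizes. It is not
    multiplicative, but it turns multiplication by [X_i ^ p_i] into multiplication by [ell i]. Hence
    it kills the ideal and can certify that an element of [AA X] is nonzero. *)
Definition phi (f : {mpoly k[t]}) : {poly k} := \sum_(m <- msupp f) f@_m *: psi m.

Lemma phiE (s : seq 'X_{1..t}) f : uniq s -> {subset msupp f <= s} ->
  phi f = \sum_(m <- s) f@_m *: psi m.
Proof.
move=> us sf; rewrite [RHS](bigID (mem (msupp f))) /= [X in _ + X]big1 ?addr0.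
  rewrite -big_filter; apply: perm_big; apply: uniq_perm => //.
    exact: filter_uniq.
  by move=> m; rewrite mem_filter; case mf: (m \in msupp f) => //=; rewrite sf.
by move=> m mf; rewrite memN_msupp_eq0 // scale0r.
Qed.

Lemma phiD f g : phi (f + g) = phi f + phi g.
Proof.
pose s := undup (msupp f ++ msupp g ++ msupp (f + g)).
have us : uniq s by apply: undup_uniq.
rewrite !(@phiE s) // -?big_split //=; try by move=> m mf; rewrite mem_undup !mem_cat mf ?orbT.
by apply: eq_bigr => m _; rewrite mcoeffD scalerDl.
Qed.

Lemma phiZ c f : phi (c *: f) = c *: phi f.
Proof.
rewrite (@phiE (msupp f)) ?msupp_uniq //; last exact: msuppZ_le.
by rewrite scaler_sumr; apply: eq_bigr => m _; rewrite mcoeffZ scalerA.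
Qed.

Lemma phi0 : phi 0 = 0. Proof. by rewrite /phi msupp0 big_nil. Qed.

Lemma phi_sum (I : Type) (s : seq I) (P : pred I) (F : I -> {mpoly k[t]}) :
  phi (\sum_(i <- s | P i) F i) = \sum_(i <- s | P i) phi (F i).
Proof. exact: (big_morph _ phiD phi0). Qed.

Lemma phiX (m : 'X_{1..t}) : phi 'X_[m] = psi m.
Proof. by rewrite /phi msuppX big_seq1 mcoeffX eqxx scale1r. Qed.

Lemma phi_pow f i : phi (f * 'X_i ^+ p i) = phi f * ell i.
Proof.
rewrite {1 2}(mpolyE f) mulr_suml !phi_sum mulr_suml; apply: eq_bigr => m _.
rewrite -scalerAl !phiZ -scalerAl mpolyXn -mpolyXD !phiX; congr (_ *: _).
rewrite /psi (bigD1 i) //= [X in _ = X * _](bigD1 i) //= [RHS]mulrAC; congr (_ * _).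
  rewrite mnmDE mulmnE mnm1E eqxx mul1n divnDr ?dvdnn // divnn wl_weight_gt0.
  by rewrite addn1 exprSr.
apply: eq_bigr => j ji; rewrite mnmDE mulmnE mnm1E eq_sym (negPf ji) mul0n.
by rewrite addn0.
Qed.

Lemma phi_ideal f : f \in @wl_ideal _ X -> phi f = 0.
Proof.
move=> /asboolP[g ->]; rewrite phi_sum big1 // => i i1.
rewrite /wl_rel mulrDr mulrBr -scalerAr !phiD -scaleN1r !phiZ !phi_pow.
have [l lE] : exists l, wl_point i = Some l.
  by apply: wl_point_some; apply: contraTneq i1 => ->.
rewrite /ell lE wl_point1 wl_point2 /= subr0 mulr1 scaleN1r mulrBr -mul_polyC.
by rewrite (mulrC _ l%:P) [X in X + _]addrAC subrr sub0r addNr.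
Qed.

Definition Aphi (a : A) : {poly k} := phi (repr a).

Lemma Aphi_pi f : Aphi (Apr f) = phi f.
Proof.
apply/eqP; rewrite -subr_eq0 -[- _]scaleN1r -phiZ -phiD scaleN1r; apply/eqP.
apply: phi_ideal; suff : repr (\pi_{ideal_quot Aideal X} f) - f \in Aideal X by [].
by rewrite Quotient.idealrBE reprK.
Qed.

Lemma AphiD a b : Aphi (a + b) = Aphi a + Aphi b.
Proof.
by have [f ->] := Apr_surj a; have [g ->] := Apr_surj b; rewrite -AprD !Aphi_pi phiD.
Qed.

Lemma Aphi0 : Aphi 0 = 0. Proof. by rewrite -Apr0 Aphi_pi phi0. Qed.

Lemma Aphi_pow a i : Aphi (a * Xvar i ^+ p i) = Aphi a * ell i.
Proof. by have [f ->] := Apr_surj a; rewrite -AprXn -AprM !Aphi_pi phi_pow. Qed.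

Lemma AphiC a c : Aphi (a * Aconst X c) = c *: Aphi a.
Proof. by have [f ->] := Apr_surj a; rewrite mulrC -AprZ !Aphi_pi phiZ. Qed.

Lemma Aphi_hform a n q : (size q <= n.+1)%N -> Aphi (a * hform n q) = Aphi a * q.
Proof.
move=> sq; rewrite /hform mulr_sumr (big_morph _ AphiD Aphi0).
rewrite -{2}(coefK q) poly_def mulr_sumr.
rewrite [RHS](big_ord_widen _ (fun i : nat => Aphi a * (q`_i *: 'X^i)) sq) [RHS]big_mkcond.
apply: eq_bigr => j _.
have T0k b e : Aphi (b * T0 ^+ e) = Aphi b.
  elim: e => [|e IH]; first by rewrite mulr1.
  by rewrite exprSr mulrA Aphi_pow IH /ell wl_point1 mulr1.
have T1k b e : Aphi (b * T1 ^+ e) = Aphi b * 'X^e.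
  elim: e => [|e IH]; first by rewrite !mulr1.
  by rewrite exprSr mulrA Aphi_pow IH /ell wl_point2 subr0 exprSr mulrA.
rewrite !mulrA T1k T0k AphiC -scalerAl -scalerAr.
by case: ltnP => // sj; rewrite nth_default // scale0r.
Qed.

(** [Aphi] recovers [q] from its form: [T0] and [T1] are algebraically independent. *)
Lemma hform_neq0 n q : (size q <= n.+1)%N -> hform n q = 0 -> q = 0.
Proof.
move=> sq /(congr1 (fun a => Aphi (1 * a))); rewrite mulr0 Aphi0 Aphi_hform //.
rewrite -Apr1 Aphi_pi -mpolyX0 phiX /psi big1 ?mul1r // => i _.
by rewrite mnm0E div0n expr0.
Qed.

(** Under [Aphi] the product of the two residual monomials becomes a product of powers of the
    [ell i], which are nonzero, and the forms multiply in the domain {poly k}. *)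
Lemma Ahomog_domain x y (a b : A) : Ahomog x a -> Ahomog y b -> a != 0 -> b != 0 -> a * b != 0.
Proof.
move=> ha hb a0 b0.
have [m mE] := Ahomog_monomial ha a0; have [m' mE'] := Ahomog_monomial hb b0.
rewrite -mE in ha; rewrite -mE' in hb.
have [q sq qE] := Ahomog_nf ha; have [r sr rE] := Ahomog_nf hb.
have q0 : q != 0 by apply: contraNneq a0 => q0; rewrite qE q0 hform0 mulr0.
have r0 : r != 0 by apply: contraNneq b0 => r0; rewrite rE r0 hform0 mulr0.
apply/eqP => /(congr1 Aphi); rewrite qE rE mulrACA hformM // Aphi0.
rewrite Aphi_hform ?size_mul_form //; apply/eqP; rewrite mulf_neq0 ?mulf_neq0 //.
rewrite /Xres -big_split /=.
have -> : \prod_i (Xvar i ^+ (m i %% p i) * Xvar i ^+ (m' i %% p i))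
    = Apr 'X_[[multinom (m i %% p i + m' i %% p i)%N | i < t]] :> A.
  by rewrite AprX; apply: eq_bigr => i _; rewrite -exprD mnmE.
by rewrite Aphi_pi phiX /psi; apply/prodf_neq0 => i _; rewrite expf_neq0 // ell_neq0.
Qed.

Lemma T0_homog : Ahomog (cvec X) T0.
Proof. by rewrite -(xvec_weight ord0); apply/AhomogX/Xvar_homog. Qed.

Lemma T1_homog : Ahomog (cvec X) T1.
Proof. by rewrite -(xvec_weight ord_snd); apply/AhomogX/Xvar_homog. Qed.

Lemma hform_homog n q : Ahomog (cvec X *+ n) (hform n q).
Proof.
apply: big_ind => [|a b|j _]; [exact: Ahomog0|exact: AhomogD|].
rewrite -[_ *+ n]add0r; apply: AhomogM; first exact: Aconst_homog.
have -> : cvec X *+ n = cvec X *+ (n - j) + cvec X *+ j.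
  by rewrite -mulrnDr subnK // -ltnS.
by apply: AhomogM; apply: AhomogX; [apply: T0_homog|apply: T1_homog].
Qed.

Lemma Ahomog_cn n (a : A) : Ahomog (cvec X *+ n) a ->
  exists2 q : {poly k}, (size q <= n.+1)%N & a = hform n q.
Proof.
pose m : 'X_{1..t} := (U_(ord0) *+ (p ord0 * n))%MM.
have mE : mdegL m = cvec X *+ n by rewrite mdegLMn mdegLU mulrnA.
have mi i : m i = (if i == ord0 then p ord0 * n else 0)%N.
  by rewrite mulmnE mnm1E eq_sym; case: eqP; rewrite ?mul1n ?mul0n.
have qE : mquot m = n.
  rewrite /mquot (bigD1 ord0) //= big1 => [|i i0]; last by rewrite mi (negPf i0) div0n.
  by rewrite mi eqxx mulKn ?wl_weight_gt0 // addn0.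
rewrite -mE => /Ahomog_nf; rewrite qE => -[q sq ->]; exists q => //.
rewrite /Xres big1 ?mul1r // => i _; rewrite mi; case: eqP => [->|_].
  by rewrite modnMr expr0.
by rewrite mod0n expr0.
Qed.

Lemma AhcM x y (a b : A) : Ahomog x a -> Ahc (x + y) (a * b) = a * Ahc y b.
Proof.
move=> [f [hf ->]]; have [g ->] := Apr_surj b.
by rewrite -AprM !Ahc_pi mhcM // AprM.
Qed.

Lemma T1_not_dvd n (a : A) : T1 ^+ n <> Xvar ord0 * a.
Proof.
(* The power [p ord0] replaces [Xvar ord0] by [T0]. The extra factor [T1] makes the total degree
   [N.+1] positive, so that the cofactor of [T0] can be cut down to a form of degree [N]. *)
move=> E; pose N := (n * p ord0)%N; pose b := a ^+ p ord0 * T1.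
have E1 : T1 ^+ N.+1 = T0 * b.
  by rewrite exprSr exprM E exprMn mulrA.
have E2 : T1 ^+ N.+1 = T0 * Ahc (cvec X *+ N) b.
  rewrite -(AhcM _ _ T0_homog) -E1 (Ahomog_Ahc _ (AhomogX N.+1 T1_homog)).
  by rewrite mulrS eqxx.
have [q sq qE] := Ahomog_cn (Ahc_homog (cvec X *+ N) b).
have : hform N.+1 ('X^(N.+1) - q) = 0.
  rewrite -scaleN1r hformD hformZ rmorphN1 mulN1r hformXn // subnn expr0 mul1r E2 qE.
  by rewrite T0E hformM ?size_poly1 // mul1r add1n subrr.
have sX : (size ('X^(N.+1) - q : {poly k})%R <= N.+2)%N.
  rewrite (leq_trans (size_polyD _ _)) // geq_max size_polyXn leqnn size_polyN.
  exact: leq_trans sq _.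
move/(hform_neq0 sX)/eqP; rewrite subr_eq0 => /eqP qX.
by move: sq; rewrite -qX size_polyXn ltnn.
Qed.

End Arithmetic.

(** * Homogeneous primes *)

Section Primes.
Variables (k : fieldType) (X : wpl k).
Local Notation t := (wl_n X).+2.
Local Notation p := (@wl_weight k X).
Local Notation A := (AA X).
Local Notation T0 := (T0 X).
Local Notation T1 := (T1 X).
Local Notation hform := (hform X).
Implicit Types (q r : {poly k}) (a b g h : A).

Definition in_ideal2 h g a := exists u v : A, a = u * h + v * g.

(* Some power of the irrelevant ideal lies in the ideal generated by h and g:
   T0 and T1 generate an irrelevant-primary ideal. *)
Definition cofinite2 h g := (exists n, in_ideal2 h g (T0 ^+ n)) /\
  (exists n, in_ideal2 h g (T1 ^+ n)).

Lemma cofinite2M h g g' : cofinite2 h g -> cofinite2 h g' -> cofinite2 h (g * g').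
Proof.
have key x : (exists n, in_ideal2 h g (x ^+ n)) -> (exists n, in_ideal2 h g' (x ^+ n)) ->
    exists n, in_ideal2 h (g * g') (x ^+ n).
  move=> [n [u [v E]]] [m [u' [v' E']]]; exists (n + m)%N.
  exists (u * x ^+ m + v * g * u'), (v * v').
  by rewrite exprD E E'; ring.
by move=> [h0 h1] [h0' h1']; split; apply: key.
Qed.

Lemma cofinite2_dvdl h g c : cofinite2 (h * c) g -> cofinite2 h g.
Proof.
by move=> [[n [u [v E]]] [m [u' [v' E']]]]; split; [exists n, (u * c), v|exists m, (u' * c), v'];
  rewrite ?E ?E' mulrAC mulrA.
Qed.

Lemma cofinite2_dvdr h g c : cofinite2 h (g * c) -> cofinite2 h g.
Proof.
by move=> [[n [u [v E]]] [m [u' [v' E']]]]; split; [exists n, u, (v * c)|exists m, u', (v' * c)];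
  rewrite ?E ?E' mulrAC mulrA.
Qed.

Lemma hform_T0 n q : (size q <= n)%N -> exists b, hform n q = T0 * b.
Proof.
case: n => [|n] sq.
  move: sq; rewrite leqn0 size_poly_eq0 => /eqP ->.
  by exists 0; rewrite hform0 mulr0.
by exists (hform n q); rewrite T0E hformM ?size_poly1 // mul1r.
Qed.

Lemma hform_lead n q : size q = n.+1 ->
  exists b c, T1 ^+ n = c * hform n q + T0 * b.
Proof.
move=> sq; have l0 : lead_coef q != 0.
  by rewrite lead_coef_eq0 -size_poly_eq0 sq.
have [|b bE] := @hform_T0 n (q - lead_coef q *: 'X^n).
  apply/leq_sizeP => j; rewrite leq_eqVlt => /orP[/eqP <-|nj].
    by rewrite coefB coefZ coefXn eqxx mulr1 lead_coefE sq subrr.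
  by rewrite coefB coefZ coefXn gtn_eqF // mulr0 subr0 nth_default ?sq.
exists (- (Aconst X (lead_coef q)^-1 * b)), (Aconst X (lead_coef q)^-1).
move: bE; rewrite -scaleNr hformD hformZ hformXn // subnn expr0 mul1r rmorphN mulNr.
move=> /eqP; rewrite subr_eq => /eqP ->.
transitivity (Aconst X (lead_coef q)^-1 * Aconst X (lead_coef q) * T1 ^+ n); last by ring.
by rewrite -rmorphM mulVf // rmorph1 mul1r.
Qed.

Lemma cofinite2_sym h g : cofinite2 h g -> cofinite2 g h.
Proof.
by move=> [[n [u [v E]]] [m [u' [v' E']]]]; split; [exists n, v, u|exists m, v', u'];
  rewrite ?E ?E' addrC.
Qed.

(** As [q] has full degree, [T1 ^ n] lies in the ideal of the form and [T0]; a further power of it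
    lies in the ideal of the form and [T0 ^ N]. *)
Lemma cofinite2_lead n q h : size q = n.+1 ->
  (exists N, in_ideal2 h (hform n q) (T0 ^+ N)) -> cofinite2 h (hform n q).
Proof.
move=> sq T0N; split=> //; case: T0N => N [u [v E]].
have [b [c bE]] := hform_lead sq; set F := hform n q in E bE *.
have [d dE] : exists d, T1 ^+ (n * N) = d * F + T0 ^+ N * b ^+ N.
  rewrite exprM bE; elim: {E} N => [|N [d IH]].
    by exists 0; rewrite !expr0 mul0r add0r mul1r.
  rewrite exprSr IH; exists (d * (c * F + T0 * b) + T0 ^+ N * b ^+ N * c).
  by rewrite !exprSr; ring.
exists (n * N)%N, (u * b ^+ N), (d + v * b ^+ N).
by rewrite dE E; ring.
Qed.

Lemma cofinite2_coprime n m q r : (size q <= n.+1)%N -> (size r <= m.+1)%N ->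
  coprimep q r -> size q = n.+1 \/ size r = m.+1 -> cofinite2 (hform n q) (hform m r).
Proof.
move=> sq sr /Bezout_eq1_coprimepP[[u v] /= uv] top.
have T0N : exists N, in_ideal2 (hform n q) (hform m r) (T0 ^+ N).
  (* Homogenizing a Bezout relation turns the constant 1 into a power of [T0]; [s] leaves room for
     the Bezout coefficients. *)
  pose s := (size u + size v)%N.
  exists (m + s + n)%N, (hform (m + s) u), (hform (n + s) v).
  have su : (size u <= (m + s).+1)%N by rewrite leqW // addnCA leq_addr.
  have sv : (size v <= (n + s).+1)%N by rewrite leqW // !addnA leq_addl.
  rewrite !hformM // (addnAC n) (addnC n m) addnAC -hformD uv.
  by rewrite -(expr0 'X) hformXn // subn0 mulr1.
case: top => top; last exact: cofinite2_lead.
apply: cofinite2_sym; apply: cofinite2_lead => //.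
by case: T0N => N [a [b E]]; exists N, b, a; rewrite addrC.
Qed.

(** What makes [L / h L] a simple sheaf: the class of a homogeneous [g] is zero or generates the
    quotient up to finite length. *)
Definition prime_elt h := forall x g, Ahomog x g -> (exists b, g = h * b) \/ cofinite2 h g.

(** By the normal form, a homogeneous element is a product of variables and one form, and both
    alternatives are stable under products. *)
Lemma prime_eltP h :
  (forall i, (exists b, Xvar i = h * b) \/ cofinite2 h (Xvar i)) ->
  (forall n q, (size q <= n.+1)%N -> (exists b, hform n q = h * b) \/ cofinite2 h (hform n q)) ->
  prime_elt h.
Proof.
move=> hX hF x g hg.
have [[m mE]|N] := pselect (exists m : 'X_{1..t}, mdegL m = x); last first.
  left; exists 0; rewrite mulr0; by apply: (Ahomog_zero _ hg) => m mE; apply: N; exists m.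
rewrite -mE in hg; have [q sq ->] := Ahomog_nf hg.
have mul a b : (exists c, a = h * c) \/ cofinite2 h a ->
    (exists c, b = h * c) \/ cofinite2 h b -> (exists c, a * b = h * c) \/ cofinite2 h (a * b).
  move=> [[c ->] _|ca]; first by left; exists (c * b); rewrite mulrA.
  by move=> [[c ->]|cb]; [left; exists (a * c); rewrite mulrCA|right; apply: cofinite2M].
have h1 : (exists c, 1 = h * c) \/ cofinite2 h 1.
  by right; split; exists 0%N, 0, 1; rewrite mul0r add0r mulr1.
apply: (mul _ _ _ (hF _ _ sq)).
apply: (big_ind (fun a => (exists c, a = h * c) \/ cofinite2 h a)) => [|a b|i _].
- exact: h1.
- exact: mul.
by elim: (m i %% p i)%N => [|n IH]; rewrite ?expr0 // exprS; apply: mul.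
Qed.

Lemma hform_dvd n m q r : size q = n.+1 -> (size r <= m.+1)%N -> q %| r ->
  exists j s, hform m r = hform n q * hform j s.
Proof.
move=> sq sr /dvdpP[s rE]; have [r0|r0] := eqVneq r 0.
  by exists 0%N, 0; rewrite r0 !hform0 mulr0.
have s0 : s != 0 by apply: contraNneq r0 => s0; rewrite rE s0 mul0r.
have q0 : q != 0 by rewrite -size_poly_eq0 sq.
have szr : size r = (size s + n)%N by rewrite rE size_mul // sq addnS.
have nm : (n <= m)%N.
  rewrite -ltnS; apply: leq_trans sr; rewrite szr -add1n leq_add2r.
  by rewrite lt0n size_poly_eq0.
exists (m - n)%N, s; rewrite hformM ?sq ?subnKC //; first by rewrite rE mulrC.
by rewrite -(leq_add2r n) -szr addSn subnK.
Qed.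

Lemma size_ell_some (i : 'I_t) : i != ord0 -> size (ell i) = 2%N.
Proof. by move=> /wl_point_some[l lE]; rewrite /ell lE size_XsubC. Qed.

Lemma coprime_ell (i j : 'I_t) : i != j -> coprimep (ell i) (ell j).
Proof.
move=> ij; rewrite /ell.
case Ei: (wl_point i) => [l|]; last by rewrite coprime1p.
case Ej: (wl_point j) => [l'|]; last by rewrite coprimep1.
rewrite coprimep_XsubC root_XsubC; apply: contraNneq ij => E.
by apply/eqP; apply: (@wl_point_inj _ X); rewrite Ei Ej E.
Qed.

Lemma Xvar_powS (i : 'I_t) : exists c, hform 1 (ell i) = Xvar i * c.
Proof.
by rewrite -Xvar_pow -(prednK (wl_weight_gt0 i)); exists (Xvar i ^+ (p i).-1); rewrite exprS.
Qed.

Lemma Xvar_neq0 (i : 'I_t) : Xvar i != 0.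
Proof.
have [c cE] := Xvar_powS i; apply/eqP => X0; have := ell_neq0 i.
by move/eqP; apply; apply: (@hform_neq0 k X 1 _ (size_ell i)); rewrite cE X0 mul0r.
Qed.

Lemma Xvar_prime (i : 'I_t) : prime_elt (Xvar i).
Proof.
have [c cE] := Xvar_powS i.
have red g : cofinite2 (hform 1 (ell i)) g -> cofinite2 (Xvar i) g.
  by rewrite cE; apply: cofinite2_dvdl.
apply: prime_eltP => [j|n q sq].
  have [->|ij] := eqVneq i j; first by left; exists 1; rewrite mulr1.
  right; have [d dE] := Xvar_powS j; apply: (@cofinite2_dvdr _ _ d); rewrite -dE; apply: red.
  apply: cofinite2_coprime (size_ell i) (size_ell j) (coprime_ell ij) _.
  have [i0|i0] := eqVneq i ord0; [right|left]; apply: size_ell_some => //.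
  by rewrite eq_sym -i0.
have dvd : (exists b, hform n q = hform 1 (ell i) * b) -> exists b, hform n q = Xvar i * b.
  by move=> [b ->]; exists (c * b); rewrite cE mulrA.
(* At infinity, divisibility by [T0] is read off from the size of [q]; at the other points, from a
   root. *)
have [i0|i0] := eqVneq i ord0.
  move: sq; rewrite leq_eqVlt => /orP[/eqP sq|sq]; [right|left].
    apply: red; rewrite i0 /ell wl_point1.
    by apply: cofinite2_coprime; rewrite ?size_poly1 ?sq ?coprime1p //; right.
  apply: dvd; have [b bE] := hform_T0 sq; exists b => //.
  by rewrite bE T0E i0 /ell wl_point1.
have [l lE] := wl_point_some i0.
have [rl|rl] := boolP (root q l); [left|right].
  apply: dvd; have [|j [b bE]] := hform_dvd (size_ell_some i0) sq; last by exists (hform j b).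
  by rewrite /ell lE dvdp_XsubCl.
apply: red; apply: cofinite2_coprime (size_ell i) sq _ _.
  by rewrite /ell lE coprimep_sym coprimep_XsubC.
by left; apply: size_ell_some.
Qed.

Lemma form_prime n q : size q = n.+1 -> irreducible_poly q ->
  (forall i : 'I_t, ~~ (q %| ell i)) -> prime_elt (hform n q).
Proof.
move=> sq iq nq; apply: prime_eltP => [i|m r sr].
  right; have [c cE] := Xvar_powS i; apply: (@cofinite2_dvdr _ _ c); rewrite -cE.
  apply: cofinite2_coprime (size_ell i) _ _; rewrite ?sq //; last by left.
  by rewrite irreducible_poly_coprime.
have [qr|qr] := boolP (q %| r); [left|right].
  by have [j [b ->]] := hform_dvd sq sr qr; exists (hform j b).
apply: cofinite2_coprime; rewrite ?sq //; last by left.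
by rewrite irreducible_poly_coprime.
Qed.

(* K stands for the set of homogeneous elements killing a simple sheaf. *)
Lemma prime_elt_exists (K : A -> Prop) :
  (forall x y a b, Ahomog x a -> Ahomog y b -> K (a * b) -> K a \/ K b) ->
  (forall x y a b, Ahomog x a -> Ahomog y b -> K a -> K (a * b)) ->
  (forall c, c != 0 -> ~ K (Aconst X c)) ->
  (exists x a, [/\ Ahomog x a, a != 0 & K a]) ->
  exists x h, [/\ Ahomog x h, h != 0, K h & prime_elt h].
Proof.
move=> KM Kid KC [x [a [ha a0 Ka]]].
have K1 : ~ K 1 by rewrite -(rmorph1 (Aconst X)); apply: KC; apply: oner_neq0.
(* If no variable lies in [K], then no monomial does, and the monomial factor of a normal form can
   be stripped off. *)
have [[i Ki]|NX] := pselect (exists i, K (Xvar i)).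
  by exists (xvec i), (Xvar i); split=> //; [apply: Xvar_homog|apply: Xvar_neq0|apply: Xvar_prime].
have KXn i n : ~ K (Xvar i ^+ n).
  elim: n => [|n IH]; first by rewrite expr0.
  rewrite exprS => /(KM _ _ _ _ (Xvar_homog i) (AhomogX n (Xvar_homog i)))[Ki|//].
  by apply: NX; exists i.
pose Q n := `[< exists q, [/\ (size q <= n.+1)%N, q != 0 & K (hform n q)] >].
have exQ : exists n, Q n.
  have [m mE] := Ahomog_monomial ha a0.
  rewrite -mE in ha; have [q sq qE] := Ahomog_nf ha.
  exists (mquot m); apply/asboolP; exists q; split=> //.
    by apply: contraNneq a0 => q0; rewrite qE q0 hform0 mulr0.
  have [y [hy nK]] : exists y, Ahomog y (Xres m) /\ ~ K (Xres m).
    apply: (big_ind (fun b => exists y, Ahomog y b /\ ~ K b)).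
    - by exists 0; split=> //; apply: Ahomog1.
    - move=> b c [y [hb Kb]] [z [hc Kc]]; exists (y + z); split; first exact: AhomogM.
      by move/(KM _ _ _ _ hb hc) => [].
    - by move=> i _; eexists; split; [apply/AhomogX/Xvar_homog|apply: KXn].
  by move: Ka; rewrite qE => /(KM _ _ _ _ hy (hform_homog X _ q))[].
(* A form of least degree in [K] is not divisible by [T0], so [q] has full size, and it has no
   proper factor, since one factor of a product lies in [K] again. *)
have [n /asboolP[q [sq q0 Kq]] minn] := ex_minnP exQ.
have min m r : (size r <= m.+1)%N -> r != 0 -> K (hform m r) -> (n <= m)%N.
  by move=> sr r0 Kr; apply: minn; apply/asboolP; exists r.
have szq : size q = n.+1.
  apply/eqP; move: sq; rewrite leq_eqVlt => /orP[//|]; rewrite ltnS => sq.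
  case: n sq Kq min {minn} => [|n] sq Kq min.
    by case/negP: q0; rewrite -size_poly_eq0 -leqn0.
  have E : hform n.+1 q = T0 * hform n q by rewrite T0E hformM ?size_poly1 // mul1r.
  rewrite E in Kq; have [K0|Kq'] := KM _ _ _ _ (T0_homog X) (hform_homog X n q) Kq.
    by case: (KXn ord0 (p ord0)).
  by have := min _ _ sq q0 Kq'; rewrite ltnn.
have iq : irreducible_poly q.
  split=> [|d sd /dvdpP[e qE]].
    rewrite szq ltnS lt0n; apply/eqP => n0; move: Kq; rewrite n0 hform1X; apply: KC.
    by apply: contraNneq q0 => E; rewrite (size1_polyC (_ : size q <= 1)%N) ?E // szq n0.
  have e0 : e != 0 by apply: contraNneq q0 => z; rewrite qE z mul0r.
  have d0 : d != 0 by apply: contraNneq q0 => z; rewrite qE z mulr0.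
  have [u uE] : exists u, size e = u.+1 by exists (size e).-1; rewrite prednK // lt0n size_poly_eq0.
  have [v vE] : exists v, size d = v.+1 by exists (size d).-1; rewrite prednK // lt0n size_poly_eq0.
  have nE : n = (u + v)%N by apply/eqP; rewrite -eqSS -szq qE size_mul // uE vE addSn addnS.
  move: Kq; rewrite nE qE -hformM ?uE ?vE //.
  move=> /(KM _ _ _ _ (hform_homog X _ _) (hform_homog X _ _))[Ke|Kd].
    have := min u e; rewrite uE nE => /(_ (leqnn _) e0 Ke).
    by rewrite -{2}(addn0 u) leq_add2l leqn0 => /eqP v0; rewrite vE v0 in sd.
  have := min v d; rewrite vE nE => /(_ (leqnn _) d0 Kd).
  rewrite -{2}(add0n v) leq_add2r leqn0 => /eqP u0.
  have [c c0 ->] : exists2 c, c != 0 & e = c%:P.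
    by apply/size_poly1P; rewrite uE u0.
  by rewrite mul_polyC eqp_sym eqp_scale.
exists (cvec X *+ n), (hform n q); split=> //; first exact: hform_homog.
  by apply/eqP => /(hform_neq0 sq)/eqP; apply/negP.
apply: form_prime => // i; apply/negP => /(hform_dvd szq (size_ell i))[j [b bE]].
case: (KXn i (p i)); rewrite Xvar_pow bE.
exact: Kid (hform_homog X n q) (hform_homog X j b) Kq.
Qed.

End Primes.

(** * Finite length and nilpotency *)

Section FiniteLength.
Variables (k : fieldType) (X : wpl k).
Local Notation t := (wl_n X).+2.
Local Notation p := (@wl_weight k X).
Local Notation A := (AA X).
Local Notation L := (LL X).
Local Notation T0 := (T0 X).
Local Notation T1 := (T1 X).
Variable M : gmod X.
Implicit Types (U V W : set M) (u v w : M) (a b : A) (x y z : L).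

Lemma hcomp_scale_homog x z a u : Ahomog x a -> hcomp z (a *: u) = a *: hcomp (z - x) u.
Proof.
move=> ha; have [s [us uE]] := hcomp_sum u.
have H y : hcomp z (a *: hcomp y u) = a *: hcomp (z - x) (hcomp y u).
  have hw : hcomp (x + y) (a *: hcomp y u) = a *: hcomp y u.
    by apply: hcompZ => //; rewrite hcompK eqxx.
  rewrite -{1}hw hcompK hw hcompK subr_eq (addrC y).
  by case: eqP => // _; rewrite scaler0.
rewrite {1}uE scaler_sumr hcomp_sumE; under eq_bigr do rewrite H.
by rewrite -scaler_sumr -hcomp_sumE -uE.
Qed.

Lemma hcomp_scale y z a v : hcomp y v = v -> hcomp z (a *: v) = Ahc (z - y) a *: v.
Proof.
move=> hv; have [s [us aE]] := Ahc_sum a.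
have AhcD x b c : Ahc x (b + c) = Ahc x b + Ahc x c.
  by have := twist_hcompD 0 x b c; rewrite add0r.
have Ahc0 x : Ahc x (0 : A) = 0.
  by apply: (addIr (Ahc x (0 : A))); rewrite -AhcD !add0r.
have H x : hcomp z (Ahc x a *: v) = Ahc (z - y) (Ahc x a) *: v.
  rewrite (hcomp_scale_homog _ _ (Ahc_homog x a)) (Ahomog_Ahc _ (Ahc_homog x a)).
  rewrite -{1}hv hcompK hv !subr_eq addrC.
  by case: eqP => // _; rewrite ?scaler0 ?scale0r.
rewrite {1}aE scaler_suml hcomp_sumE; under eq_bigr do rewrite H.
by rewrite -scaler_suml -(big_morph _ (AhcD _) (Ahc0 _)) -aE.
Qed.

Lemma gsubZ U a u : gsub U -> U u -> U (a *: u).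
Proof. by case=> _ _ UZ _; apply: UZ. Qed.

Lemma gsubh U x u : gsub U -> U u -> U (hcomp x u).
Proof. by case=> _ _ _; apply. Qed.

Lemma gsub_sum U (I : Type) (s : seq I) (F : I -> M) :
  gsub U -> (forall i, U (F i)) -> U (\sum_(i <- s) F i).
Proof.
move=> gU UF; apply: (big_ind U) => [|u v|i _]; [exact: gsub0|exact: gsubD|exact: UF].
Qed.

Lemma gsub_homog_notin U v : gsub U -> ~ U v -> exists y, ~ U (hcomp y v).
Proof.
move=> gU Uv; apply: contrapT => N; apply: Uv.
have [s [_ ->]] := hcomp_sum v; apply: (gsub_sum _ gU) => y.
by apply: contrapT => NU; apply: N; exists y.
Qed.

Definition gcyc U v : set M := [set w | exists u a, U u /\ w = u + a *: v].

Lemma gsub_gcyc U v y : gsub U -> hcomp y v = v -> gsub (gcyc U v).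
Proof.
move=> gU hv; split.
- by exists 0, 0; rewrite scale0r addr0; split=> //; apply: gsub0.
- move=> _ _ [u [a [Uu ->]]] [u' [a' [Uu' ->]]]; exists (u + u'), (a + a').
  by rewrite scalerDl addrACA; split=> //; apply: gsubD.
- move=> b _ [u [a [Uu ->]]]; exists (b *: u), (b * a).
  by rewrite scalerDr scalerA; split=> //; apply: gsubZ.
- move=> z _ [u [a [Uu ->]]]; exists (hcomp z u), (Ahc (z - y) a).
  by rewrite hcompD (hcomp_scale _ _ hv); split=> //; apply: gsubh.
Qed.

Lemma gcyc_sub U v : U `<=` gcyc U v.
Proof. by move=> u Uu; exists u, 0; rewrite scale0r addr0. Qed.

Lemma gcyc_mem U v : gsub U -> gcyc U v v.
Proof. by move=> gU; exists 0, 1; rewrite scale1r add0r; split=> //; apply: gsub0. Qed.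

Lemma gcyc_min U v W : gsub W -> U `<=` W -> W v -> gcyc U v `<=` W.
Proof.
by move=> gW UW Wv _ [u [a [/UW Wu ->]]]; apply: gsubD => //; apply: gsubZ.
Qed.

(** Every monomial other than 1 contains a variable, so modulo [U] an element acts on [v] by its
    constant term. *)
Lemma scale_mod_irrelevant U v a : gsub U -> (forall i, U (Xvar i *: v)) ->
  exists c, U (a *: v - Aconst X c *: v).
Proof.
move=> gU UX; have [f ->] := Apr_surj a; exists f@_0%MM.
rewrite -scalerBl; set b := _ - _.
have -> : b = \sum_(m <- msupp f) (if m == 0%MM then 0 else Aconst X f@_m * Apr 'X_[m]).
  rewrite /b {1}(mpolyE f) Apr_sum.
  have [f0|f0] := boolP (0%MM \in msupp f).
    rewrite !(bigD1_seq 0%MM) ?msupp_uniq //= eqxx add0r AprZ mpolyX0 Apr1 mulr1 [LHS]addrC addKr.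
    by apply: eq_bigr => m /negPf ->; rewrite AprZ.
  rewrite (memN_msupp_eq0 f0) rmorph0 subr0 [LHS]big_seq [RHS]big_seq.
  apply: eq_bigr => m mf; rewrite AprZ; case: eqP => // m0.
  by rewrite m0 (negPf f0) in mf.
rewrite scaler_suml; apply: (gsub_sum _ gU) => m; case: eqP => [_|/eqP m0].
  by rewrite scale0r; apply: gsub0.
have [i mi] : exists i, m i != 0%N.
  apply: contrapT => N; case/eqP: m0; apply/mnmP => i; rewrite mnm0E.
  by apply: contrapT => /eqP mi; apply: N; exists i.
have -> : m = ((m - U_(i)) + U_(i))%MM.
  by rewrite submK //; apply/mnm_lepP => j; rewrite mnm1E; case: eqP => // <-; rewrite lt0n.
by rewrite mpolyXD AprM mulrA -scalerA; apply: gsubZ => //; apply: UX.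
Qed.

(** A simple graded module is the field in one degree: it is generated by a homogeneous [v], and the
    multiples [X_i v] generate a proper submodule for degree reasons. *)
Lemma gcover_structure U V : gcover U V ->
  (forall i v, V v -> U (Xvar i *: v)) /\
  exists y, forall z v, V v -> z <> y -> U (hcomp z v).
Proof.
move=> [gU gV UV neq cov].
have [v0 [Vv0 Uv0]] : exists v0, V v0 /\ ~ U v0.
  apply: contrapT => N; apply: neq; apply/seteqP; split=> // v Vv.
  by apply: contrapT => Uv; apply: N; exists v.
have [y Uv] := gsub_homog_notin gU Uv0; set v := hcomp y v0 in Uv.
have Vv : V v by apply: gsubh.
have hv : hcomp y v = v by rewrite hcompK eqxx.
have VE : gcyc U v = V.
  case: (cov _ (gsub_gcyc gU hv)) => //; first exact: gcyc_sub.
    exact: gcyc_min.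
  by move=> E; case: Uv; rewrite -E; apply: gcyc_mem.
have UX i : U (Xvar i *: v).
  have hw : hcomp (xvec i + y) (Xvar i *: v) = Xvar i *: v by apply: hcompZ (Xvar_homog i) hv.
  case: (cov _ (gsub_gcyc gU hw)).
  - exact: gcyc_sub.
  - by apply: gcyc_min => //; apply: gsubZ.
  - by move=> E; rewrite -[X in X _]E; apply: gcyc_mem.
  (* Otherwise [v] is, modulo [U], a multiple of [X_i v] by a coefficient of degree [- xvec i],
     which must be zero. *)
  - move=> E; case: Uv; move: (Vv); rewrite -E => -[u [a [Uu vE]]].
    move/(congr1 (hcomp y)): vE; rewrite hv hcompD (hcomp_scale _ _ hw) opprD addrCA subrr addr0.
    by rewrite (Ahomog_neg (Ahc_homog _ a)) scale0r addr0 => ->; apply: gsubh.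
split=> [i w|].
  rewrite -{1}VE => -[u [a [Uu ->]]]; rewrite scalerDr scalerA mulrC -scalerA.
  by apply: gsubD => //; apply: gsubZ.
exists y => z w; rewrite -{1}VE => -[u [a [Uu ->]]] zy; rewrite hcompD.
apply: gsubD => //; first exact: gsubh.
have [c Uc] := scale_mod_irrelevant a gU UX.
have := gsubh z gU Uc; rewrite hcompB (hcomp_scale_homog _ _ (Aconst_homog X c)) subr0.
by rewrite -{2}hv hcompK; case: eqP => // _; rewrite scaler0 subr0.
Qed.

Lemma gflen_nilpotent U V i : gflen U V -> exists n, forall v, V v -> U (Xvar i ^+ n *: v).
Proof.
elim=> [_|V' W _ [n IH] /gcover_structure[WX _]]; first by exists 0%N => v; rewrite scale1r.
by exists n.+1 => w Ww; rewrite exprSr -scalerA; apply: IH; apply: WX.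
Qed.

Lemma gflen_degrees U V : gflen U V ->
  exists s : seq L, forall z v, V v -> z \notin s -> U (hcomp z v).
Proof.
elim=> [gU|V' W fl [s IH] /gcover_structure[_ [y yE]]].
  by exists [::] => z v Uv _; apply: gsubh.
exists (y :: s) => z w Ww; rewrite inE negb_or => /andP[/eqP zy zs].
have := IH z _ (yE _ _ Ww zy) zs; by rewrite hcompK eqxx.
Qed.

Lemma gflen_gcyc U v y : gsub U -> hcomp y v = v -> (forall i, U (Xvar i *: v)) ->
  gflen U (gcyc U v).
Proof.
move=> gU hv UX; have [Uv|Uv] := pselect (U v).
  rewrite (_ : gcyc U v = U); first exact: GFlen0.
  by apply/seteqP; split; [apply: gcyc_min|apply: gcyc_sub].
apply: GFlenS (GFlen0 gU) _; split=> //.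
- exact: gsub_gcyc hv.
- exact: gcyc_sub.
- by move=> E; apply: Uv; rewrite E; apply: gcyc_mem.
- move=> W gW UW WV; have [Wv|Wv] := pselect (W v); [right|left].
    by apply/seteqP; split=> //; apply: gcyc_min.
  apply/seteqP; split=> // w Ww; have [u [a [Uu wE]]] := WV _ Ww.
  rewrite wE; apply: gsubD => //.
  have [c Uc] := scale_mod_irrelevant a gU UX.
  rewrite -(subrK (Aconst X c *: v) (a *: v)); apply: gsubD => //.
  have [->|c0] := eqVneq c 0; first by rewrite rmorph0 scale0r; apply: gsub0.
  case: Wv; rewrite -(scale1r v) -(rmorph1 (Aconst X)) -(mulVf c0) rmorphM -scalerA.
  apply: gsubZ => //.
  rewrite -(addKr (u + (a *: v - Aconst X c *: v)) (Aconst X c *: v)) -addrA subrK -wE.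
  by apply: gsubD => //; apply: gsubN => //; apply: gsubD => //; apply: UW.
Qed.

Lemma homog_gens V : gsub V -> exists s : seq M,
  (forall v, v \in s -> V v /\ exists y, hcomp y v = v) /\
  forall W, gsub W -> (forall v, v \in s -> W v) -> V `<=` W.
Proof.
move=> gV; have [s sV sE] := gsub_fin_gen gV.
have [r [rV rE]] : exists r : seq M, (forall v, v \in r -> V v /\ exists y, hcomp y v = v) /\
    forall W, gsub W -> (forall v, v \in r -> W v) -> forall v, v \in s -> W v.
  elim: s sV {sE} => [|v s IH] sV; first by exists [::].
  have [w ws|r [rV rE]] := IH; first by apply: sV; rewrite inE ws orbT.
  have [d [_ vE]] := hcomp_sum v.
  exists ([seq hcomp y v | y <- d] ++ r); split=> [w|W gW rW w].
    rewrite mem_cat => /orP[/mapP[y _ ->]|/rV//]; split.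
      by apply: gsubh => //; apply: sV; rewrite inE eqxx.
    by exists y; rewrite hcompK eqxx.
  rewrite inE => /orP[/eqP ->|]; last by apply: rE => // z zr; apply: rW; rewrite mem_cat zr orbT.
  rewrite vE big_seq; apply: (big_ind W) => [|a b|y yd]; [exact: gsub0|exact: gsubD|].
  by apply: rW; rewrite mem_cat; apply/orP; left; apply/mapP; exists y.
exists r; split=> // W gW rW v Vv.
by apply: lspan_min (gsub_submodule gW) _ _ (sE _ Vv); apply: rE.
Qed.

Lemma gflen_irrelevant U V : gsub U -> gsub V -> U `<=` V ->
  (forall i v, V v -> U (Xvar i *: v)) -> gflen U V.
Proof.
move=> gU gV UV VX; have [s [sV sE]] := homog_gens gV.
suff [W [flW UW sW WV]] : exists W, [/\ gflen U W, U `<=` W,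
    forall v, v \in s -> W v & W `<=` V].
  rewrite (_ : V = W) //; apply/seteqP; split=> //.
  by apply: sE => //; apply: gflen_gsubr flW.
elim: s sV {sE} => [|v s IH] sV; first by exists U; split=> //; apply: GFlen0.
have [w ws|W [flW UW sW WV]] := IH; first by apply: sV; rewrite inE ws orbT.
have [|Vv [y hv]] := sV v; first by rewrite inE eqxx.
have gW := gflen_gsubr flW.
exists (gcyc W v); split.
- apply: gflen_trans flW _; apply: gflen_gcyc gW hv _ => i.
  by apply: UW; apply: VX.
- by move=> u /UW; apply: gcyc_sub.
- move=> w; rewrite inE => /orP[/eqP ->|/sW]; [exact: gcyc_mem|exact: gcyc_sub].
- exact: gcyc_min.
Qed.

Definition gscale a V : set M := [set w | exists2 v, V v & w = a *: v].

Lemma gsub_gscale x a V : Ahomog x a -> gsub V -> gsub (gscale a V).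
Proof.
move=> ha gV; split.
- by exists 0; [apply: gsub0|rewrite scaler0].
- by move=> _ _ [v Vv ->] [w Vw ->]; exists (v + w); [apply: gsubD|rewrite scalerDr].
- move=> b _ [v Vv ->]; exists (b *: v); first exact: gsubZ.
  by rewrite !scalerA mulrC.
- move=> z _ [v Vv ->]; exists (hcomp (z - x) v); first exact: gsubh.
  exact: hcomp_scale_homog.
Qed.

(** The converse of [gflen_nilpotent]; it relies on the finite generation of [V], through
    [gflen_irrelevant]. *)
Lemma gflen_of_nilpotent U V : gsub U -> gsub V -> U `<=` V ->
  (forall i, exists n, forall v, V v -> U (Xvar i ^+ n *: v)) -> gflen U V.
Proof.
move=> gU gV UV nil.
(* The list holds the variables known only to be nilpotent on [V / U]; those outside it annihilate
   [V / U]. *)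
have {nil} : (forall i, i \in enum 'I_t -> exists n, forall v, V v -> U (Xvar i ^+ n *: v)) /\
    (forall i, i \notin enum 'I_t -> forall v, V v -> U (Xvar i *: v)).
  by split=> [i _|i]; [apply: nil|rewrite mem_enum].
elim: (enum _) U V gU gV UV => [|i r IH] U V gU gV UV [nil ann].
  by apply: gflen_irrelevant => // i v; apply: ann.
have [n nE] := nil i (mem_head _ _).
elim: n V gV UV nil ann nE => [|n IHn] V gV UV nil ann nE.
  rewrite (_ : V = U); first exact: GFlen0.
  by apply/seteqP; split=> // v /nE; rewrite scale1r.
have gXV := gsub_gscale (Xvar_homog i) gV.
(* On [W / U] a smaller power of [X_i] vanishes, and on [V / W] the variable itself does, so that it
   leaves the list. *)
pose W := gadd U (gscale (Xvar i) V).
have gW : gsub W by apply: gsub_gadd.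
have WV : W `<=` V.
  move=> _ [u [_ [Uu [v Vv ->] ->]]]; apply: gsubD => //; first exact: UV.
  exact: gsubZ.
apply: (gflen_trans (V := W)).
  apply: IHn => //.
  - exact: gaddl.
  - by move=> j jr; have [m mE] := nil j jr; exists m => v /WV; apply: mE.
  - by move=> j jr v /WV; apply: ann.
  - move=> _ [u [_ [Uu [v Vv ->] ->]]]; rewrite scalerDr scalerA -exprSr.
    by apply: gsubD => //; [apply: gsubZ|apply: nE].
apply: IH => //; split=> j jr.
  have [|m mE] := nil j; first by rewrite inE jr orbT.
  by exists m => v /mE; apply: gaddl.
have [->|ji] := eqVneq j i; first by move=> v Vv; apply: gaddr => //; exists v.
by move=> v Vv; apply: gaddl => //; apply: ann => //; rewrite inE negb_or ji.
Qed.

(** In a monomial of degree at least [2 n] in [T0] and [T1], one exponent is at least [n]. *)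
Lemma scale_hform U V n m q : gsub U -> (2 * n <= m)%N ->
  (forall v, V v -> U (T0 ^+ n *: v)) -> (forall v, V v -> U (T1 ^+ n *: v)) ->
  forall v, V v -> U (hform X m q *: v).
Proof.
move=> gU nm V0 V1 v Vv; rewrite /hform scaler_suml; apply: (gsub_sum _ gU) => j.
rewrite -scalerA; apply: gsubZ => //.
have [nj|jn] := leqP n j.
  by rewrite -(subnK nj) exprD mulrA -scalerA; apply: gsubZ => //; apply: V1.
have mj : (n <= m - j)%N.
  rewrite leq_subRL ?(leq_trans _ nm) // mul2n -addnn ?leq_add2r ?(ltnW jn) //.
  by rewrite (leq_trans (ltnW jn)) // leq_addr.
by rewrite mulrC -(subnK mj) exprD mulrA -scalerA; apply: gsubZ => //; apply: V0.
Qed.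

(** [X_i ^ p_i] is a linear form in [T0] and [T1], so its power [2 n] falls under [scale_hform]. *)
Lemma gflen_of_T U V n : gsub U -> gsub V -> U `<=` V ->
  (forall v, V v -> U (T0 ^+ n *: v)) -> (forall v, V v -> U (T1 ^+ n *: v)) -> gflen U V.
Proof.
move=> gU gV UV V0 V1; apply: gflen_of_nilpotent => // i.
exists (p i * (2 * n))%N => v Vv.
have [E _] := hform_exp X (2 * n) (size_ell i).
by rewrite exprM Xvar_pow E muln1; apply: (scale_hform _ gU (leqnn _) V0 V1).
Qed.

End FiniteLength.

(** * Line bundles on the weighted projective line *)

Section Shift.
Variables (k : fieldType) (X : wpl k).
Local Notation A := (AA X).
Local Notation L := (LL X).
Local Notation gmod := (gmod X).
Local Notation C := (coh_ab X).

Section ShiftModule.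
Variables (d : L) (M : gmod).

Let hc (x : L) (u : M) : M := hcomp (x - d) u.

Fact sh_hcompD x : {morph hc x : u v / u + v}.
Proof. exact: hcompD. Qed.

Fact sh_hcompK x y u : hc x (hc y u) = if x == y then hc y u else 0.
Proof. by rewrite /hc hcompK (inj_eq (addIr _)). Qed.

Fact sh_hcomp_sum u : exists s : seq L, uniq s /\ u = \sum_(x <- s) hc x u.
Proof.
have [s [us uE]] := hcomp_sum u; exists [seq x + d | x <- s]; split.
  by rewrite map_inj_uniq // => x y /addIr.
by rewrite big_map [LHS]uE; apply: eq_bigr => x _; rewrite /hc addrK.
Qed.

Fact sh_hcompZ x y a u : Ahomog x a -> hc y u = u -> hc (x + y) (a *: u) = a *: u.
Proof. by move=> ha hu; rewrite /hc -addrA; apply: hcompZ. Qed.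

(* This is M(-d) in the usual notation for shifts. *)
Definition sh : gmod :=
  GMod sh_hcompD sh_hcompK sh_hcomp_sum sh_hcompZ (gmod_fg M).

Lemma sh_gsub (U : set M) : @gsub _ _ sh U <-> gsub U.
Proof.
split=> -[U0 UD UZ Uh]; split=> // x u Uu; last exact: Uh.
by have := Uh (x + d) _ Uu; rewrite /= /hc addrK.
Qed.

Lemma sh_gflen (U V : set M) : @gflen _ _ sh U V <-> gflen U V.
Proof.
split; elim=> [gU|V' W _ IH [gV gW VW neq cov]]; try exact/GFlen0/sh_gsub.
  apply: GFlenS IH _; split=> //; [exact/sh_gsub|exact/sh_gsub|].
  by move=> Z gZ; apply: cov; apply/sh_gsub.
apply: (GFlenS IH); split=> //; [exact/sh_gsub|exact/sh_gsub|].
by move=> Z gZ; apply: cov; apply/sh_gsub.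
Qed.

End ShiftModule.

Section ShiftFrac.
Variables (d : L) (M N : gmod).

Lemma sh_gcorr (R : M -> N -> Prop) : @gcorr _ _ (sh d M) (sh d N) R <-> gcorr R.
Proof.
split=> -[R0 RD RZ Rh]; split=> // x u v Ruv; last exact: Rh.
by have := Rh (x + d) _ _ Ruv; rewrite /= !addrK.
Qed.

Definition fsh (f : frac M N) : frac (sh d M) (sh d N) :=
  @Frac _ _ (sh d M) (sh d N) (fcorr f) ((sh_gcorr _).2 (fcorr_gcorr f))
    ((@sh_gflen d M _ _).2 (fcorr_dom f)) ((@sh_gflen d N _ _).2 (fcorr_ind f)).

Definition funsh (f : frac (sh d M) (sh d N)) : frac M N :=
  @Frac _ _ M N (fcorr f) ((sh_gcorr _).1 (fcorr_gcorr f))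
    ((@sh_gflen d M _ _).1 (fcorr_dom f)) ((@sh_gflen d N _ _).1 (fcorr_ind f)).

Lemma fsh_eqv (f g : frac M N) : frac_eqv (fsh f) (fsh g) <-> frac_eqv f g.
Proof.
split=> -[U [V [flU flV Uf Ug E]]]; exists U, V; split=> //.
- exact: (@sh_gflen d M _ _).1 flU.
- exact: (@sh_gflen d N _ _).1 flV.
- exact: (@sh_gflen d M _ _).2 flU.
- exact: (@sh_gflen d N _ _).2 flV.
Qed.

Definition qsh (f : qhom M N) : qhom (sh d M) (sh d N) := qpi (fsh (repr f)).

Lemma qsh_pi (f : frac M N) : qsh (qpi f) = qpi (fsh f).
Proof. by apply/qpiP; apply/fsh_eqv; apply/qpiP; rewrite /qpi reprK. Qed.

Lemma qsh_inj (f g : qhom M N) : qsh f = qsh g -> f = g.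
Proof.
have [f' ->] := qpi_surj f; have [g' ->] := qpi_surj g; rewrite !qsh_pi.
by move=> /qpiP/fsh_eqv fg; apply/qpiP.
Qed.

Lemma qsh_full (g : qhom (sh d M) (sh d N)) : exists f, g = qsh f.
Proof.
have [g' ->] := qpi_surj g; exists (qpi (funsh g')); rewrite qsh_pi.
by apply/qpiP/frac_eqv_ext.
Qed.

End ShiftFrac.

Lemma qsh1 d (M : gmod) : qsh d (qpi (fid M)) = qpi (fid (sh d M)).
Proof. by rewrite qsh_pi; apply/qpiP/frac_eqv_ext. Qed.

Lemma qshM d (M N P : gmod) (g : qhom N P) (f : qhom M N) :
  qsh d (qcomp g f) = qcomp (qsh d g) (qsh d f).
Proof.
have [g' ->] := qpi_surj g; have [f' ->] := qpi_surj f.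
by rewrite qcomp_pi !qsh_pi qcomp_pi; apply/qpiP/frac_eqv_ext.
Qed.

Lemma ghom_iso (M N : gmod) (f : M -> N) (g : N -> M) :
  ghom f -> ghom g -> cancel f g -> cancel g f -> @iso_obj C M N.
Proof.
move=> hf hg fK gK; exists (qpi (fhom hf)), (qpi (fhom hg)).
split; rewrite /= qcomp_pi; apply/qpiP/frac_eqv_ext => u v.
  by split=> [[_ -> ->]|<-]; [rewrite /= fK|exists (f u) => //=; rewrite fK].
by split=> [[_ -> ->]|<-]; [rewrite /= gK|exists (g u) => //=; rewrite gK].
Qed.

Lemma sh_ess d (N : gmod) : exists M : gmod, @iso_obj C (sh d M) N.
Proof.
exists (sh (- d) N); apply: (@ghom_iso (sh d (sh (- d) N)) N (fun u => u) (fun u => u)) => //;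
  split=> // x u /=;
by rewrite opprK subrK.
Qed.

Section Mult.
Variables (d : L) (a : A) (ha : Ahomog d a).

Fact mult_ghom (M : gmod) : ghom (fun u : sh d M => a *: (u : M) : M).
Proof.
split=> [u v|b u|x u]; first exact: scalerDr.
  by rewrite !scalerA mulrC.
by rewrite (hcomp_scale_homog _ _ ha).
Qed.

Definition fmult (M : gmod) : frac (sh d M) M := fhom (mult_ghom M).

Lemma fmultN (M N : gmod) (f : qhom M N) :
  qcomp f (qpi (fmult M)) = qcomp (qpi (fmult N)) (qsh d f).
Proof.
have [f' ->] := qpi_surj f; rewrite qsh_pi !qcomp_pi; apply/qpiP/eqv_sub => u w [v fv ->].
by exists (a *: (u : M)) => //; case: (fcorr_gcorr f') => _ _ fZ _; apply: fZ.
Qed.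

Definition mult_twisting : twisting C :=
  @Twisting C (sh d) (@qsh d) (@qsh1 d) (@qshM d) (@qsh_inj d) (@qsh_full d)
    (@sh_ess d) (fun M => qpi (fmult M)) fmultN.

Lemma fmult_range (M : gmod) : frange (fmult M) = gscale a [set: M].
Proof.
by apply/seteqP; split=> [_ [u _ ->]|_ [u _ ->]]; exists u.
Qed.

Lemma mult_killed (M : gmod) :
  killed mult_twisting M <-> gflen [set 0] (gscale a [set: M]).
Proof. by rewrite /killed /= -fmult_range; apply: qpi_eq0. Qed.

End Mult.

Lemma gmod_zeroP (M : gmod) : @zero_obj C M <-> gflen [set 0] [set: M].
Proof.
rewrite (zero_objP (C := coh_ab X) M) -[idm _]/(qpi (fid M)) -[X in _ = X]/(0 : qhom M M) qpi_eq0.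
have -> : frange (fid M) = setT by apply/seteqP; split=> // u _; exists u.
by [].
Qed.

Section Cyclic.
Variables (M : gmod) (y : L) (v : M).
Hypotheses (hv : hcomp y v = v).

Fact cyc_ghom (x d : L) : d - x = y -> ghom (fun c : sh d (twist x) => (c : A) *: v : M).
Proof.
move=> E; split=> [a b|a b|z b].
- exact: scalerDl.
- by rewrite scalerA.
- rewrite (hcomp_scale _ _ hv) -E opprB /= addrCA; congr (Ahc _ _ *: _).
Qed.

End Cyclic.

Fact cyc0_ghom (M : gmod) (y : L) (v : M) : hcomp y v = v ->
  ghom (fun c : twist (X := X) (- y) => (c : A) *: v : M).
Proof.
move=> hv; split=> [a b|a b|z b].
- exact: scalerDl.
- by rewrite scalerA.
- by rewrite (hcomp_scale _ _ hv) addrC.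
Qed.

End Shift.

Section CohLineBundles.
Variables (k : fieldType) (X : wpl k).
Local Notation t := (wl_n X).+2.
Local Notation A := (AA X).
Local Notation L := (LL X).
Local Notation gmod := (gmod X).
Local Notation C := (coh_ab X).
Local Notation is_lb := (@line_bundle k X).

Lemma lb_isoE (M N : C) : iso_obj M N -> is_lb M -> is_lb N.
Proof.
move=> MN [x Mx]; exists x.
exact: (iso_obj_trans (C := C)) (iso_obj_sym (C := C) MN) Mx.
Qed.

Lemma sh_twist d x : @iso_obj C (sh d (twist x)) (twist (x - d)).
Proof.
apply: (@ghom_iso _ _ (sh d (twist x)) (twist (x - d)) (fun u => u) (fun u => u)) => //;
by split=> // z u; rewrite /= [x + (z - d)]addrCA [z + _]addrC.
Qed.

Lemma lb_shE d (a : A) (ha : Ahomog d a) (M : C) : is_lb (tw (mult_twisting ha) M) <-> is_lb M.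
Proof.
split=> [[x [e Ie]]|[x Mx]]; last first.
  exists (x - d); apply: (iso_obj_trans (C := C)) (sh_twist d x).
  exact: (tw_iso (mult_twisting ha)) Mx.
exists (x + d); have :
    iso_obj (tw (mult_twisting ha) M) (tw (mult_twisting ha) (twist (x + d) : C)).
  apply: (iso_obj_trans (C := C)) (ex_intro _ e Ie) _; apply: (iso_obj_sym (C := C)).
  by have := sh_twist d (x + d); rewrite addrK.
move=> [f If]; have [g gE] := twm_full f; exists g.
by apply/(twm_isoE (mult_twisting ha)); rewrite -gE.
Qed.

Lemma twist_nonzero x : ~ @zero_obj C (twist x).
Proof.
move/gmod_zeroP/(gflen_nilpotent ord_snd) => [n /(_ (1 : A) I)] E.
apply: (@T1_not_dvd k X n 0); rewrite mulr0 -exprM mulnC exprM.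
have {}E : Xvar ord_snd ^+ n = 0 :> A by rewrite -[LHS]mulr1.
by rewrite E expr0n gtn_eqF // wl_weight_gt0.
Qed.

Lemma homog_regular d (b c : A) : Ahomog d b -> b != 0 -> b * c = 0 -> c = 0.
Proof.
move=> hb b0 cb; have [s [us ->]] := Ahc_sum c; rewrite big1 // => z _.
apply/eqP; apply: contrapT => /negP cz.
have := Ahomog_domain hb (Ahc_homog z c) b0 cz.
by rewrite -(AhcM _ _ hb) cb (Ahomog_Ahc _ (Ahomog0 (d + z))) !eqxx.
Qed.

Lemma twist_mult_mono d (a : A) (ha : Ahomog d a) x : a != 0 ->
  mono (twn (mult_twisting ha) (twist x : C)).
Proof.
move=> a0; apply: coh_monoP; apply: gflen0_trivial; first exact: gsub_fker.
by move=> u /esym; apply: homog_regular ha a0.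
Qed.

(** Multiplication by [Xvar ord0] is mono; were it invertible, [Xvar ord0] would divide a power of
    [T1]. *)
Lemma twist_not_simple x : ~ @simple_obj C (twist x).
Proof.
move=> [_ sT].
have mX := @twist_mult_mono _ _ (Xvar_homog (X := X) ord0) x (Xvar_neq0 ord0).
have [Z0|/iso_epi eX] := sT _ _ mX.
  by apply: (@twist_nonzero x); apply/(tw_zeroE (mult_twisting (Xvar_homog (X := X) ord0))).
have := coh_epi_range eX; rewrite fmult_range => /(gflen_nilpotent ord_snd)[n].
move=> /(_ (1 : A) I)[c _ E].
pose q := @wl_weight k X ord_snd.
apply: (@T1_not_dvd k X n (Xvar ord0 ^+ q.-1 * c ^+ q)).
rewrite -exprM mulnC exprM mulrA -exprS prednK ?wl_weight_gt0 // -exprMn.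
by congr (_ ^+ _); rewrite -[LHS]mulr1.
Qed.

Lemma cyc_range (M : gmod) (y : L) (v : M) (hv : hcomp y v = v) :
  frange (fhom (cyc0_ghom hv)) = gcyc [set 0] v.
Proof.
apply/seteqP; split=> [_ [c _ ->]|_ [_ [c [-> ->]]]].
  by exists 0, c; rewrite add0r.
by exists c => //; rewrite add0r.
Qed.

(** If all composites from line bundles vanished, the finitely many homogeneous generators of the
    domain of a representative would have images of finite length, and so would the whole domain. *)
Lemma coh_lb_generate (M N : C) (f : mor M N) : f <> 0 ->
  exists (B : C) (w : mor B M), is_lb B /\ f \co w <> 0.
Proof.
have [f' ->] := qpi_surj f => f0; apply: contrapT => N0; apply: f0; apply/qpi_eq0.
have gD := gsub_rdom (fcorr_gcorr f').
have [s [sV sE]] := homog_gens gD.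
have {N0} fin v : v \in s -> gflen [set 0] (rimg (fcorr f') (gcyc [set 0] v)).
  move=> /sV[_ [y hv]]; apply: contrapT => nfl; apply: N0.
  exists (twist (- y) : C), (qpi (fhom (cyc0_ghom hv))); split.
    by exists (- y); apply: (iso_obj_refl (C := C)).
  by rewrite /= qcomp_pi => /qpi_eq0; rewrite frange_comp cyc_range.
have [R [flR sR]] : exists R, gflen [set 0] R /\ forall v, v \in s -> exists2 r, R r & fcorr f' v r.
  elim: s sV {sE} fin => [|v s IH] sV fin.
    by exists [set 0]; split=> //; apply/GFlen0/gsub_set0.
  have [w ws|w ws|R [flR sR]] := IH.
  - by apply: sV; rewrite inE ws orbT.
  - by apply: fin; rewrite inE ws orbT.
  have fv := fin v (mem_head _ _).
  exists (gadd (rimg (fcorr f') (gcyc [set 0] v)) R); split; first exact: gflen0_gadd.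
  move=> w; rewrite inE => /orP[/eqP ->|/sR[r Rr fr]]; last first.
    by exists r => //; apply: gaddr => //; apply: gflen_gsubr fv.
  have [[r fr] _] := sV v (mem_head _ _); exists r => //; apply: gaddl.
    exact: gflen_gsubr flR.
  by exists v => //; apply: gcyc_mem; apply: gsub_set0.
have gR := gflen_gsubr flR.
apply: gflen0_sub (gflen0_gadd flR (fcorr_ind f')); first exact: gsub_frange.
move=> z [u _ fz].
have [|||r Rr fr] := sE (rimg (rinv (fcorr f')) R) _ _ u.
- by apply: gsub_rimg => //; apply: gcorr_rinv; apply: fcorr_gcorr.
- by move=> v /sR[r Rr fr]; exists r.
- by exists z.
exists r, (z - r); split=> //; last by rewrite addrC subrK.
by have := fcorrB fz fr; rewrite subrr.
Qed.

(** A nonzero homogeneous element in the range of [T] generates a copy of a line bundle. It lies in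
    the simple [T], hence equals [T], but no line bundle is simple. *)
Lemma coh_lb_torsionfree (B T : C) (f : mor T B) : is_lb B -> simple_obj T -> ~ mono f.
Proof.
move=> [x [e Ie]] sT mf.
have {mf} := mono_comp (C := C) (iso_mono (C := C) Ie) mf.
have [g ->] := qpi_surj (e \co f) => mg.
have g0 : (qpi g : @mor C T (twist x)) <> 0.
  by move=> g0; case: sT.1; apply/zero_objP; apply: mg; rewrite g0 !comp0m.
have [u [Ru u0]] : exists u : twist x, frange g u /\ u <> 0.
  apply: contrapT => N; apply: g0; apply/qpi_eq0.
  apply: gflen0_trivial; first exact: gsub_frange.
  by move=> u Ru; apply: contrapT => u0; apply: N; exists u.
have [y uy0] := gsub_homog_notin (gsub_set0 (twist x)) u0.
set v : twist x := hcomp y u in uy0.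
have Rv : frange g v by apply: gsubh => //; apply: gsub_frange.
have hv : hcomp y v = v by rewrite hcompK eqxx.
have mw : mono (qpi (fhom (cyc0_ghom hv)) : @mor C (twist (- y)) (twist x)).
  apply: coh_monoP; apply: gflen0_trivial; first exact: gsub_fker.
  move=> c /esym; rewrite -[_ *: _]/(c * (v : A)) mulrC.
  apply: (homog_regular (d := x + y)); first exact: Ahc_homog.
  by apply/eqP => v0; apply: uy0.
have [w wE] : exists w : @mor C (twist (- y)) T,
    (qpi (fhom (cyc0_ghom hv)) : @mor C (twist (- y)) (twist x))
    = (qpi g : @mor C T (twist x)) \co w.
  have /kernelP[_ _ kU] := coh_mono_kernel (coh_mono_ker mg).
  apply: kU; rewrite /= qcomp_pi; apply/qpi_eq0; rewrite frange_comp cyc_range.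
  apply: gflen0_trivial.
    apply: gsub_rimg; first exact: fcorr_gcorr.
    exact: gsub_gcyc (gsub_set0 _) hv.
  move=> _ [_ [_ [c [-> ->]]] ->]; apply: etrans (qcl0 (gsub_frange g)).
  by apply/qclP; rewrite subr0 add0r; apply: gsubZ => //; apply: gsub_frange.
have mw' : mono w by apply: (@mono_of_comp C _ _ _ (qpi g : @mor C T (twist x))); rewrite -wE.
have [Z0|Iw] := sT.2 _ _ mw'; first exact: twist_nonzero Z0.
apply: (@twist_not_simple (- y)); apply: (simple_iso (C := C)) sT.
by apply: (iso_obj_sym (C := C)); exists w.
Qed.

End CohLineBundles.

(** * Local splitting, and the prime of a simple sheaf *)

Section CohLocal.
Variables (k : fieldType) (X : wpl k).
Local Notation t := (wl_n X).+2.
Local Notation A := (AA X).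
Local Notation L := (LL X).
Local Notation gmod := (gmod X).
Local Notation C := (coh_ab X).
Local Notation is_lb := (@line_bundle k X).

Lemma gscale_nilpotent (M : gmod) (i : 'I_t) n : gflen [set 0] (gscale (Xvar i ^+ n) [set: M]) ->
  exists m, forall v : M, Xvar i ^+ m *: v = 0.
Proof.
move=> /(gflen_nilpotent i)[m E]; exists (m + n)%N => v.
by rewrite exprD -scalerA; apply: E; exists v.
Qed.

Lemma nilpotent_zero (M : gmod) :
  (forall i : 'I_t, exists n, forall v : M, Xvar i ^+ n *: v = 0) -> @zero_obj C M.
Proof.
move=> nil; apply/gmod_zeroP; apply: gflen_of_nilpotent (gsub_set0 _) (gsubT _) _ _ => // i.
by have [n nE] := nil i; exists n => v _; apply: nE.
Qed.

(** Each power of a variable is zero or invertible on [T]. If every variable had a vanishing power,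
    [T] would have finite length as a module, that is, be zero as a sheaf. *)
Lemma simple_invertible (T : C) : simple_obj T -> exists i : 'I_t,
  forall n, is_iso (twn (mult_twisting (AhomogX n (Xvar_homog i))) T).
Proof.
move=> sT; apply: contrapT => N; case: sT.1; apply: nilpotent_zero => i.
apply: contrapT => Ni; apply: N; exists i => n; apply: simple_simple_iso => //.
  exact: (tw_simple (mult_twisting (AhomogX n (Xvar_homog i)))).
by move=> /(mult_killed (AhomogX n (Xvar_homog i)))/gscale_nilpotent; apply: Ni.
Qed.

(** As [b] is onto up to finite length, some [X_i ^ m] times the generator 1 has a preimage, and a
    homogeneous preimage defines [s]. *)
Lemma twist_local i x (E : C) (b : mor E (twist x : C)) : epi b ->
  exists m, exists s : mor (tw (mult_twisting (AhomogX m (Xvar_homog i))) (twist x : C)) E,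
    b \co s = twn (mult_twisting (AhomogX m (Xvar_homog i))) (twist x).
Proof.
have [b' ->] := qpi_surj b => /coh_epi_range/(gflen_nilpotent i)[m /(_ (1 : A) I)].
rewrite -[_ *: _]/(_ * 1) mulr1 => -[e0 _ be0].
pose d : L := xvec i *+ m; pose y : L := d - x.
pose e1 := hcomp y e0; have he1 : hcomp y e1 = e1 by rewrite hcompK eqxx.
have be1 : fcorr b' e1 (Xvar i ^+ m : A).
  have [_ _ _ bh] := fcorr_gcorr b'; have := bh y _ _ be0.
  rewrite -[hcomp y (_ : twist x)]/(Ahc (x + y) (Xvar i ^+ m)).
  by rewrite (Ahomog_Ahc _ (AhomogX m (Xvar_homog i))) /y subrKC eqxx.
exists m, (qpi (fhom (cyc_ghom he1 (erefl : d - x = y)))).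
rewrite /= qcomp_pi; apply/qpiP/eqv_sub => c _ ->; exists ((c : A) *: e1) => //.
have [_ _ bZ _] := fcorr_gcorr b'; have := bZ c _ _ be1.
by congr (fcorr b' _ _); apply: mulrC.
Qed.

Definition homog_elt := {d : L & {a : A | Ahomog d a}}.

Definition elt_twisting (h : homog_elt) : twisting C :=
  mult_twisting (proj2_sig (projT2 h)).

Definition mk_elt d (a : A) (ha : Ahomog d a) : homog_elt :=
  existT _ d (exist _ a ha).

Lemma coh_lb_local (B T E : C) (b : mor E B) : is_lb B -> simple_obj T -> epi b ->
  exists h, is_iso (twn (elt_twisting h) T) /\
    exists s : mor (tw (elt_twisting h) B) E, b \co s = twn (elt_twisting h) B.
Proof.
move=> [x [e [e' [e'e ee']]]] sT eb; have [i Ii] := simple_invertible sT.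
have eeb : epi (e \co b) by apply: (epi_comp (C := C)) => //; apply: (iso_epi (C := C)); exists e'.
have [m [s sE]] := twist_local i eeb.
exists (mk_elt (AhomogX m (Xvar_homog i))); split; first exact: Ii.
set F := elt_twisting _; exists (s \co twm F e).
have E2 : (e \co b) \co (s \co twm F e) = e \co twn F B.
  by rewrite (twnN F e) compmA; congr (_ \co _).
apply: (iso_mono (C := C) (f := e)); first by exists e'.
by rewrite -E2 !compmA.
Qed.

Section Prime.
Variable T : C.
Hypothesis sT : simple_obj T.

Let K (a : A) := gflen [set 0] (gscale a [set: T]).

(** If [a] does not kill the simple [T], it is invertible on [T]. *)
Lemma kills_mul x y (a b : A) : Ahomog x a -> Ahomog y b -> K (a * b) -> K a \/ K b.
Proof.
move=> ha hb Kab; have [Ka|Ka] := pselect (K a); [by left|right].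
have /(iso_epi (C := C)) ea : is_iso (twn (mult_twisting ha) T).
  apply: simple_simple_iso => //; first exact: (tw_simple (mult_twisting ha)).
  by move/(mult_killed ha).
have := coh_epi_range ea; rewrite fmult_range => fl.
have := rimg_gflen (fcorr_gcorr (fmult hb T)) ((sh_gflen y _ _).2 fl).
rewrite -/(frange _) fmult_range => /(gflen_trans _); apply.
apply: gflen0_sub Kab.
  apply: gsub_rimg; first exact: fcorr_gcorr.
  by apply/sh_gsub; apply: gsub_gscale ha (gsubT T).
by move=> _ [_ [v _ ->] ->]; exists v => //; rewrite scalerA mulrC.
Qed.

Lemma kills_id x y (a b : A) : Ahomog x a -> Ahomog y b -> K a -> K (a * b).
Proof.
move=> ha hb; apply: gflen0_sub; first exact: gsub_gscale (AhomogM ha hb) (gsubT T).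
by move=> _ [v _ ->]; exists (b *: v); rewrite ?scalerA.
Qed.

Lemma kills_const c : c != 0 -> ~ K (Aconst X c).
Proof.
move=> c0 Kc; case: sT.1; apply/gmod_zeroP; move: Kc.
rewrite /K (_ : gscale _ _ = setT) //; apply/seteqP; split=> // v _.
exists (Aconst X c^-1 *: v) => //.
by rewrite scalerA -rmorphM mulfV // rmorph1 scale1r.
Qed.

(** A line bundle maps onto [T], not injectively since it is not simple. By commutativity, a nonzero
    homogeneous element of the kernel kills the image. *)
Lemma kills_exists : exists x a, [/\ Ahomog x a, a != 0 & K a].
Proof.
have [B [w [[x [e [e' [e'e ee']]]] wN0]]] := coh_lb_generate (nonzero_id (C := C) sT.1).
rewrite comp1m in wN0.
have ew : epi (w \co e').
  apply: (epi_comp (C := C)); first exact: simple_to_epi.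
  by apply: (iso_epi (C := C)); exists e.
have [f fE] := qpi_surj (w \co e' : @mor C (twist x) T); rewrite fE in ew.
have flR := coh_epi_range ew.
have [u [Ku u0]] : exists u : twist x, fker f u /\ u <> 0.
  apply: contrapT => N; apply: (@twist_not_simple k X x); apply: (simple_iso (C := C)) sT.
  apply: (iso_obj_sym (C := C)); exists (qpi f); apply: (mono_epi_iso (C := C)) => //.
  apply: coh_monoP; apply: gflen0_trivial; first exact: gsub_fker.
  by move=> u Ku; apply: contrapT => u0; apply: N; exists u.
have [y uy0] := gsub_homog_notin (gsub_set0 (twist x)) u0.
pose a : A := Ahc (x + y) u; have ha : Ahomog (x + y) a by apply: Ahc_homog.
have Ka : fker f (a : twist x) by apply: (gsubh y (gsub_fker f) Ku).
exists (x + y), a; split=> //; first by apply/eqP => a0; apply: uy0.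
have := rimg_gflen (fcorr_gcorr (fmult ha T)) ((sh_gflen (x + y) _ _).2 flR).
rewrite -/(frange _) fmult_range => /(gflen_trans _); apply.
apply: gflen0_sub (fcorr_ind f).
  apply: gsub_rimg; first exact: fcorr_gcorr.
  by apply/sh_gsub; apply: gsub_frange.
move=> _ [v [c _ fcv] ->]; have [_ _ fZ _] := fcorr_gcorr f.
have := fcorrB (fZ a _ _ fcv) (fZ (c : A) _ _ Ka); rewrite scaler0 subr0.
by congr (fcorr f _ _); apply/eqP; rewrite subr_eq0; apply/eqP; apply: mulrC.
Qed.

Lemma prime_quot_simple d (h : A) (hh : Ahomog d h) x : prime_elt h -> K h ->
  @simple_obj C (quotgmod (gsub_frange (fmult hh (twist x)))).
Proof.
move=> ph Kh; set gR := gsub_frange _; split.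
  (* If the quotient vanished, [h] would divide a power of every variable; as [h] kills [T], all
     variables would be nilpotent on [T]. *)
  move/gmod_zeroP => fl; case: sT.1; apply: nilpotent_zero => i.
  have [n /(_ (qcl gR (1 : A)) I)] := gflen_nilpotent i fl; rewrite -qclZ => E.
  have /qclP := etrans E (esym (qcl0 gR)); rewrite subr0 fmult_range => -[c _ {}E].
  have {}E : Xvar i ^+ n = h * c by rewrite -[LHS]mulr1.
  have [m mE] := gflen_nilpotent i Kh; exists (m + n)%N => v.
  by rewrite exprD -scalerA E -scalerA; apply: mE; exists (c *: v).
move=> W i0; have [i ->] := qpi_surj i0 => mi.
have [[r [Rr rN0]]|N] := pselect (exists r, frange i r /\ r <> 0); last first.
  left; apply/zero_objP; apply: mi; rewrite compm0.
  have -> : (qpi i : @mor C W (quotgmod gR)) = 0; last by rewrite comp0m.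
  apply/qpi_eq0; apply: gflen0_trivial; first exact: gsub_frange.
  by move=> r Rr; apply: contrapT => r0; apply: N; exists r.
right; apply: (mono_epi_iso (C := C)) => //; apply: coh_epiP.
have gI := gsub_frange i.
have [y ry0] := gsub_homog_notin (gsub_set0 (quotgmod gR)) rN0.
have [u uE] := qcl_surj r.
pose g : A := Ahc (x + y) u; have hg : Ahomog (x + y) g by apply: Ahc_homog.
have gE : hcomp y r = qcl gR g by rewrite uE; apply: quot_hcE.
have Ig : frange i (qcl gR g) by rewrite -gE; apply: gsubh.
(* [g] has nonzero class in the quotient, so [h] does not divide it. Hence powers of [T0] and [T1]
   are combinations of [h] and [g], and they carry the quotient into the range of [i]. *)
have [[b bE]|[[n [a0 [b0 E0]]] [m [a1 [b1 E1]]]]] := ph _ _ hg.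
  case: ry0; rewrite gE; apply: etrans (qcl0 gR); apply/qclP; rewrite subr0 fmult_range.
  by exists b.
have key a b (z : quotgmod gR) : frange i ((a * h + b * g) *: z).
  have [c ->] := qcl_surj z; rewrite scalerDl; apply: gsubD => //.
    rewrite -qclZ (_ : qcl gR _ = 0); first exact: (gsub0 gI).
    apply: etrans (qcl0 gR); apply/qclP; rewrite subr0 fmult_range; exists (a * (c : A)) => //.
    by rewrite -[_ *: _]/(_ * _) -[h *: _]/(_ * _) mulrCA mulrA.
  rewrite -qclZ (_ : _ *: c = (b * (c : A)) *: (g : twist x)); last first.
    by rewrite -[_ *: _]/(_ * _) -[RHS]/(_ * _) mulrAC.
  by rewrite qclZ; apply: (gsubZ _ gI Ig).
apply: (@gflen_of_T _ _ _ _ _ (n + m)) => // z _.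
  by rewrite exprD mulrC -scalerA E0; apply: (gsubZ _ gI); apply: key.
by rewrite exprD -scalerA E1; apply: (gsubZ _ gI); apply: key.
Qed.

End Prime.

Lemma coh_lb_prime (T : C) : simple_obj T ->
  exists h, killed (elt_twisting h) T /\
    forall B : C, is_lb B -> mono (twn (elt_twisting h) B) /\
      exists Q (q : mor B Q), is_cokernel (twn (elt_twisting h) B) q /\ simple_obj Q.
Proof.
move=> sT.
have [d [h [hh h0 Kh ph]]] := prime_elt_exists (@kills_mul T sT) (@kills_id T)
  (kills_const sT) (kills_exists sT).
exists (mk_elt hh); split; first exact/(mult_killed hh).
move=> B [x [e Ie]]; set F := elt_twisting _.
have [e' [e'e ee']] := Ie.
have mB : mono (twn F B).
  apply: (mono_of_comp (C := C) (g := e)); rewrite (twnN F e).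
  apply: (mono_comp (C := C)); first exact: twist_mult_mono.
  exact: (twm_mono (F := F) (iso_mono (C := C) Ie)).
split=> //; have sQ := prime_quot_simple sT hh x ph Kh.
set Q := quotgmod _ in sQ; exists (Q : C).
pose pr : @mor C (twist x) Q := qpi (fprj (gsub_frange (fmult hh (twist x)))).
have cq : is_cokernel (twn F (twist x : C)) pr := coh_cokernel (fmult hh (twist x)).
exists (pr \co e); split=> //.
have [epr prn prU] := (cokernelP (C := C) _ _).1 cq.
apply/(cokernelP (C := C)); split.
- by apply: (epi_comp (C := C)) => //; apply: (iso_epi (C := C)).
- by rewrite -compmA (twnN F e) compmA prn comp0m.
- move=> W w wn; have [v vE] : exists v : mor (Q : C) W, w \co e' = v \co pr.
    apply: prU; apply: (iso_epi (C := C) ((twm_isoE F e).2 Ie)).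
    by rewrite comp0m -compmA -(twnN F e) compmA -(compmA w) e'e compm1.
  by exists v; rewrite compmA -vE -compmA e'e compm1.
Qed.

End CohLocal.

(** * Finiteness over a finite field *)

Lemma finite_card_finType (T : finType) : finite_card (fun _ : T => True).
Proof.
exists #|T|, (@enum_val T T); split=> [i j /enum_val_inj//|x]; split=> // _.
by exists (enum_rank x); rewrite enum_rankK.
Qed.

Lemma finite_card_prod (T U : Type) (P : T -> Prop) (Q : U -> Prop) :
  finite_card P -> finite_card Q -> finite_card (fun z : T * U => P z.1 /\ Q z.2).
Proof.
move=> fP fQ; apply: (finite_card_fibre (f := fst) _ fP) => [[x y] []//|x Px].
apply: (finite_card_inj (f := snd) _ _ fQ) => [[x' y] [[]]//|].
by move=> [x1 y1] [x2 y2] [_ /= ->] [_ /= ->] ->.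
Qed.

Section CohFinite.
Variables (k : finFieldType) (X : wpl k).
Local Notation t := (wl_n X).+2.
Local Notation A := (AA X).
Local Notation L := (LL X).
Local Notation gmod := (gmod X).
Local Notation C := (coh_ab X).
Local Notation is_lb := (@line_bundle k X).

Lemma Ahomog_finite x : finite_card (@Ahomog k X x).
Proof.
have [[m mE]|N] := pselect (exists m : 'X_{1..t}, mdegL m = x); last first.
  exists 1%N; apply: (has_card1 (a := 0)); first exact: Ahomog0.
  by move=> a; apply: Ahomog_zero => m mE; apply: N; exists m.
pose n := mquot m.
apply: (finite_card_image (A := fun _ : {ffun 'I_n.+1 -> k} => True)
  (R := fun c a => a = Xres m * hform X n (\poly_(i < n.+1) c (inord i)))).
- by move=> c a b _ -> ->.
- move=> a; rewrite -mE => /Ahomog_nf[q sq ->]; exists [ffun i : 'I_n.+1 => q`_i] => //.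
  congr (_ * hform X _ _); apply/polyP => i; rewrite coef_poly ffunE.
  by case: ltnP => ni; [rewrite inordK|rewrite nth_default // (leq_trans sq)].
- exact: finite_card_finType.
Qed.

(** With homogeneous generators the coefficients can be taken homogeneous of prescribed degree,
    which leaves finitely many. *)
Lemma hcomp_finite (M : gmod) y : finite_card (fun u : M => hcomp y u = u).
Proof.
have [s [sV sE]] := homog_gens (gsubT M).
pose dg (v : M) : L := xget 0 [set z | hcomp z v = v].
have dgE v : v \in s -> hcomp (dg v) v = v.
  by move=> /sV[_ [z zE]]; rewrite /dg; case: xgetP => [//|/(_ z)].
have gS : gsub [set u : M | lspan s u].
  have sS := lspan_submodule s; split=> /=.
  - exact: LSpan0.
  - by move=> u v; apply: submoduleD.
  - by move=> a u; apply: submoduleZ.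
  - move=> z u; elim=> [|a v w vs _ IH]; first by rewrite hcomp0; apply: LSpan0.
    by rewrite hcompD (hcomp_scale _ _ (dgE _ vs)); apply: LSpanD.
pose F (r : seq M) (m : M) := exists2 c : M -> A, (forall v, Ahomog (y - dg v) (c v)) &
  m = \sum_(v <- r) c v *: v.
have finF r : finite_card (F r).
  elim: r => [|v r IH].
    exists 1%N; apply: (has_card1 (a := 0)).
      by exists (fun=> 0) => [v|]; [apply: Ahomog0|rewrite big_nil].
    by move=> m [c _ ->]; rewrite big_nil.
  apply: (finite_card_image (R := fun z m => m = z.1 *: v + z.2) _ _
    (finite_card_prod (Ahomog_finite (y - dg v)) IH)).
    by move=> z m m' _ -> ->.
  move=> _ [c hc ->]; exists (c v, \sum_(w <- r) c w *: w); last by rewrite big_cons.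
  by split=> //; exists c.
apply: finite_card_sub (finF (undup s)) => u hu.
have /(lspan_sumP _ (undup_uniq s))[c uE] : lspan (undup s) u.
  apply: lspan_sub (sE _ gS (fun v vs => mem_lspan vs) u I) => v.
  by rewrite mem_undup.
exists (fun v => Ahc (y - dg v) (c v)) => [v|]; first exact: Ahc_homog.
rewrite -hu uE hcomp_sumE big_seq [RHS]big_seq; apply: eq_bigr => v.
by rewrite mem_undup => vs; rewrite (hcomp_scale _ _ (dgE _ vs)).
Qed.

(** Some [X_i] is invertible on [T], so a morphism from [A(x)] is determined by its values on high
    powers of [X_i], and these values all come from one finite component of [T]. *)
Lemma coh_lb_finite (B T : C) : is_lb B -> simple_obj T ->
  finite_card (fun _ : mor B T => True).
Proof.
move=> [x [e [e' [e'e ee']]]] sT.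
apply: (finite_card_inj (f := fun u : mor B T => u \co e')
  (B := fun _ : @mor C (twist x) T => True)) => //.
  by move=> u v _ _ E; rewrite -(compm1 u) -e'e compmA E -compmA e'e compm1.
have [i Ii] := simple_invertible sT.
pose dg n : L := xvec i *+ n - x.
(* The cokernel of [X_i] on [T] has finite length, hence lives in finitely many degrees, and the
   degrees [dg n] are pairwise distinct. *)
have [n0 n0E] : exists n0, forall n, (n0 <= n)%N -> forall v : T,
    hcomp (dg n.+1) v = v -> exists2 w, hcomp (dg n) w = w & v = Xvar i *: w.
  have := coh_epi_range (iso_epi (C := C) (Ii 1%N)); rewrite fmult_range expr1.
  move=> /gflen_degrees[s sE].
  have [n0 n0E] : exists n0, forall n, (n0 <= n)%N -> dg n \notin s.
    elim: s {sE} => [|y s [n0 IH]]; first by exists 0%N.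
    have [[n nE]|N] := pselect (exists n, dg n = y); last first.
      exists n0 => n /IH ns; rewrite inE negb_or ns andbT.
      by apply/eqP => E; apply: N; exists n.
    exists (maxn n0 n.+1) => m; rewrite geq_max => /andP[/IH ms nm].
    rewrite inE negb_or ms andbT -nE; apply/eqP => /addIr/xvec_inj mn.
    by rewrite mn ltnn in nm.
  exists n0 => n nn v hv.
  have [w _ wE] := sE _ v I (n0E _ (leqW nn)); rewrite hv in wE.
  exists (hcomp (dg n) w); first by rewrite hcompK eqxx.
  rewrite -hv wE (hcomp_scale_homog _ _ (Xvar_homog i)); congr (_ *: hcomp _ _).
  by rewrite /dg mulrS -(addrA (xvec i)) addrAC subrr add0r.
have descend j v : hcomp (dg (n0 + j)%N) v = v ->
    exists2 w : T, hcomp (dg n0) w = w & v = Xvar i ^+ j *: w.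
  elim: j v => [|j IH] v; first by rewrite addn0 => hv; exists v; rewrite ?scale1r.
  rewrite addnS => /n0E[|w /IH[w' hw' ->] ->]; first exact: leq_addr.
  by exists w'; rewrite // scalerA -exprS.
(* [m] stands for the value on [X_i ^ n0], which need not lie in the domain of a representative;
   only multiples by powers of [X_i] are compared. *)
pose R (m : T) (f : @mor C (twist x) T) := exists (f' : frac (twist x) T) j,
  f = qpi f' /\ fcorr f' (Xvar i ^+ (n0 + j) : A) (Xvar i ^+ j *: m).
apply: (finite_card_image (R := R) _ _ (hcomp_finite T (dg n0))).
  move=> m f1 f2 _ [f1' [j1 [-> E1]]] [f2' [j2 [-> E2]]].
  pose j := (j1 + j2)%N; pose n := (n0 + j)%N.
  have raise f' j' : (j' <= j)%N -> fcorr f' (Xvar i ^+ (n0 + j') : twist x) (Xvar i ^+ j' *: m) ->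
      fcorr f' (Xvar i ^+ n : twist x) (Xvar i ^+ j *: m).
    move=> jj E; have [_ _ fZ _] := fcorr_gcorr f'; have := fZ (Xvar i ^+ (j - j')) _ _ E.
    rewrite scalerA -[_ *: (_ : twist x)]/(_ * _) -!exprD addnCA subnK //.
  have {}E1 := raise _ _ (leq_addr _ _) E1; have {}E2 := raise _ _ (leq_addl _ _) E2.
  (* The difference relates [X_i ^ n] to 0, so it vanishes after multiplication by [X_i ^ n], which
     is invertible on [T]. *)
  pose g := fadd f1' (fopp f2').
  have gE : qpi f1' - qpi f2' = qpi g :> qhom (twist x) T.
    by rewrite -[RHS]qadd_pi -qopp_pi.
  pose F := mult_twisting (AhomogX n (Xvar_homog i)).
  apply/eqP; rewrite -subr_eq0; apply/eqP; rewrite [LHS]gE.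
  apply: (twm_eq0 (F := F)); apply: (iso_mono (C := C) (Ii n)).
  rewrite compm0 -(twnN F (qpi g : @mor C (twist x) T)) /= qcomp_pi.
  apply/qpiP/eqv_sub => c _ ->; exists (Xvar i ^+ n *: c) => //.
  have gX : fcorr g (Xvar i ^+ n : twist x) 0.
    exists (Xvar i ^+ j *: m), (- (Xvar i ^+ j *: m)); rewrite /= opprK subrr; split=> //.
  have [_ _ gZ _] := fcorr_gcorr g; have := gZ (c : A) _ _ gX; rewrite scaler0.
  by congr (fcorr g _ _); apply: mulrC.
move=> f _; have [f' ->] := qpi_surj f.
(* Some [X_i ^ l] lies in the domain of the representative; the additional power [n0] brings its
   value into the degrees where [descend] applies. *)
have [l /(_ (1 : A) I)[m fm]] := gflen_nilpotent i (fcorr_dom f').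
have [_ _ fZ fh] := fcorr_gcorr f'.
have {fm} := fh (dg (n0 + l)%N) _ _ (fZ (Xvar i ^+ n0) _ _ fm).
set z := _ *: (_ *: _); set w := hcomp _ (_ *: m).
have -> : hcomp (dg (n0 + l)%N) z = (Xvar i ^+ (n0 + l) : A).
  have -> : z = (Xvar i ^+ (n0 + l) : A).
    by rewrite /z scalerA -exprD; apply: mulr1.
  rewrite -[LHS]/(Ahc (x + dg (n0 + l)%N) _) (Ahomog_Ahc _ (AhomogX _ (Xvar_homog i))).
  by rewrite /dg subrKC eqxx.
have [|m0 hm0 ->] := descend l w; first by rewrite hcompK eqxx.
by exists m0 => //; exists f', l.
Qed.

Definition coh_lb : line_bundles C :=
  @LineBundles C is_lb (homog_elt X) (@elt_twisting k X) (@lb_isoE k X)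
    (fun h => lb_shE (proj2_sig (projT2 h))) (@coh_lb_torsionfree k X) coh_lb_finite
    (@coh_lb_generate k X) (@coh_lb_local k X) (@coh_lb_prime k X).

End CohFinite.

Theorem proposition3p5 (k : finFieldType) (X : wpl k) (L L' S S' : coh X) :
  line_bundle L -> line_bundle L' -> torsion_sheaf S -> torsion_sheaf S' ->
  [/\ short_exact L (L' \oplus S') S <->
        (exists S'' : coh X, short_exact S' S S'' /\ short_exact L L' S''),
      (forall S'' : coh X, short_exact S' S S'' -> short_exact L L' S'' ->
        [/\ finite_card (hall_set S L (L' \oplus S')),
            finite_card (fun _ : mor L' S' => True),
            finite_card (hall_set S'' S' S),
            [/\ finite_card (aut S), finite_card (aut S')
              & finite_card (aut S'')]
          & ((hall_number S L (L' \oplus S'))%:R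
             = (card_hom L' S')%:R * (hall_number S'' S' S)%:R
               * ((card_aut S')%:R * (card_aut S'')%:R / (card_aut S)%:R)
             :> rat)%R])
    & indecomposable S -> short_exact L (L' \oplus S') S ->
        (iso_obj S S' -> hall_number S L (L' \oplus S') = card_hom L S)
        /\ (~ iso_obj S S' -> hall_number S L (L' \oplus S') = card_aut S')].
Proof.
move=> lL lL' flS flS'.
have cop := @dsum_coproduct k X L' S'.
split.
- exact: (@ses_sumE (coh_ab X) (coh_lb X) L L' S S' _ _ _ lL lL' flS' cop).
- exact: (@hall_sum_rat (coh_ab X) (coh_lb X) L L' S S' _ _ _ lL lL' flS flS' cop).
- move=> iS sLS; split.
    exact: (@hall_sum_indec_iso (coh_ab X) (coh_lb X) L L' S S' _ _ _ lL lL' flS flS' cop).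
  exact: (@hall_sum_indec_niso (coh_ab X) (coh_lb X) L L' S S' _ _ _ lL lL' flS flS' cop).
Qed.
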